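(* There is a universal constant $\varepsilon_0>0$ and a randomized algorithm that, given query access to an $n$-point metric $w$ with positive integer entries together with an arbitrary minimum spanning tree of the complete graph $G_w$ (including its edge weights), performs $\tilde O(n^{1.5})$ distance queries and with high probability outputs a value $X$ with $\mathsf{TSP}(w)\le X\le(2-\varepsilon_0)\,\mathsf{TSP}(w)$.
   Context: Query access means that the algorithm may query any entry $w(u,v)$ of the $n\times n$ distance matrix. $G_w$ is the complete graph on the $n$ points with edge weights $w$; $\mathsf{TSP}(w)$ is the minimum weight of a Hamiltonian cycle in $G_w$. $\tilde O$ hides polylogarithmic factors in $n$. *)

(* Defs.v *)
From mathcomp Require Import all_boot all_order all_algebra all_fingroup.
Set Implicit Arguments. Unset Strict Implicit. Unset Printing Implicit Defensive.
Import Order.TTheory GRing.Theory Num.Theory.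

Definition is_int_metric (n : nat) (w : 'I_n -> 'I_n -> nat) : Prop :=
  [/\ (forall u, w u u = 0%N),
      (forall u v, u != v -> (0 < w u v)%N),
      (forall u v, w u v = w v u) &
      (forall u v x, (w u x <= w u v + w v x)%N)].

Definition tree_rel (n : nat) (T : seq ('I_n * 'I_n)) : rel 'I_n :=
  fun u v => ((u, v) \in T) || ((v, u) \in T).

Definition is_spanning_tree (n : nat) (T : seq ('I_n * 'I_n)) : Prop :=
  size T = n.-1 /\ forall u v, connect (tree_rel T) u v.

Definition tree_weight (n : nat) (w : 'I_n -> 'I_n -> nat) (T : seq ('I_n * 'I_n)) : nat :=
  \sum_(e <- T) w e.1 e.2.

Definition is_MST (n : nat) (w : 'I_n -> 'I_n -> nat) (T : seq ('I_n * 'I_n)) : Prop :=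
  is_spanning_tree T /\
  forall T', is_spanning_tree T' -> (tree_weight w T <= tree_weight w T')%N.

Definition tour_cost (n : nat) (w : 'I_n -> 'I_n -> nat) (p : {perm 'I_n}) : nat :=
  \sum_(i < n) w (p i) (p (ordS i)).

Definition TSP (n : nat) (w : 'I_n -> 'I_n -> nat) : nat :=
  tour_cost w [arg min_(p < (1%g : {perm 'I_n})) tour_cost w p].

(* A randomized query program on n points: it may return a (rational) value,
   query the distance w u v and continue depending on the answer, or flip a
   fair coin and continue depending on the outcome. Local computation is free
   (standard query model). *)
Inductive qprog (n : nat) : Type :=
  | Ret of rat
  | Query of 'I_n & 'I_n & (nat -> qprog n)
  | Coin of (bool -> qprog n).

Fixpoint num_queries (n : nat) (w : 'I_n -> 'I_n -> nat) (P : qprog n) : nat :=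
  match P with
  | Ret _ => 0%N
  | Query u v k => (num_queries w (k (w u v))).+1
  | Coin k => maxn (num_queries w (k true)) (num_queries w (k false))
  end.

Fixpoint success_prob (n : nat) (w : 'I_n -> 'I_n -> nat) (good : rat -> bool)
    (P : qprog n) : rat :=
  match P with
  | Ret x => if good x then 1%R else 0%R
  | Query u v k => success_prob w good (k (w u v))
  | Coin k => ((success_prob w good (k true) + success_prob w good (k false)) / 2%:R)%R
  end.

(* An algorithm: given n and the MST as a list of edges with their weights
   (u, v, w u v), produces a randomized query program. *)
Definition algorithm := forall n : nat, seq ('I_n * 'I_n * nat) -> qprog n.

Definition mst_input (n : nat) (w : 'I_n -> 'I_n -> nat) (T : seq ('I_n * 'I_n)) :
  seq ('I_n * 'I_n * nat) := [seq (e.1, e.2, w e.1 e.2) | e <- T].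

(* Main.v *)
(** Let M be the weight of the given spanning tree; since M <= TSP <= 2M, it is enough to tell
    apart the cases TSP <= (1 + delta) M and TSP > (2 - eps) M: the algorithm then answers
    (2 - eps) M or 2M.  Root the tree and identify a vertex x with the edge from x to its parent.

    Near 2M.  Adding to the tree a subset of a family of chords and doubling the remaining
    uncovered edges gives Eulerian multigraphs; averaging over the subsets and choosing the chords
    greedily yields a set C of tree edges of weight at most 202 (2M - TSP) such that, outside C,
    tree distances exceed w by a factor at most 1.01.  So every local witness that the tree is a
    bad approximation of w must be paid for by C.

    Near M.  Three kinds of witnesses are looked for at an edge x drawn with probability
    proportional to its weight.
    (1) Long: a point far below x is close to a point which is not below x.
    (2) Replaceable: cut the tree at all edges of weight at least t; the two parts joined by x,
    which has weight about t, contain two points at distance about t that are much farther apart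
    in the tree.
    (3) Conflict: at the scale of x, two parts not adjacent in the tree have points at distance
    about t.  The conflict graph has a small vertex cover if C is light, so the number of
    vertices killed in a random greedy maximal independent set is used as a test; its status at a
    random vertex is computed after exploring about sqrt n steps explicitly and the others lazily,
    for an expected number of rows of order sqrt n.
    All distances are read row by row from net points, and the expected number of rows is
    polylogarithmic for (1) and (2).  Conversely, every tree edge is crossed by at least two hops
    of a tour; if the tour has length close to M, a constant fraction of the tree weight is
    covered by hops that are much shorter than the tree path between their ends, and these hops
    provide the witnesses.

    The thresholds t form a geometric grid whose offset is chosen so that few tree edges have
    weight just below a threshold; distances are scaled by a constant to make the grid integral.
    No attempt is made to optimise the constants. *)

Require Import Defs.
From mathcomp Require Import all_boot all_order all_algebra all_fingroup.
From mathcomp Require Import zify ring lra.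
Import Order.TTheory GRing.Theory Num.Theory.

Set Implicit Arguments. Unset Strict Implicit. Unset Printing Implicit Defensive.

(** * Randomized query programs *)

Local Open Scope ring_scope.

Section Averages.

(** All tests are compared through one number, the success probability of a single base experiment.
    Soundness bounds it by a constant times the share of the tree weight lying in [C]; completeness
    bounds it below by a constant [dl]. So [eps] can be fixed after the constants of the experiment,
    and repetition with a vote separates the two cases.

    Completeness rests on a deficit: the hops cover every tree edge twice, that is 2M in all,
    whereas an unremarkable hop covers at most 3/2 of its own length and the lengths add up to about
    M. A constant fraction of M is left to remarkable hops.

    The obstacle is that a short tour bounds the excess (hops of length at least t minus tree edges
    of weight at least t) only after summation over t, while the accounting needs it at the
    thresholds. The excess at a threshold is larger than slightly below it by at most the number of
    tree edges in between; hence the choice of the offset.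

    The prefix of about sqrt n steps balances k explored steps against R / k for the lazy
    evaluation, where R must be of order n for nearly all vertices to be decided. *)

Definition avg (k : nat) (f : nat -> rat) : rat :=
  (\sum_(i < 2 ^ k) f i) / (2 ^ k)%:R.

Lemma avgS k f :
  avg k.+1 f = (avg k (fun i => f (2 ^ k + i)%N) + avg k f) / 2%:R.
Proof.
rewrite /avg.
have -> : \sum_(i < 2 ^ k.+1) f i =
    \sum_(i < 2 ^ k) f i + \sum_(i < 2 ^ k) f (2 ^ k + i)%N.
  have e : (2 ^ k.+1 = 2 ^ k + 2 ^ k)%N by rewrite expnS mul2n addnn.
  rewrite -(big_mkord xpredT f) -(big_mkord xpredT f).
  rewrite -(big_mkord xpredT (fun i => f (2 ^ k + i)%N)) e.
  rewrite (@big_cat_nat _ _ _ (2 ^ k)) //= ?leq_addr //; congr (_ + _).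
  rewrite -{1}[(2 ^ k)%N]add0n big_addn addnK; apply: eq_bigr => i _.
  by rewrite addnC.
have h : (2 ^ k)%:R != 0 :> rat by rewrite pnatr_eq0 expn_eq0.
by rewrite expnS natrM; field.
Qed.

Variable X : Type.
Implicit Types (s : seq X) (f g : option X -> rat).

(** Fair coins cannot produce a uniform element of a list of arbitrary length. A draw takes a
    uniform index below the next power of two and yields [None] past the end, so that every position
    has probability exactly [drawq s], at least half of the uniform one. *)
Definition drawk s := up_log 2 (size s).
Definition drawq s : rat := ((2 ^ drawk s)%:R)^-1.

Definition Ed s f : rat := avg (drawk s) (fun i => f (onth s i)).

Lemma drawq_gt0 s : 0 < drawq s.
Proof. by rewrite invr_gt0 ltr0n expn_gt0. Qed.

Lemma drawq_le1 s : drawq s <= 1.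
Proof.
by rewrite invf_le1 ?ltr0n ?expn_gt0 // ler1n expn_gt0.
Qed.

Lemma size_drawk s : (size s <= 2 ^ drawk s)%N.
Proof. exact: up_logP. Qed.

Lemma drawq_size s : drawq s * (size s)%:R <= 1.
Proof.
rewrite mulrC ler_pdivrMr ?ltr0n ?expn_gt0 // mul1r ler_nat.
exact: size_drawk.
Qed.

Lemma drawq_size_lb s : (0 < size s)%N -> 1 <= 2%:R * drawq s * (size s)%:R.
Proof.
move=> s0; have p0 : 0 < (2 ^ drawk s)%:R :> rat by rewrite ltr0n expn_gt0.
rewrite /drawq mulrAC ler_pdivlMr // mul1r -natrM ler_nat.
have [s1|s1] := ltnP 1 (size s); last first.
  by rewrite /drawk; have -> : size s = 1%N by lia.
have /andP[] := up_log_bounds (isT : (1 < 2)%N) s1; rewrite -/(drawk s).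
have : (0 < drawk s)%N by rewrite /drawk up_log_gt0.
case: (drawk s) => // k _ /= h _; rewrite expnS; lia.
Qed.

Lemma EdE s f :
  Ed s f = drawq s * (\sum_(x <- s) f (Some x)) +
           (1 - drawq s * (size s)%:R) * f None.
Proof.
rewrite /Ed /avg -/(drawq s).
rewrite -(big_mkord xpredT (fun i => f (onth s i))).
rewrite (@big_cat_nat _ _ _ (size s)) ?size_drawk //=.
have -> : \sum_(0 <= i < size s) f (onth s i) = \sum_(x <- s) f (Some x).
  elim: (s) => [|x s' IH]; first by rewrite !big_nil.
  by rewrite [RHS]big_cons big_nat_recl //= IH.
have -> : \sum_(size s <= i < 2 ^ drawk s) f (onth s i) =
    ((2 ^ drawk s)%:R - (size s)%:R) * f None.
  rewrite -natrB ?size_drawk // mulr_natl.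
  have -> : \sum_(size s <= i < 2 ^ drawk s) f (onth s i) =
     \sum_(size s <= i < 2 ^ drawk s) f None.
    apply: eq_big_nat => i /andP[hi _]; congr f.
    by rewrite onth_default.
  by rewrite sumr_const_nat.
have h : (2 ^ drawk s)%:R != 0 :> rat by rewrite pnatr_eq0 expn_eq0.
by rewrite /drawq; field.
Qed.

Lemma Ed_le s f g : (forall x, f x <= g x) -> Ed s f <= Ed s g.
Proof.
move=> h; rewrite /Ed /avg ler_wpM2r ?invr_ge0 ?ler0n //.
by apply: ler_sum => i _; apply: h.
Qed.

Lemma Ed_cst s c : Ed s (fun=> c) = c.
Proof.
rewrite EdE big_const_seq count_predT iter_addr_0 -[c *+ _]mulr_natr; ring.
Qed.

Lemma EdD s f g : Ed s (fun x => f x + g x) = Ed s f + Ed s g.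
Proof. by rewrite /Ed /avg -mulrDl big_split. Qed.

Lemma EdZ s c f : Ed s (fun x => c * f x) = c * Ed s f.
Proof. by rewrite /Ed /avg mulrA big_distrr. Qed.

Lemma eq_Ed s f g : f =1 g -> Ed s f = Ed s g.
Proof. by move=> h; rewrite /Ed /avg; congr (_ / _); apply: eq_bigr => i _; rewrite h. Qed.

(* The latest draw is the head of the list. *)
Fixpoint En s (R : nat) (F : seq (option X) -> rat) : rat :=
  if R is R'.+1 then En s R' (fun l => Ed s (fun y => F (y :: l))) else F [::].

Lemma En_le s R F G : (forall l, size l = R -> F l <= G l) -> En s R F <= En s R G.
Proof.
elim: R F G => [|R IH] F G h /=; first exact: h.
by apply: IH => l hl; apply: Ed_le => y; apply: h; rewrite /= hl.
Qed.

Lemma eq_En s R F G : (forall l, size l = R -> F l = G l) -> En s R F = En s R G.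
Proof.
move=> h; apply/eqP; rewrite eq_le; apply/andP.
by split; apply: En_le => l hl; rewrite h.
Qed.

Lemma En_cst s R c : En s R (fun=> c) = c.
Proof.
elim: R => //= R IH; rewrite -[RHS]IH; apply: eq_En => l _; exact: Ed_cst.
Qed.

Lemma EnD s R F G : En s R (fun l => F l + G l) = En s R F + En s R G.
Proof.
elim: R F G => //= R IH F G; rewrite -IH; apply: eq_En => l _; exact: EdD.
Qed.

Lemma EnZ s R c F : En s R (fun l => c * F l) = c * En s R F.
Proof.
elim: R F => //= R IH F; rewrite -IH; apply: eq_En => l _; exact: EdZ.
Qed.

Lemma En_sum s R (I : Type) (r : seq I) F :
  En s R (fun l => \sum_(i <- r) F i l) = \sum_(i <- r) En s R (F i).
Proof.
elim: r => [|i r IH].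
  by rewrite big_nil -[RHS](En_cst s R); apply: eq_En => l _; rewrite big_nil.
rewrite big_cons -IH -EnD; apply: eq_En => l _; by rewrite big_cons.
Qed.

Lemma Ed_sum s (I : Type) (r : seq I) F :
  Ed s (fun l => \sum_(i <- r) F i l) = \sum_(i <- r) Ed s (F i).
Proof.
elim: r => [|i r IH].
  by rewrite big_nil -[RHS](Ed_cst s); apply: eq_Ed => l; rewrite big_nil.
rewrite big_cons -IH -EdD; apply: eq_Ed => l; by rewrite big_cons.
Qed.

End Averages.

Section Programs.
Variable n : nat.
Implicit Types (w : 'I_n -> 'I_n -> nat).

Fixpoint coins (k : nat) (f : nat -> qprog n) : qprog n :=
  if k is k'.+1
  then Coin (fun b => coins k' (fun i => f (if b then 2 ^ k' + i else i)%N))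
  else f 0%N.

Lemma success_coins w good k f :
  success_prob w good (coins k f) = avg k (fun i => success_prob w good (f i)).
Proof.
elim: k f => [|k IH] f /=; first by rewrite /avg expn0 big_ord1 divr1.
by rewrite !IH avgS.
Qed.

Lemma queries_coins w k f B :
  (forall i, num_queries w (f i) <= B)%N -> (num_queries w (coins k f) <= B)%N.
Proof.
by elim: k f => [|k IH] f h /=; [exact: h | rewrite geq_max !IH].
Qed.

Definition draw X (s : seq X) (f : option X -> qprog n) : qprog n :=
  coins (drawk s) (fun i => f (onth s i)).

Lemma success_draw w good X (s : seq X) f :
  success_prob w good (draw s f) = Ed s (fun y => success_prob w good (f y)).
Proof. exact: success_coins. Qed.

Fixpoint draws X (s : seq X) (R : nat) (f : seq (option X) -> qprog n) : qprog n :=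
  if R is R'.+1 then draws s R' (fun l => draw s (fun y => f (y :: l)))
  else f [::].

Lemma success_draws w good X (s : seq X) R f :
  success_prob w good (draws s R f) = En s R (fun l => success_prob w good (f l)).
Proof.
elim: R f => //= R IH f; rewrite IH; apply: eq_En => l _; exact: success_draw.
Qed.

Lemma queries_draws w X (s : seq X) R f B :
  (forall l, num_queries w (f l) <= B)%N -> (num_queries w (draws s R f) <= B)%N.
Proof.
elim: R f => [|R IH] f h /=; first exact: h.
by apply: IH => l; apply: queries_coins => i; apply: h.
Qed.

(* Programs whose elementary query returns a whole row of the distance matrix. *)
Inductive rprog (A : Type) : Type :=
  | RRet of A
  | RRow of 'I_n & ({ffun 'I_n -> nat} -> rprog A).

Fixpoint rbind A B (p : rprog A) (f : A -> rprog B) : rprog B :=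
  match p with
  | RRet a => f a
  | RRow v k => RRow v (fun row => rbind (k row) f)
  end.

Definition wrow w v : {ffun 'I_n -> nat} := [ffun u => w v u].

Fixpoint rrun w A (p : rprog A) : A :=
  match p with
  | RRet a => a
  | RRow v k => rrun w (k (wrow w v))
  end.

Fixpoint rcost w A (p : rprog A) : nat :=
  match p with
  | RRet _ => 0
  | RRow v k => (rcost w (k (wrow w v))).+1
  end.

Lemma rrun_bind w A B (p : rprog A) (f : A -> rprog B) :
  rrun w (rbind p f) = rrun w (f (rrun w p)).
Proof. by elim: p => //= v k IH; rewrite IH. Qed.

Lemma rcost_bind w A B (p : rprog A) (f : A -> rprog B) :
  rcost w (rbind p f) = (rcost w p + rcost w (f (rrun w p)))%N.
Proof. by elim: p => //= v k IH; rewrite IH addSn. Qed.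

Fixpoint rexplore (vs : seq 'I_n) : rprog (seq {ffun 'I_n -> nat}) :=
  if vs is v :: vs'
  then RRow v (fun row => rbind (rexplore vs') (fun rows => RRet (row :: rows)))
  else RRet [::].

Lemma rrun_explore w vs : rrun w (rexplore vs) = [seq wrow w v | v <- vs].
Proof. by elim: vs => //= v vs IH; rewrite rrun_bind IH. Qed.

Lemma rcost_explore w vs : rcost w (rexplore vs) = size vs.
Proof. by elim: vs => //= v vs IH; rewrite rcost_bind /= addn0 IH. Qed.

Fixpoint qrow (v : 'I_n) (us : seq 'I_n) (acc : {ffun 'I_n -> nat})
    (k : {ffun 'I_n -> nat} -> qprog n) : qprog n :=
  if us is u :: us'
  then Query v u (fun a =>
         qrow v us' [ffun x => if x == u then a else acc x] k)
  else k acc.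

Lemma qrowE w v (us : seq 'I_n) (acc : {ffun 'I_n -> nat}) k :
  let row : {ffun 'I_n -> nat} :=
    [ffun x => if x \in us then w v x else acc x] in
  (forall good, success_prob w good (qrow v us acc k) = success_prob w good (k row)) /\
  num_queries w (qrow v us acc k) = (size us + num_queries w (k row))%N.
Proof.
elim: us acc => [|u us IH] acc /=.
  by have -> : [ffun x => if x \in [::] then w v x else acc x] = acc
    by apply/ffunP => x; rewrite ffunE.
have [IH1 IH2] := IH [ffun x => if x == u then w v u else acc x].
have e : [ffun x => if x \in us then w v x
          else [ffun x => if x == u then w v u else acc x] x] =
         [ffun x => if x \in u :: us then w v x else acc x] :> {ffun 'I_n -> nat}.
  apply/ffunP => x; rewrite !ffunE inE.
  by have [->|_] := eqVneq x u; case: ifP.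
rewrite e in IH1 IH2.
by split => [good|]; rewrite ?IH1 ?IH2 ?addSn.
Qed.

(** Only expected numbers of rows are small, while queries are bounded on every run; the fuel
    enforces a worst-case bound, and [None] reports that it ran out. A row costs [n] queries. *)
Fixpoint rtrans A (fuel : nat) (p : rprog A) (k : option A -> qprog n) {struct p} : qprog n :=
  match p with
  | RRet a => k (Some a)
  | RRow v c =>
      if fuel is f.+1
      then qrow v (enum 'I_n) [ffun=> 0%N] (fun row => rtrans f (c row) k)
      else k None
  end.

Lemma rtransE w A fuel (p : rprog A) k :
  let res := if (rcost w p <= fuel)%N then Some (rrun w p) else None in
  (forall good, success_prob w good (rtrans fuel p k) = success_prob w good (k res)) /\
  (num_queries w (rtrans fuel p k) <= fuel * n + num_queries w (k res))%N.
Proof.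
elim: p fuel => [a|v c IH] fuel /=; first by split => //; apply: leq_addl.
case: fuel => [|f] /=; first by split.
have [h1 h2] := qrowE w v (enum 'I_n) [ffun=> 0%N] (fun row => rtrans f (c row) k).
have e : [ffun x => if x \in enum 'I_n then w v x else [ffun=> 0%N] x] = wrow w v.
  by apply/ffunP => x; rewrite !ffunE mem_enum.
rewrite e in h1 h2; have [IH1 IH2] := IH (wrow w v) f.
split => [good|]; first by rewrite h1 IH1.
rewrite h2 size_enum_ord mulSn -addnA leq_add2l; exact: IH2.
Qed.

(** A Bernoulli experiment in continuation-passing style. Since the second clause holds for every
    continuation, consecutive experiments behave as independent ones, which is all that repetition
    and voting need. *)
Definition is_exp w (e : (bool -> qprog n) -> qprog n) (p : rat) (B : nat) : Prop :=
  [/\ 0 <= p <= 1,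
      forall good k, success_prob w good (e k) =
        p * success_prob w good (k true) + (1 - p) * success_prob w good (k false) &
      forall k b, (num_queries w (k true) <= b)%N -> (num_queries w (k false) <= b)%N ->
        (num_queries w (e k) <= B + b)%N].

(** Exhausted fuel counts as [false]: truncation creates no false positive and is paid for in
    completeness only. *)
Definition rexp fuel (p : rprog bool) : (bool -> qprog n) -> qprog n :=
  fun k => rtrans fuel p (fun ob => k (odflt false ob)).

Lemma rexpP w fuel p :
  is_exp w (rexp fuel p)
    ((rcost w p <= fuel)%N && rrun w p)%:R (fuel * n).
Proof.
split => [|good k|k b hb1 hb2].
- by case: (_ && rrun w p).
- have [-> _] := rtransE w fuel p (fun ob => k (odflt false ob)).
  case: (rcost w p <= fuel)%N => /=; last by ring.
  by case: (rrun w p) => /=; ring.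
- have [_ h] := rtransE w fuel p (fun ob => k (odflt false ob)).
  apply: leq_trans h _; rewrite leq_add2l.
  by case: (odflt _ _).
Qed.

Lemma Ed_bounds X (s : seq X) (f : option X -> rat) :
  (forall y, 0 <= f y <= 1) -> 0 <= Ed s f <= 1.
Proof.
move=> h; apply/andP; split.
  by rewrite -(Ed_cst s 0); apply: Ed_le => y; have /andP[] := h y.
by rewrite -(Ed_cst s 1); apply: Ed_le => y; have /andP[] := h y.
Qed.

Lemma En_bounds X (s : seq X) R (f : seq (option X) -> rat) :
  (forall y, 0 <= f y <= 1) -> 0 <= En s R f <= 1.
Proof.
move=> h; apply/andP; split.
  by rewrite -(En_cst s R 0); apply: En_le => y _; have /andP[] := h y.
by rewrite -(En_cst s R 1); apply: En_le => y _; have /andP[] := h y.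
Qed.

Lemma exp_draw w X (s : seq X) e p B :
  (forall y, is_exp w (e y) (p y) B) ->
  is_exp w (fun k => draw s (fun y => e y k)) (Ed s p) B.
Proof.
move=> h; split => [|good k|k b hb1 hb2].
- by apply: Ed_bounds => y; have [] := h y.
- rewrite success_draw.
  have -> : Ed s (fun y => success_prob w good (e y k)) =
    Ed s (fun y => success_prob w good (k false) +
      (success_prob w good (k true) - success_prob w good (k false)) * p y).
    by apply: eq_Ed => y; have [_ -> _] := h y; ring.
  by rewrite EdD Ed_cst EdZ; ring.
- by apply: queries_coins => i; have [_ _ ->] := h (onth s i).
Qed.

Lemma exp_draws w X (s : seq X) R e p B :
  (forall l, is_exp w (e l) (p l) B) ->
  is_exp w (fun k => draws s R (fun l => e l k)) (En s R p) B.
Proof.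
move=> h; split => [|good k|k b hb1 hb2].
- by apply: En_bounds => y; have [] := h y.
- rewrite success_draws.
  have -> : En s R (fun y => success_prob w good (e y k)) =
    En s R (fun y => success_prob w good (k false) +
      (success_prob w good (k true) - success_prob w good (k false)) * p y).
    by apply: eq_En => y _; have [_ -> _] := h y; ring.
  by rewrite EnD En_cst EnZ; ring.
- by apply: queries_draws => i; have [_ _ ->] := h i.
Qed.

Definition exp_or (e1 e2 : (bool -> qprog n) -> qprog n) : (bool -> qprog n) -> qprog n :=
  fun k => e1 (fun b => if b then k true else e2 k).

Lemma exp_orP w e1 e2 p1 p2 B1 B2 :
  is_exp w e1 p1 B1 -> is_exp w e2 p2 B2 ->
  is_exp w (exp_or e1 e2) (1 - (1 - p1) * (1 - p2)) (B1 + B2).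
Proof.
move=> [/andP[h10 h11] h12 h13] [/andP[h20 h21] h22 h23]; split.
- by apply/andP; split; nra.
- by move=> good k; rewrite /exp_or h12 h22; ring.
- move=> k b hb1 hb2; rewrite -addnA; apply: h13; last exact: h23.
  exact: leq_trans hb1 (leq_addl _ _).
Qed.

Fixpoint exp_rep (m : nat) e : (bool -> qprog n) -> qprog n :=
  if m is m'.+1 then exp_or e (exp_rep m' e) else fun k => k false.

Lemma exp_repP w e p B m : is_exp w e p B ->
  is_exp w (exp_rep m e) (1 - (1 - p) ^+ m) (m * B).
Proof.
move=> h; elim: m => [|m IH] /=.
  split; [by rewrite expr0 subrr lexx ler01 | |].
    by move=> good k; rewrite expr0; ring.
  by move=> k b _ hb; rewrite add0n.
have := exp_orP h IH; rewrite mulSn exprS.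
by have -> : 1 - (1 - p) * (1 - (1 - (1 - p) ^+ m)) = 1 - (1 - p) * (1 - p) ^+ m by ring.
Qed.

(** [s] is the number of positive outcomes still missing; truncated subtraction keeps it at 0 once
    the quota is reached. *)
Fixpoint majority (m s : nat) e (k : bool -> qprog n) : qprog n :=
  match m with
  | 0 => k (s == 0%N)
  | m'.+1 => e (fun b => majority m' (s - b) e k)
  end.

Lemma queries_majority w e p B m s k b : is_exp w e p B ->
  (forall c, num_queries w (k c) <= b)%N ->
  (num_queries w (majority m s e k) <= m * B + b)%N.
Proof.
move=> [_ _ h] hb; elim: m s => [|m IH] s /=; first by rewrite add0n.
by rewrite mulSn -addnA; apply: h.
Qed.

Lemma success_range w good (P : qprog n) : 0 <= success_prob w good P <= 1.
Proof.
elim: P => [x|u v k IH|k IH] /=; first by case: ifP.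
  exact: IH.
have /andP[? ?] := IH true; have /andP[? ?] := IH false.
by apply/andP; split; lra.
Qed.

(* Exponential moment of the number of wrong answers. *)
Lemma majority_no w good e p B m s k : is_exp w e p B ->
  success_prob w good (k false) = 1 ->
  1 - success_prob w good (majority m s e k) <= (1 + 7%:R * p) ^+ m / 8%:R ^+ s.
Proof.
move=> [/andP[p0 p1] h _] hk; elim: m s => [|m IH] s /=.
  rewrite expr0; case: s => [|s] /=.
    by have /andP[? ?] := success_range w good (k true); rewrite expr0; lra.
  by rewrite hk subrr divr_ge0 // exprn_ge0.
rewrite h subn0 exprS.
have h1 := IH (s - 1)%N; have h0 := IH s.
set a := success_prob _ _ _ in h1 *; set b := success_prob _ _ _ in h0 *.
have e0 : 0 <= (1 + 7%:R * p) ^+ m by apply: exprn_ge0; lra.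
have s0 : 0 < (8%:R ^+ s)^-1 :> rat by rewrite invr_gt0 exprn_gt0.
have h1' : 1 - a <= 8%:R * ((1 + 7%:R * p) ^+ m / 8%:R ^+ s).
  apply: le_trans h1 _; rewrite mulrCA ler_wpM2l //.
  case: (s) => [|s']; first by rewrite expr0 invr1; lra.
  by rewrite subn1 /= exprS invfM mulrA divff // mul1r.
set z := _ / _ in h0 h1'; have -> : (1 + 7%:R * p) * (1 + 7%:R * p) ^+ m / 8%:R ^+ s = (1 + 7%:R * p) * z by rewrite /z mulrA.
nra.
Qed.

(** The same exponential moment for the negative outcomes: the vote fails only if at least
    [m.+1 - s] of them occur. Writing [8 ^ s] in the numerator avoids a truncated subtraction in the
    exponent. *)
Lemma majority_yes w good e p B m s k : is_exp w e p B ->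
  success_prob w good (k true) = 1 ->
  1 - success_prob w good (majority m s e k) <=
    (1 + 7%:R * (1 - p)) ^+ m * 8%:R ^+ s / 8%:R ^+ m.+1.
Proof.
move=> [/andP[p0 p1] h _] hk; have q0 : 0 <= 1 - p by lra.
have all0 m' : success_prob w good (majority m' 0 e k) = 1.
  by elim: m' => [|m' IH] //=; rewrite h !IH; ring.
elim: m s => [|m IH] s /=.
  rewrite expr0 mul1r expr1; case: s => [|s] /=.
    by rewrite hk subrr divr_ge0 // exprn_ge0.
  rewrite exprS mulrAC divff // mul1r.
  have /andP[? ?] := success_range w good (k false).
  by have : 1 <= 8%:R ^+ s :> rat by [apply: exprn_ege1]; lra.
case: s => [|s].
  have -> : success_prob w good (e (fun b : bool => majority m (0 - b) e k)) = 1.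
    by rewrite h !sub0n !all0; ring.
  rewrite subrr; apply: divr_ge0; last exact: exprn_ge0.
  by apply: mulr_ge0; apply: exprn_ge0 => //; lra.
rewrite h subn1 /= subn0.
have h1 := IH s; have h0 := IH s.+1.
set a := success_prob _ _ _ in h1 *; set b := success_prob _ _ _ in h0 *.
set A := (1 + 7%:R * (1 - p)) ^+ m in h0 h1 *.
have -> : (1 + 7%:R * (1 - p)) ^+ m.+1 * 8%:R ^+ s.+1 / 8%:R ^+ m.+2
  = (1 + 7%:R * (1 - p)) * (A * 8%:R ^+ s / 8%:R ^+ m.+1).
  rewrite !(exprS _ m.+1) (exprS _ s) (exprS _ m) -/A.
  by field; rewrite expf_neq0.
have {}h0 : 1 - b <= 8%:R * (A * 8%:R ^+ s / 8%:R ^+ m.+1).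
  by apply: le_trans h0 _; rewrite (exprS _ s) (mulrCA A) !mulrA.
set z := A * 8%:R ^+ s / 8%:R ^+ m.+1 in h0 h1 *.
nra.
Qed.
End Programs.

(** * Random greedy independent sets *)

Section GreedyDefs.
Variables (V : eqType) (c : V -> nat).

(** Independent draws with repetition replace a random order. A drawn vertex that is still alive
    joins the independent set and removes its [nb]-neighbours, itself among them when [nb] is
    reflexive; [None] is an idle step. *)
Fixpoint alive (L0 : pred V) (nb : rel V) (l : seq (option V)) (x : V) : bool :=
  if l is y :: l' then
    alive L0 nb l' x &&
      (if y is Some y' then ~~ (nb y' x && alive L0 nb l' y') else true)
  else L0 x.

Fixpoint killed (L0 : pred V) (nb : rel V) (l : seq (option V)) (x : V) : bool :=
  if l is y :: l' then
    killed L0 nb l' x ||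
      (alive L0 nb l' x &&
        (if y is Some y' then [&& nb y' x, alive L0 nb l' y' & y' != x] else false))
  else false.

(* Cost of evaluating [alive] at [x] recursively, when inspecting x costs c x. *)
Fixpoint rec_cost (L0 : pred V) (nb : rel V) (l : seq (option V)) (x : V) : nat :=
  if l is y :: l' then
    (rec_cost L0 nb l' x +
      (if y is Some y' then
         if alive L0 nb l' x && nb y' x then rec_cost L0 nb l' y' else 0
       else 0))%N
  else c x.

Definition steps_cost (l : seq (option V)) : nat :=
  \sum_(y <- l) (if y is Some y' then c y' else 0).

(** Restricting [nb] to the survivors of [l1] does not change the later steps, but the degrees of
    the second phase become degrees among survivors, which are small in expectation. *)
Lemma alive_cat nb l2 l1 x (L1 := alive xpredT nb l1)
    (nb2 := fun y x => [&& nb y x, L1 y & L1 x]) :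
  alive L1 nb2 l2 x = alive xpredT nb (l2 ++ l1) x.
Proof.
have sub l y : alive xpredT nb (l ++ l1) y -> L1 y.
  by elim: l => //= a l IH /andP[/IH].
elim: l2 x => [|y l2 IH] x //=.
rewrite IH; case: (boolP (alive _ _ (l2 ++ l1) x)) => //= /sub hx.
case: y => // y; rewrite IH /nb2 hx andbT.
case: (boolP (alive _ _ (l2 ++ l1) y)); rewrite ?andbF // => /sub ->.
by rewrite !andbT.
Qed.

Lemma killed_alive L0 nb l x : killed L0 nb l x -> ~~ alive L0 nb l x.
Proof.
elim: l => //= y l IH /orP[/IH/negbTE -> //|/andP[->]].
by case: y => // y' /and3P[-> -> _].
Qed.

(** A vertex neither alive nor killed has joined the set, and joined vertices are independent. Hence
    the alive and the killed vertices together form a vertex cover. *)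
Lemma joined_sep (nb : rel V) l x y : symmetric nb ->
  x != y -> nb x y -> [|| alive xpredT nb l x, killed xpredT nb l x,
     alive xpredT nb l y | killed xpredT nb l y].
Proof.
move=> snb.
pose J l x := ~~ alive xpredT nb l x && ~~ killed xpredT nb l x.
have JS o l' z : J (o :: l') z -> J l' z \/ (alive xpredT nb l' z /\ o = Some z).
  rewrite /J /=; case: (boolP (alive _ _ l' z)) => /=; last first.
    by move=> _ /norP[-> _]; left.
  move=> az; case: o => //= o /andP[]; rewrite negbK => /andP[-> ->].
  case: (killed _ _ _ _) => //=; rewrite negbK => /eqP ->; by right.
have J1 l' z t : J l' z -> nb z t -> z != t -> ~~ alive xpredT nb l' t.
  elim: l' z t => [|o l' IH] z t; first by rewrite /J.
  move=> /JS[jz|[az ->]] nzt zt /=; first by rewrite (negbTE (IH _ _ jz nzt zt)).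
  by rewrite nzt az andbF.
move=> xy nxy; have [//|] := boolP [|| _, _, _ | _].
rewrite !negb_or => /and4P[a1 k1 a2 k2].
have : J l x by rewrite /J a1 k1.
have : J l y by rewrite /J a2 k2.
elim: l {a1 k1 a2 k2} => [|o l IH]; first by rewrite /J.
move=> /JS[jy|[ay oy]] /JS[jx|[ax ox]].
- exact: IH.
- by have nyx : nb y x by [rewrite snb]; have := J1 _ _ _ jy nyx; rewrite eq_sym ax => /(_ xy).
- by have := J1 _ _ _ jx nxy xy; rewrite ay.
- by move: xy; rewrite ox in oy; case: oy => ->; rewrite eqxx.
Qed.

End GreedyDefs.

Section GreedyExpectation.
Variables (V : eqType) (O : seq V) (c : V -> nat).
Hypothesis uO : uniq O.
Let q : rat := drawq O.

Let q0 : 0 < q. Proof. exact: drawq_gt0. Qed.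

Local Notation "b %:B" := ((b : bool)%:R : rat) (at level 2).

Lemma aliveSE (L0 : pred V) nb y l x :
  (alive L0 nb (Some y :: l) x)%:B =
  (alive L0 nb l x)%:B * (1 - (nb y x)%:B * (alive L0 nb l y)%:B).
Proof.
by rewrite /=; case: (alive _ _ _ x); case: (nb y x); case: (alive _ _ _ y) => /=; ring.
Qed.

Lemma rec_costSE (L0 : pred V) nb y l x :
  (rec_cost c L0 nb (Some y :: l) x)%:R =
  (rec_cost c L0 nb l x)%:R +
  (alive L0 nb l x)%:B * (nb y x)%:B * (rec_cost c L0 nb l y)%:R :> rat.
Proof.
rewrite /= natrD; congr (_ + _).
by case: (alive _ _ _ x); case: (nb y x) => /=; ring.
Qed.

Lemma EdO (f : option V -> rat) z :
  f None = z ->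
  Ed O f = z + q * \sum_(y <- O) (f (Some y) - z).
Proof.
move=> hz; rewrite EdE hz -/q sumrB big_const_seq count_predT iter_addr_0.
by rewrite -[z *+ _]mulr_natr; ring.
Qed.

Section Cost.
Variables (L0 : pred V) (nb : rel V).
Hypothesis snb : symmetric nb.

(** Times [drawq O], this is the expected growth of the total evaluation cost in the next step. *)
Definition Psi l : rat :=
  \sum_(v <- O) \sum_(x <- O)
    (alive L0 nb l v)%:B * (nb v x)%:B * (rec_cost c L0 nb l x)%:R.

(** A supermartingale. Drawing [y] raises the cost of the alive neighbours of [y] and removes these
    neighbours if [y] is alive. Summed over [y], gain and loss are the same sum over walks with
    three vertices, two consecutive ones alive and the cost read at the third. *)
Lemma Psi_step l : Ed O (fun y => Psi (y :: l)) <= Psi l.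
Proof.
rewrite (@EdO _ (Psi l)); last first.
  by apply: eq_bigr => v _; apply: eq_bigr => x _; rewrite /= andbT addn0.
rewrite gerDl; apply: mulr_ge0_le0; first exact: ltW.
pose a v := (alive L0 nb l v)%:B; pose N y x := (nb y x)%:B.
pose Q x : rat := (rec_cost c L0 nb l x)%:R.
have a0 v : 0 <= a v by rewrite ler0n.
have N0 v x : 0 <= N v x by rewrite ler0n.
have Q0 x : 0 <= Q x by rewrite ler0n.
have N1 v x : N v x <= 1 by rewrite lern1 leq_b1.
have NC v x : N v x = N x v by rewrite /N snb.
have h y : y \in O -> Psi (Some y :: l) - Psi l <=
   \sum_(v <- O) \sum_(x <- O) a v * N v x * a x * N y x * Q y -
   \sum_(v <- O) \sum_(x <- O) a y * N y v * a v * N v x * Q x.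
  move=> _; rewrite /Psi -!sumrB; apply: ler_sum => v _.
  rewrite -!sumrB; apply: ler_sum => x _.
  rewrite aliveSE rec_costSE -/(a v) -/(a x) -/(a y) -/(N y v) -/(N v x) -/(N y x) -/(Q x) -/(Q y).
  (* The cross term, a cost gained next to a vertex lost in the same step, enters negatively and is
     dropped. *)
  have : 0 <= a v * N y v * a y * (N v x * (a x * N y x * Q y)) by rewrite !mulr_ge0.
  lra.
apply: le_trans (_ : \sum_(y <- O) (\sum_(v <- O) \sum_(x <- O) a v * N v x * a x * N y x * Q y -
   \sum_(v <- O) \sum_(x <- O) a y * N y v * a v * N v x * Q x) <= 0).
  by rewrite [X in X <= _]big_seq [X in _ <= X]big_seq; apply: ler_sum => y hy; apply: h.
rewrite sumrB subr_le0 le_eqVlt; apply/orP; left; apply/eqP.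
under eq_bigr => y _ do rewrite exchange_big.
rewrite exchange_big /=.
rewrite [RHS]exchange_big /=.
rewrite (eq_bigr (fun i => \sum_(i0 <- O) \sum_(j <- O) a j * N j i * a i * N i i0 * Q i0)).
  apply: eq_bigr => v _; rewrite [RHS]exchange_big /=.
  by apply: eq_bigr => x _.
move=> v _; apply: eq_bigr => x _; apply: eq_bigr => y _; by rewrite (NC x v).
Qed.

Lemma Psi_mono R : En O R Psi <= Psi [::].
Proof.
elim: R => [|R IH] //=; apply: le_trans IH; apply: En_le => l _.
exact: Psi_step.
Qed.

Lemma sum_rec_cost R :
  En O R (fun l => \sum_(x <- O) (rec_cost c L0 nb l x)%:R) <=
  \sum_(x <- O) (c x)%:R + R%:R * q * Psi [::].
Proof.
elim: R => [|R IH] /=; first by rewrite !mul0r addr0.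
have -> : En O R (fun l => Ed O (fun y =>
      \sum_(x <- O) (rec_cost c L0 nb (y :: l) x)%:R)) =
   En O R (fun l => \sum_(x <- O) (rec_cost c L0 nb l x)%:R) + En O R (fun l => q * Psi l).
  rewrite -EnD; apply: eq_En => l _.
  rewrite (@EdO _ (\sum_(x <- O) (rec_cost c L0 nb l x)%:R)).
  - congr (_ + q * _); rewrite /Psi exchange_big /=; apply: eq_bigr => y _.
    rewrite -sumrB; apply: eq_bigr => x _; rewrite rec_costSE (snb x y); ring.
    - by apply: eq_bigr => x _; rewrite /= addn0.
rewrite EnZ -natr1 mulrDl mulrDl mul1r addrA.
apply: lerD => //; rewrite ler_pM2l //; exact: Psi_mono.
Qed.

End Cost.

Section Full.
Variable nb : rel V.
Hypotheses (snb : symmetric nb) (rnb : reflexive nb).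

Let al l x := (alive xpredT nb l x)%:B.

Lemma Ed_alive l x :
  Ed O (fun y => al (y :: l) x) =
  al l x - q * (al l x * \sum_(v <- O) al l v * (nb v x)%:B).
Proof.
rewrite (@EdO _ (al l x)).
- rewrite -mulrN; congr (_ + q * _); rewrite mulr_sumr -sumrN.
  by apply: eq_bigr => y _; rewrite /al aliveSE; ring.
- by rewrite /al /= andbT.
Qed.

Definition adeg l x : rat := al l x * \sum_(v <- O) al l v * (nb v x)%:B.

Lemma adeg_step l y x : adeg (y :: l) x <= adeg l x.
Proof.
have h z : al (y :: l) z <= al l z.
  rewrite /al /= ler_nat; case: (alive xpredT nb l z) => //=; exact: leq_b1.
apply: ler_pM; [exact: ler0n | | exact: h |].
  by apply: sumr_ge0 => v _; rewrite mulr_ge0 ?ler0n.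
by apply: ler_sum => v _; rewrite ler_wpM2r ?ler0n ?h.
Qed.

(** At each step an alive [x] dies with probability [q] times its alive degree, and this degree
    never grows. If it were large after [k] steps it would have been large all along, and the total
    probability of dying would exceed 1. *)
Lemma prefix_degree k x :
  q * k%:R * En O k (fun l => adeg l x) <= 1.
Proof.
suff h : En O k (fun l => al l x) <= 1 - q * k%:R * En O k (fun l => adeg l x).
  have : 0 <= En O k (fun l => al l x).
    by rewrite -(En_cst O k 0); apply: En_le => l _; exact: ler0n.
  lra.
elim: k => [|k IH] /=; first by rewrite /al /=; lra.
have -> : En O k (fun l => Ed O (fun y => al (y :: l) x)) =
   En O k (fun l => al l x) + En O k (fun l => - q * adeg l x).
  rewrite -EnD; apply: eq_En => l _; rewrite Ed_alive /adeg; ring.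
rewrite EnZ.
have : En O k (fun l => Ed O (fun y => adeg (y :: l) x)) <= En O k (fun l => adeg l x).
  apply: En_le => l _; rewrite -[X in _ <= X](Ed_cst O); apply: Ed_le => y.
  exact: adeg_step.
set A := En _ _ _ in IH *; set B := En _ _ _ in IH *; set B' := En _ _ _ => hB.
rewrite -natr1.
have : q * (k%:R + 1) * B' <= q * (k%:R + 1) * B.
  by rewrite ler_wpM2l // mulr_ge0 ?(ltW q0) // addr_ge0 // ler0n.
lra.
Qed.

(** By reflexivity of [nb], drawing [x] itself already removes it. *)
Lemma alive_decay R x : x \in O -> En O R (fun l => al l x) <= (1 - q) ^+ R.
Proof.
move=> xO; elim: R => [|R IH] /=; first by rewrite expr0 lern1 leq_b1.
have -> : (1 - q) ^+ R.+1 = (1 - q) * (1 - q) ^+ R by rewrite exprS.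
apply: le_trans (_ : (1 - q) * En O R (fun l => al l x) <= _); last first.
  rewrite ler_wpM2l //; have := drawq_le1 O; rewrite -/q; lra.
rewrite -EnZ; apply: En_le => l _; rewrite Ed_alive.
suff : al l x * 1 <= al l x * \sum_(v <- O) al l v * (nb v x)%:B.
  by move=> h; have := ler_wpM2l (ltW q0) h; lra.
rewrite /al; case ax : (alive _ _ _ _); last by rewrite !mul0r.
rewrite !mul1r (bigD1_seq x) //= ax rnb mulr1 lerDl.
by apply: sumr_ge0 => v _; rewrite mulr_ge0 ?ler0n.
Qed.

Lemma alive_rare R x : x \in O ->
  En O R (fun l => al l x) * (1 + q * R%:R) <= 1.
Proof.
move=> xO; have h := alive_decay R xO.
have q1 : q <= 1 by exact: drawq_le1.
have b : (1 - q) ^+ R * (1 + q * R%:R) <= 1.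
  elim: R {h} => [|R IH]; first by rewrite expr0; lra.
  have e0 : 0 <= (1 - q) ^+ R by rewrite exprn_ge0 // subr_ge0.
  have R0 : 0 <= R%:R :> rat by rewrite ler0n.
  rewrite exprS -natr1; apply: le_trans IH.
  rewrite [(1 - q) * _]mulrC -mulrA ler_wpM2l //.
  have := ltW q0; nra.
apply: le_trans b; rewrite ler_wpM2r // addr_ge0 // mulr_ge0 ?ler0n //.
exact: ltW.
Qed.

Let ki l x := (killed xpredT nb l x)%:B.

Lemma Ed_killed l x :
  Ed O (fun y => ki (y :: l) x) =
  ki l x + q * \sum_(v <- O) (al l x * al l v * (nb v x)%:B * (v != x)%:B).
Proof.
rewrite (@EdO _ (ki l x)).
- congr (_ + q * _); apply: eq_bigr => y _; rewrite /ki /al /=.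
  have := @killed_alive _ xpredT nb l x.
  case: (killed _ _ _ _); case: (alive _ _ _ x) => /=; try by move/(_ isT).
  + by move=> _; rewrite !mul0r subrr.
  + move=> _; case: (nb y x); case: (alive _ _ _ y); case: (y != x) => /=; ring.
  + by move=> _; rewrite !mul0r subrr.
- by rewrite /ki /= andbF orbF.
Qed.

(** At any moment [x] is about to be killed by [v] with the same probability as [v] by [x]. A vertex
    outside the cover [X] can be killed only by one inside, so in expectation there are no more
    kills outside than inside, and inside there are at most [count X O]. No such bound holds
    pointwise: a single vertex of [X] may kill many. *)
Lemma killed_le R (X : pred V) :
  (forall x y, x \in O -> y \in O -> x != y -> nb x y -> X x || X y) ->
  En O R (fun l => \sum_(x <- O) ki l x) <= 2%:R * (count X O)%:R.
Proof.
move=> vc.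
have step : En O R (fun l => \sum_(x <- O | ~~ X x) ki l x) <=
            En O R (fun l => \sum_(x <- O | X x) ki l x).
  elim: R => [|R IH] /=.
    by rewrite !big1 // => x _.
  have e (P : pred V) l : Ed O (fun y => \sum_(x <- O | P x) ki (y :: l) x) =
      \sum_(x <- O | P x) ki l x + q * \sum_(x <- O | P x)
        \sum_(v <- O) (al l x * al l v * (nb v x)%:B * (v != x)%:B).
    under eq_Ed => y do rewrite -big_filter.
    rewrite Ed_sum big_filter mulr_sumr -big_split /=.
    by apply: eq_bigr => x _; rewrite Ed_killed.
  rewrite (@eq_En _ _ _ _ _ (fun l _ => e (fun x => ~~ X x) l)).
  rewrite (@eq_En _ _ _ _ _ (fun l _ => e X l)).
  rewrite !EnD !EnZ; apply: lerD => //; rewrite ler_pM2l //.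
  apply: En_le => l _.
  set f := fun x v => al l x * al l v * (nb v x)%:B * (v != x)%:B.
  have f0 x v : 0 <= f x v by rewrite /f !mulr_ge0 ?ler0n.
  have fC x v : f x v = f v x by rewrite /f snb eq_sym; ring.
  rewrite -/(\sum_(x <- O | ~~ X x) \sum_(v <- O) f x v).
  rewrite -/(\sum_(x <- O | X x) \sum_(v <- O) f x v).
  apply: le_trans (_ : \sum_(x <- O | ~~ X x) \sum_(v <- O | X v) f x v <= _).
    rewrite [X in X <= _]big_seq_cond [X in _ <= X]big_seq_cond; apply: ler_sum => x /andP[xO nx].
    rewrite [X in _ <= X]big_mkcond [X in X <= _]big_seq [X in _ <= X]big_seq /=.
    apply: ler_sum => v vO; case: ifP => // /negbT nv.
    rewrite /f; case: (boolP (v == x)) => [|vx] /=; first by rewrite mulr0.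
    case: (boolP (nb v x)) => [nvx|]; last by rewrite mulr0 mul0r.
    by have := vc _ _ vO xO vx nvx; rewrite (negbTE nv) (negbTE nx).
  rewrite exchange_big /=; apply: ler_sum => x _.
  rewrite [X in X <= _]big_mkcond; apply: ler_sum => v _.
  by case: ifP => // _; rewrite fC.
have tot : En O R (fun l => \sum_(x <- O) ki l x) =
   En O R (fun l => \sum_(x <- O | X x) ki l x) + En O R (fun l => \sum_(x <- O | ~~ X x) ki l x).
  by rewrite -EnD; apply: eq_En => l _; rewrite [LHS](bigID X).
have hX : En O R (fun l => \sum_(x <- O | X x) ki l x) <= (count X O)%:R.
  rewrite -[X in _ <= X](En_cst O R); apply: En_le => l _.
  rewrite -sum1_count natr_sum; apply: ler_sum => x _.
  by rewrite /ki lern1 leq_b1.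
rewrite tot; lra.
Qed.

(** The alive and killed vertices form a vertex cover by [joined_sep], and only a fraction [eta] of
    the vertices is expected to stay alive. *)
Lemma killed_ge R (tau : rat) (eta : rat) :
  (forall S : pred V,
     (forall x y, x \in O -> y \in O -> x != y -> nb x y -> S x || S y) ->
     tau <= (count S O)%:R) ->
  1 <= eta * (1 + q * R%:R) ->
  tau - eta * (size O)%:R <= En O R (fun l => \sum_(x <- O) ki l x).
Proof.
move=> vc he.
have h1 : tau <= En O R (fun l => \sum_(x <- O) ki l x + \sum_(x <- O) al l x).
  rewrite -[X in X <= _](En_cst O R); apply: En_le => l _.
  have := vc (fun x => alive xpredT nb l x || killed xpredT nb l x).
  move=> /(_ _)/le_trans; apply.
    by move=> x y _ _ xy nxy; rewrite -!orbA; apply: joined_sep.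
  rewrite -sum1_count natr_sum big_mkcond -big_split /=; apply: ler_sum => x _.
  rewrite /ki /al; case: (alive _ _ _ _); case: (killed _ _ _ _) => /=; lra.
rewrite EnD in h1.
suff : En O R (fun l => \sum_(x <- O) al l x) <= eta * (size O)%:R by lra.
rewrite En_sum.
have -> : eta * (size O)%:R = \sum_(x <- O) eta.
  by rewrite big_const_seq count_predT iter_addr_0 mulr_natr.
rewrite [X in X <= _]big_seq [X in _ <= X]big_seq; apply: ler_sum => x xO.
have d0 : 0 < 1 + q * R%:R.
  by have : 0 <= q * R%:R by [rewrite mulr_ge0 ?ler0n // ltW]; lra.
rewrite -(ler_pM2r d0); exact: le_trans (alive_rare R xO) he.
Qed.

Lemma En_cat R k (F : seq (option V) -> rat) :
  En O (R + k) F = En O k (fun l1 => En O R (fun l2 => F (l2 ++ l1))).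
Proof. by elim: R F => [|R IH] F //=; rewrite IH. Qed.

Lemma steps_cost_E k : En O k (fun l => (steps_cost c l)%:R) =
  k%:R * (q * \sum_(x <- O) (c x)%:R).
Proof.
elim: k => [|k IH] /=; first by rewrite /steps_cost big_nil mul0r.
have -> : En O k (fun l => Ed O (fun y => (steps_cost c (y :: l))%:R)) =
    En O k (fun l => (steps_cost c l)%:R + q * \sum_(x <- O) (c x)%:R).
  apply: eq_En => l _; rewrite (@EdO _ (steps_cost c l)%:R).
  - congr (_ + q * _); apply: eq_bigr => y _.
    by rewrite /steps_cost big_cons natrD; ring.
    - by rewrite /steps_cost big_cons.
by rewrite EnD En_cst IH -natr1; ring.
Qed.

(** With [nb] restricted to the survivors, [Psi [::]] is the sum of [c x] times the alive degree of
    [x]; [prefix_degree] turns the factor [R * q] of [sum_rec_cost] into [R / k]. *)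
Lemma second_phase_cost k R : (0 < k)%N ->
  En O k (fun l1 => let L1 := alive xpredT nb l1 in
    let nb2 := fun y x => [&& nb y x, L1 y & L1 x] in
    En O R (fun l2 => \sum_(x <- O) (rec_cost c L1 nb2 l2 x)%:R)) <=
  (1 + R%:R / k%:R) * \sum_(x <- O) (c x)%:R.
Proof.
move=> k0; set Sc := \sum_(x <- O) (c x)%:R.
apply: le_trans (_ : En O k (fun l1 => Sc + R%:R * q * \sum_(x <- O) ((c x)%:R * adeg l1 x)) <= _).
  apply: En_le => l1 _ /=.
  have s2 : symmetric (fun y x => [&& nb y x, alive xpredT nb l1 y & alive xpredT nb l1 x]).
    by move=> y x; rewrite snb (andbC (alive _ _ _ y)).
  apply: le_trans (sum_rec_cost (alive xpredT nb l1) s2 R) _; rewrite lerD2l.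
  apply: ler_wpM2l; first by rewrite mulr_ge0 ?ler0n ?(ltW q0).
  rewrite /Psi exchange_big /=; apply: ler_sum => x _.
  rewrite /adeg mulrA mulr_sumr; apply: ler_sum => v _ /=.
  rewrite /al; case: (alive _ _ _ v); case: (nb v x); case: (alive _ _ _ x) => /=; lra.
rewrite EnD En_cst EnZ mulrDl mul1r lerD2l En_sum.
have kR : 0 < k%:R :> rat by rewrite ltr0n.
have h x : En O k (fun l => (c x)%:R * adeg l x) <= (c x)%:R / (q * k%:R).
  rewrite EnZ ler_wpM2l ?ler0n // -[X in _ <= X]mul1r ler_pdivlMr ?mulr_gt0 //.
  by rewrite mulrC; exact: prefix_degree.
apply: le_trans (_ : R%:R * q * \sum_(x <- O) ((c x)%:R / (q * k%:R)) <= _).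
  by rewrite ler_wpM2l ?mulr_ge0 ?ler0n ?(ltW q0) //; apply: ler_sum => x _; apply: h.
rewrite -mulr_suml -/Sc le_eqVlt; apply/orP; left; apply/eqP.
by field; rewrite (gt_eqF kR) (gt_eqF q0).
Qed.

End Full.
End GreedyExpectation.

(** * Rooted trees *)

Local Open Scope nat_scope.

Section RootedTree.
Variables (V : finType) (r : V) (par : V -> V) (lv : V -> nat).

(** [lv] certifies that iterating [par] ends at [r]. The root carries a dummy edge, a loop that
    separates nothing ([sep_root]). *)
Definition rooted : Prop :=
  par r = r /\ forall v, v != r -> lv v = (lv (par v)).+1.

Hypothesis rtd : rooted.

Lemma par_root : par r = r. Proof. by case: rtd. Qed.
Lemma lv_par v : v != r -> lv v = (lv (par v)).+1. Proof. by case: rtd => _; apply. Qed.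

Definition anc (x v : V) : bool := fconnect par v x.

Lemma anc_refl x : anc x x. Proof. exact: connect0. Qed.

Lemma ancE x v : anc x v = (x == v) || anc x (par v).
Proof. by rewrite /anc fconnect_eqVf eq_sym. Qed.

Lemma anc_trans y x z : anc x y -> anc y z -> anc x z.
Proof. by move=> h1 h2; apply: connect_trans h2 h1. Qed.

Lemma anc_par x v : anc x (par v) -> anc x v.
Proof. by rewrite (ancE x v) => ->; rewrite orbT. Qed.

Lemma anc_parl x : anc (par x) x.
Proof. by apply: anc_par; apply: anc_refl. Qed.

Lemma tree_ind (P : V -> Prop) :
  P r -> (forall v, v != r -> P (par v) -> P v) -> forall v, P v.
Proof.
move=> Pr Ps v; have [k] := ubnP (lv v); elim: k v => // k IH v lk.
have [-> //|vr] := eqVneq v r.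
by apply: Ps => //; apply: IH; move: lk; rewrite (lv_par vr).
Qed.

Lemma anc_rootl v : anc r v.
Proof. elim/tree_ind: v => [|v _]; [exact: anc_refl | exact: anc_par]. Qed.

Lemma anc_root x : anc x r = (x == r).
Proof.
apply/idP/idP => [/iter_findex <-|/eqP ->]; last exact: anc_refl.
by elim: (findex _ _ _) => //= k /eqP ->; rewrite par_root.
Qed.

Lemma anc_lv x v : anc x v -> x != v -> lv x < lv v.
Proof.
elim/tree_ind: v => [|v vr IH]; first by rewrite anc_root => ->.
rewrite ancE (lv_par vr) ltnS => /orP[->//|h] _.
by have [->|/(IH h)/ltnW] := eqVneq x (par v).
Qed.

Lemma anc_anti x v : anc x v -> anc v x -> x = v.
Proof.
move=> h1 h2; apply/eqP; apply: contraT => xv.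
have := anc_lv h1 xv; rewrite eq_sym in xv; have := anc_lv h2 xv; lia.
Qed.

Lemma anc_total x y v : anc x v -> anc y v -> anc x y || anc y x.
Proof.
elim/tree_ind: v => [|v vr IH].
  by rewrite !anc_root => /eqP -> /eqP ->; rewrite anc_refl.
rewrite (ancE x) (ancE y) => /orP[/eqP ->|hx] /orP[/eqP ->|hy].
- by rewrite anc_refl.
- by rewrite (anc_par hy) orbT.
- by rewrite (anc_par hx).
- exact: IH.
Qed.

Lemma anc_self_par x : x != r -> anc x (par x) = false.
Proof.
move=> xr; apply/negP => h; have := anc_anti h (anc_parl x) => e.
by have := lv_par xr; rewrite -e; lia.
Qed.

Lemma anc_child x v : anc x v -> x != v -> exists y, [/\ par y = x, y != r & anc y v].
Proof.
elim/tree_ind: v => [|v vr IH]; first by rewrite anc_root => ->.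
rewrite ancE => /orP[->//|h] _; have [->|xp] := eqVneq x (par v).
  by exists v; split => //; apply: anc_refl.
have [y [h1 h2 h3]] := IH h xp; exists y; split => //; exact: anc_par.
Qed.

Definition sep (x u v : V) : bool := anc x u (+) anc x v.

Lemma sepC x u v : sep x u v = sep x v u. Proof. exact: addbC. Qed.

Lemma sepxx x u : sep x u u = false. Proof. exact: addbb. Qed.

Lemma sep_trans y x u v : sep x u v = sep x u y (+) sep x y v.
Proof. by rewrite /sep; case: anc; case: anc; case: anc. Qed.

Lemma sep_root u v : sep r u v = false.
Proof. by rewrite /sep !anc_rootl. Qed.

Lemma sep_nroot x u v : sep x u v -> x != r.
Proof. by apply: contraTneq => ->; rewrite sep_root. Qed.

Lemma sep_par x y : x != r -> sep y x (par x) = (y == x).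
Proof.
move=> xr; rewrite /sep (ancE y x); have [->|] /= := eqVneq y x.
  by rewrite anc_self_par.
by rewrite addbb.
Qed.

Lemma sep_anc y a v : anc a v -> sep y a v = anc y v && ~~ anc y a.
Proof.
by move=> h; rewrite /sep; case ya : (anc y a); rewrite ?(anc_trans ya h) ?andbT.
Qed.

(* A vertex one step closer to a on the path from b to a. *)
Lemma sep_step a b : b != a -> exists b' y,
  [/\ y != r, (b = y /\ b' = par y) \/ (b = par y /\ b' = y) &
      forall z, sep z a b = (z == y) || sep z a b' /\ ((z == y) && sep z a b') = false].
Proof.
move=> ba; case: (boolP (anc b a)) => h.
  have [y [h1 h2 h3]] := anc_child h ba.
  exists y, y; split => //; first by right.
  move=> z; rewrite (sepC z a) (sepC z a) (sep_anc _ h) (sep_anc _ h3) -h1.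
  rewrite (ancE z y); have [->|] /= := eqVneq z y.
    by rewrite h3 (anc_self_par h2).
  by [].  
have br : b != r by apply: contraNneq h => ->; exact: anc_rootl.
exists (par b), b; split => //; first by left.
move=> z; rewrite (sep_trans b z a) (sep_trans b z a (par b)) sepxx addbF.
rewrite sep_par //; have [->|] /= := eqVneq z b; last by rewrite addbF.
by rewrite /sep anc_refl (negbTE h).
Qed.

Variable om : V -> nat.

Definition dist (U : pred V) u v : nat := \sum_(x | U x) om x * sep x u v.
Definition depth v : nat := \sum_x om x * anc x v.
Definition wt (U : pred V) : nat := \sum_(x | U x) om x.

Lemma distC U u v : dist U u v = dist U v u.
Proof. by apply: eq_bigr => x _; rewrite sepC. Qed.

Lemma distxx U u : dist U u u = 0.
Proof. by apply: big1 => x _; rewrite sepxx muln0. Qed.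

Lemma leq_dist (U U' : pred V) u v u' v' :
  (forall z, U z -> sep z u v -> U' z && sep z u' v') ->
  dist U u v <= dist U' u' v'.
Proof.
move=> h; rewrite /dist big_mkcond [X in _ <= X]big_mkcond /=; apply: leq_sum => x _.
case: (boolP (U x)) => // hU; case: (boolP (sep x u v)) => hs; last by rewrite muln0.
by have /andP[-> ->] := h x hU hs.
Qed.

Lemma dist_wt U u v : dist U u v = wt (fun x => U x && sep x u v).
Proof.
rewrite /dist /wt big_mkcondr; apply: eq_bigr => x _.
by case: ifP; rewrite ?muln1 ?muln0.
Qed.

Lemma depth_anc a v : anc a v -> depth v = depth a + dist xpredT a v.
Proof.
move=> h; rewrite /depth /dist -big_split /=; apply: eq_bigr => x _.
rewrite -mulnDr (sep_anc _ h); case xa : (anc x a); last by rewrite add0n andbT.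
by rewrite (anc_trans xa h).
Qed.

Lemma depth_par v : v != r -> depth v = depth (par v) + om v.
Proof.
move=> vr; rewrite (depth_anc (anc_parl v)); congr (_ + _).
rewrite /dist (bigD1 v) //= sepC sep_par // eqxx muln1 big1 ?addn0 // => x xv.
by rewrite sepC sep_par // (negbTE xv) muln0.
Qed.

Lemma depth_mono a v : anc a v -> depth a <= depth v.
Proof. by move=> /depth_anc ->; apply: leq_addr. Qed.

Lemma sep_through x a v z : anc x a -> ~~ anc x v ->
  sep z a v = sep z a x + (z == x) + sep z (par x) v :> nat.
Proof.
move=> xa nxv; have xr : x != r by apply: contraNneq nxv => ->; exact: anc_rootl.
rewrite (sep_trans x z a v) (sep_trans (par x) z x v) sep_par // (sepC z a x) sep_anc //.
have [->|zx] /= := eqVneq z x; first by rewrite anc_refl andbF /sep anc_self_par // (negbTE nxv).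
rewrite addn0; case: (boolP (anc z a && ~~ anc z x)) => [/andP[za nzx]|] //=.
have xz : anc x z by have := anc_total xa za; rewrite (negbTE nzx) orbF.
have -> // : sep z (par x) v = false.
rewrite /sep; have -> : anc z (par x) = false.
  by apply/negbTE; apply: contra nzx; apply: anc_par.
by apply/negbTE; apply: contra nxv; apply: anc_trans.
Qed.

Lemma dist_through U x a v : anc x a -> ~~ anc x v ->
  dist U a v = dist U a x + U x * om x + dist U (par x) v.
Proof.
move=> h1 h2; rewrite /dist (eq_bigr _ (fun z _ => congr1 (muln (om z)) (sep_through z h1 h2))).
under eq_bigr => z _ do rewrite !mulnDr.
rewrite !big_split /=; congr (_ + _ + _).
rewrite big_mkcond (bigD1 x) //= eqxx muln1 big1 ?addn0; first by case: ifP; rewrite ?mul1n.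
by move=> z /negbTE ->; rewrite muln0 if_same.
Qed.

(** Moving [b] one edge towards [a] shortens the path by at most [m]; the first length not above
    [s + m] is therefore still at least [s]. *)
Lemma path_trim a b s m : s <= dist xpredT a b ->
  (forall z, sep z a b -> om z <= m) ->
  exists b', [/\ (forall z, sep z a b' -> sep z a b),
                 s <= dist xpredT a b' & dist xpredT a b' <= s + m].
Proof.
have [k] := ubnP #|[pred z | sep z a b]|; elim: k b => // k IH b hk hs hm.
have [hle|hgt] := leqP (dist xpredT a b) (s + m); first by exists b.
have ba : b != a by apply: contraTneq hgt => ->; rewrite distxx.
have [b' [y [yr _ hz]]] := sep_step ba.
have sub z : sep z a b' -> sep z a b by move=> h; rewrite (hz z).1 h orbT.
have sy : sep y a b by rewrite (hz y).1 eqxx.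
have ny : ~~ sep y a b' by have := (hz y).2; rewrite eqxx => /negbT.
have hd : dist xpredT a b = dist xpredT a b' + om y.
  rewrite /dist (bigD1 y) //= [in RHS](bigD1 y) //= sy (negbTE ny) muln1 muln0 add0n addnC.
  congr (_ + _); apply: eq_bigr => z zy; by rewrite (hz z).1 (negbTE zy).
case: (IH b').
- rewrite ltnS in hk; apply: leq_trans hk; apply: proper_card; apply/properP; split.
    by apply/subsetP => z; rewrite !inE; apply: sub.
  by exists y; rewrite !inE.
- have := hm y sy; lia.
- by move=> z /sub/hm.
- move=> b'' [h1 h2 h3]; exists b''; split => // z /h1; exact: sub.
Qed.

Section Tops.
Variable E : pred V.

Definition istop y := (y == r) || E y.

(** A part left after cutting the edges of [E] is named by its highest vertex, which is the root or
    the lower end of a cut edge. *)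
Definition top v : V := [arg max_(y > r | anc y v && istop y) lv y].

Lemma topP v : [/\ anc (top v) v, istop (top v) &
  forall y, anc y v -> istop y -> anc y (top v)].
Proof.
rewrite /top; case: arg_maxnP => [|y /andP[h1 h2] h3].
  by rewrite anc_rootl /istop eqxx.
split => // z za zt; have := anc_total za h1; case: (boolP (anc z y)) => //= nzy yz.
have : lv z <= lv y by apply: h3; rewrite za zt.
have zy : y != z by apply: contraNneq nzy => ->; apply: anc_refl.
have := anc_lv yz zy; lia.
Qed.

Lemma top_anc v : anc (top v) v. Proof. by case: (topP v). Qed.
Lemma top_istop v : istop (top v). Proof. by case: (topP v). Qed.
Lemma top_max y v : anc y v -> istop y -> anc y (top v). Proof. by case: (topP v) => _ _; apply. Qed.

Lemma top_id y : istop y -> top y = y.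
Proof.
move=> hy; apply: anc_anti; first exact: top_anc.
by apply: top_max => //; apply: anc_refl.
Qed.

Lemma topK v : top (top v) = top v. Proof. by apply: top_id; apply: top_istop. Qed.

Lemma anc_top y v : istop y -> anc y (top v) = anc y v.
Proof.
move=> hy; apply/idP/idP => h; first exact: anc_trans h (top_anc v).
exact: top_max.
Qed.

Lemma top_eqP u v : reflect (forall x, E x -> ~~ sep x u v) (top u == top v).
Proof.
apply: (iffP eqP) => [e x Ex|h].
  have hx : istop x by rewrite /istop Ex orbT.
  by rewrite /sep -(anc_top u hx) -(anc_top v hx) e addbb.
have aux a b : (forall x, E x -> ~~ sep x a b) -> anc (top a) (top b).
  move=> hab; apply: top_max; last exact: top_istop.
  have := top_istop a => /orP[/eqP ->|/hab]; first exact: anc_rootl.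
  by rewrite /sep top_anc /= negbK.
by apply: anc_anti; apply: aux => // x /h; rewrite sepC.
Qed.

Lemma top_par x : x != r -> ~~ E x -> top (par x) = top x.
Proof.
move=> xr nx; apply/eqP/top_eqP => z Ez; rewrite sepC sep_par //.
by apply: contraNneq nx => <-.
Qed.

End Tops.

Lemma top_sub (E E' : pred V) v : (forall x, E x -> E' x) -> top E (top E' v) = top E v.
Proof.
move=> sub; apply/eqP/top_eqP => x /sub Ex; rewrite sep_anc ?top_anc //.
by rewrite anc_top ?andbN // /istop Ex orbT.
Qed.

(* Mass is transported upwards: every edge of C emits k times its weight, every
   edge of Z consumes its own weight, and G v is the best chain below v. *)
Lemma resource_bound (C Z : pred V) (k : nat) :
  (forall x, Z x -> exists2 a, anc x a &
     wt (fun y => anc x y && anc y a) <= k * wt (fun y => [&& C y, anc x y & anc y a])) ->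
  ~~ Z r -> wt Z <= k * wt C.
Proof.
Import Order.TTheory GRing.Theory Num.Theory.
Local Open Scope ring_scope.
move=> hZ nZr.
pose phi y : int := (k * om y * C y)%N%:R - (om y)%:R.
pose cs v a : int := \sum_(y | [&& anc v y, anc y a & y != v]) phi y.
pose best v := [arg max_(a > v | anc v a) cs v a]%O.
pose G v := cs v (best v).
have GP v : [/\ anc v (best v), 0 <= G v & forall a, anc v a -> cs v a <= G v].
  rewrite /G /best; case: Order.TotalTheory.arg_maxP => [|b h1 h2]; first exact: anc_refl.
  split => //.
  have <- : cs v v = 0.
    rewrite /cs big_pred0 // => y; apply/negP => /and3P[p1 p2].
    by rewrite (anc_anti p1 p2) eqxx.
  by apply: h2; apply: anc_refl.
pose F x : int := Num.max 0 (phi x + G x).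
have F0 x : 0 <= F x by rewrite /F le_max lexx.
have csS y a : y != r -> anc y a -> cs (par y) a = phi y + cs y a.
  move=> yr ya; rewrite /cs (bigD1 y) /=; last first.
    rewrite anc_parl ya /=; apply/negP => /eqP e.
    by have := anc_self_par yr; rewrite -e anc_refl.
  congr (_ + _); apply: eq_bigl => z.
  case: (boolP (anc z a)) => za; rewrite ?andbF //=.
  apply/idP/idP.
    move=> /andP[/andP[h1 h2] h3]; rewrite h3 andbT.
    have := anc_total za ya; case: (boolP (anc y z)) => // nyz; rewrite orbF => zy.
    by move: zy; rewrite ancE (negbTE h3) /= => zy; rewrite (anc_anti h1 zy) eqxx in h2.
  move=> /andP[yz zy]; rewrite zy (anc_trans (anc_parl y) yz) andbT /=.
  apply: contraTneq yz => ->; by rewrite anc_self_par.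
have Gle v : G v <= \sum_(y | (y != r) && (par y == v)) F y.
  have [hb _ _] := GP v; have [e|ne] := eqVneq (best v) v.
    rewrite /G e /cs big_pred0; first by apply: sumr_ge0.
    by move=> y; apply/negP => /and3P[p1 p2]; rewrite (anc_anti p1 p2) eqxx.
  rewrite eq_sym in ne; have [y [h1 h2 h3]] := anc_child hb ne.
  rewrite (bigD1 y) /=; last by rewrite h2 h1 eqxx.
  rewrite /G -{1}h1 csS //; apply: ler_wpDr; first exact: sumr_ge0.
  rewrite /F le_max; apply/orP; right; rewrite lerD2l.
  by have [_ _] := GP y; apply.
have tot : \sum_v G v <= \sum_(y | y != r) F y.
  apply: le_trans (ler_sum _ (fun v _ => Gle v)) _.
  rewrite (exchange_big_dep (fun y => y != r)) /=; last by move=> v y _ /andP[].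
  apply: ler_sum => y yr; rewrite (bigD1 (par y)) /=; last by rewrite yr eqxx.
  rewrite big_pred0 ?addr0 // => v; rewrite yr /= eq_sym.
  by rewrite andbN.
have Gr : 0 <= G r by case: (GP r).
(* For [x] in [Z] the chain of the hypothesis makes [phi x + G x] nonnegative, so the maximum with 0
   in [F] is harmless and the full weight of [x] is consumed. Elsewhere the consumption of [x] is
   forgiven. *)
have Fle x : F x <= G x + (k * om x * C x)%N%:R - (om x * Z x)%N%:R.
  have [_ Gx0 hG] := GP x; rewrite /F /phi ge_max; apply/andP; split; last first.
    by case: (Z x); rewrite ?muln1 ?muln0; lia.
  case: (boolP (Z x)) => [zx|_]; last by rewrite muln0; lia.
  have [a xa hw] := hZ x zx; have := hG a xa.
  suff : 0 <= phi x + cs x a by rewrite /phi muln1; lia.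
  have -> : phi x + cs x a = \sum_(y | anc x y && anc y a) phi y.
    rewrite (bigD1 x) /=; last by rewrite anc_refl xa.
    by rewrite /cs; congr (_ + _); apply: eq_bigl => y; rewrite andbA.
  rewrite /phi sumrB -!natr_sum subr_ge0 ler_nat.
  rewrite /wt in hw; apply: leq_trans hw _.
  rewrite big_distrr /= [X in (X <= _)%N]big_mkcond [X in (_ <= X)%N]big_mkcond /=.
  by apply: leq_sum => y _; case: (C y) => /=; rewrite ?muln1 ?muln0 ?if_same.
have hF : \sum_(y | y != r) F y <= \sum_(x | x != r)
     (G x + (k * om x * C x)%N%:R - (om x * Z x)%N%:R) by apply: ler_sum.
(* What arrives at [v] was sent by its children, so [tot] and the sum of [Fle] cancel the terms [G]
   and leave the two weights. *)
have hT : \sum_(x | x != r) (om x * Z x)%N%:R <= \sum_(x | x != r) (k * om x * C x)%N%:R :> int.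
  have e : \sum_v G v = G r + \sum_(x | x != r) G x by rewrite (bigD1 r).
  have h := le_trans tot hF.
  have e2 : \sum_(x | x != r) (G x + (k * om x * C x)%N%:R - (om x * Z x)%N%:R) =
     \sum_(x | x != r) G x + \sum_(x | x != r) (k * om x * C x)%N%:R -
       \sum_(x | x != r) (om x * Z x)%N%:R :> int by rewrite sumrB big_split.
  rewrite e e2 in h; lra.
rewrite -!natr_sum ler_nat in hT.
have eZ : wt Z = (\sum_(x | x != r) om x * Z x)%N.
  rewrite /wt big_mkcond (bigD1 r) //= (negbTE nZr) add0n.
  by apply: eq_bigr => x _; case: (Z x); rewrite ?muln1 ?muln0.
rewrite eZ; apply: leq_trans hT _.
rewrite /wt big_distrr /= [X in (X <= _)%N]big_mkcond [X in (_ <= X)%N]big_mkcond /=.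
by apply: leq_sum => x _; case: (C x); case: eqVneq; rewrite ?muln1 ?muln0.
Qed.

End RootedTree.

(** * Tours and Eulerian multigraphs *)

Local Open Scope nat_scope.

Section Euler.
Variables (n : nat) (w : 'I_n -> 'I_n -> nat).
Hypothesis metw : is_int_metric w.

Let w0 u : w u u = 0. Proof. by case: metw. Qed.
Let wC u v : w u v = w v u. Proof. by case: metw. Qed.
Let wT v u x : w u x <= w u v + w v x. Proof. by case: metw. Qed.

Fixpoint walkc (x : 'I_n) (s : seq 'I_n) : nat :=
  if s is y :: s' then w x y + walkc y s' else 0.

Lemma walkc_cat x s1 s2 : walkc x (s1 ++ s2) = walkc x s1 + walkc (last x s1) s2.
Proof. by elim: s1 x => //= y s1 IH x; rewrite IH addnA. Qed.

Lemma walkc_shift x y s z : walkc x (rcons s z) <= w x y + walkc y (rcons s z).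
Proof.
case: s => [|a s] /=; first by rewrite !addn0; apply: wT.
by rewrite addnA leq_add2r; apply: wT.
Qed.

Lemma walkc_subseq x s' s z : subseq s' s ->
  walkc x (rcons s' z) <= walkc x (rcons s z).
Proof.
elim: s s' x => [|y s IH] s' x; first by rewrite subseq0 => /eqP ->.
case: s' => [_|a s'].
  apply: leq_trans (walkc_shift x y [::] z) _; rewrite /= leq_add2l.
  by apply: (IH [::] y); apply: sub0seq.
rewrite /=; case: eqP => [->|_] h; first by rewrite leq_add2l; apply: IH.
apply: leq_trans (IH _ x h) _; exact: walkc_shift.
Qed.

Lemma walkcE x s z :
  walkc x (rcons s z) = \sum_(i < (size s).+1) w (nth z (x :: s) i) (nth z s i).
Proof.
elim: s x => [|y s IH] x; first by rewrite /= big_ord1 addn0.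
by rewrite big_ord_recl [LHS]/= IH.
Qed.

(** Shortcutting: keeping one occurrence of each vertex does not lengthen the closed walk, by the
    triangle inequality. *)
Lemma TSP_walk x s : last x s = x -> (forall v, v \in x :: s) -> TSP w <= walkc x s.
Proof.
move=> hl hv; have n0 : 0 < n by case: (n) x {hl hv} => [[]|].
pose t := undup (filter (predC1 x) s).
have tx : x \notin t by rewrite mem_undup mem_filter /= eqxx.
have tall v : v \in x :: t.
  rewrite inE /t mem_undup mem_filter; have := hv v; rewrite inE /=.
  by case: (v == x).
have ut : uniq (x :: t) by rewrite /= tx undup_uniq.
have st : (size t).+1 = n.
  rewrite -[LHS]/(size (x :: t)) -(card_uniqP ut) -[RHS]card_ord.
  by apply: eq_card => v; rewrite tall.
have pinj : injective (fun i : 'I_n => nth x (x :: t) i).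
  by move=> i j /eqP; rewrite nth_uniq //= ?st // => /eqP /val_inj.
have -> : walkc x s = walkc x (rcons s x).
  by rewrite -cats1 walkc_cat hl /= w0 !addn0.
apply: leq_trans (_ : walkc x (rcons t x) <= _); last first.
  apply: walkc_subseq; apply: subseq_trans (undup_subseq _) (filter_subseq _ _).
apply: leq_trans (_ : tour_cost w (perm pinj) <= _).
  by rewrite /TSP; case: arg_minnP => // p _ hp; apply: hp.
rewrite walkcE st /tour_cost leq_eqVlt; apply/orP; left; apply/eqP.
apply: eq_bigr => i _; rewrite !permE; congr (w _ _).
rewrite /=; have [hi|hi] := ltnP i.+1 n.
  by rewrite modn_small.
have -> : i.+1 = n by have := ltn_ord i; lia.
by rewrite modnn /= nth_default // -ltnS; apply: leq_trans hi; rewrite st.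
Qed.

Implicit Types E : seq ('I_n * 'I_n).

Definition deg E v : nat := \sum_(e <- E) ((e.1 == v) + (e.2 == v)).
Definition cost E : nat := \sum_(e <- E) w e.1 e.2.

Lemma deg_rem E e v : e \in E -> deg E v = (e.1 == v) + (e.2 == v) + deg (rem e E) v.
Proof. by move=> h; rewrite /deg (big_rem e). Qed.

Lemma deg_gt0 E v : deg E v != 0 -> exists2 e, e \in E & (e.1 == v) || (e.2 == v).
Proof.
elim: E => [|e E IH]; first by rewrite /deg big_nil.
rewrite /deg big_cons; case: (boolP ((e.1 == v) || (e.2 == v))) => [h _|/norP[/negbTE -> /negbTE ->]].
  by exists e => //; rewrite mem_head.
by rewrite add0n => /IH[e' h1 h2]; exists e' => //; rewrite inE h1 orbT.
Qed.

Lemma deg_in E e : e \in E -> deg E e.1 != 0 /\ deg E e.2 != 0.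
Proof. by move=> h; rewrite !(deg_rem _ h) !eqxx; split; lia. Qed.

Lemma trail E x y :
  (forall v, odd (deg E v) = (v == x) (+) (v == y)) ->
  exists s E', [/\ last y s = x, walkc y s + cost E' = cost E,
    forall v, ~~ odd (deg E' v),
    forall e, e \in E -> e \in E' \/ (e.1 \in y :: s /\ e.2 \in y :: s) &
    size s + size E' = size E /\ (deg E y != 0 -> s != [::])].
Proof.
have [m] := ubnP (size E); elim: m E y => // m IH E y hm hodd.
have [d0|dn0] := eqVneq (deg E y) 0.
  have := hodd y; rewrite d0 eqxx /= addbT => /esym/negbFE/eqP xy.
  exists [::], E; split => //=.
  - by move=> v; rewrite hodd xy addbb.
  - by move=> e ->; left.
have [e eE hev] := deg_gt0 dn0.
pose z := if e.1 == y then e.2 else e.1.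
have hz v : (e.1 == v) + (e.2 == v) = (y == v) + (z == v).
  by rewrite /z; case: eqP hev => [<-//|_ /= /eqP ->]; rewrite addnC.
have [||s [E' [h1 h2 h3 h4 [h5 h6]]]] := IH (rem e E) z.
- by rewrite size_rem //; have := hm; case: (E) eE.
- move=> v; have := hodd v; rewrite (deg_rem v eE) hz !oddD !oddb.
  rewrite (eq_sym y) (eq_sym z); case: (odd _); case: (v == y); case: (v == z); case: (v == x) => //.
exists (z :: s), E'; split => //.
- rewrite /= -addnA h2 /cost (big_rem e eE) /=; congr (_ + _).
  by rewrite /z; case: eqP hev => [->//|_ /= /eqP ->].
- move=> f fE; have [->|fe] := eqVneq f e.
    right; rewrite !inE /z; case: eqP hev => [->|_ /= /eqP ->]; by rewrite !eqxx ?orbT.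
  have /h4[->|[]] : f \in rem e E.
      move: fE; have /perm_mem -> := perm_to_rem eE.
      by rewrite inE (negbTE fe).
    by left.
  by right; rewrite ![in _ \in y :: _]inE; split; apply/orP; right.
- by split => //=; rewrite addSn h5 size_rem //; case: (E) eE.
Qed.

Lemma euler_splice E0 E x s (K : nat) :
  (forall u v, connect (tree_rel E0) u v) ->
  last x s = x -> walkc x s + cost E <= K -> (forall v, ~~ odd (deg E v)) ->
  (forall e, e \in E0 -> e \in E \/ (e.1 \in x :: s /\ e.2 \in x :: s)) ->
  exists2 s', last x s' = x & walkc x s' <= K /\ forall v, v \in x :: s'.
Proof.
move=> conn; have [m] := ubnP (size E); elim: m E s => // m IH E s hm hl hK hev hE.
case: (boolP (has (fun z => deg E z != 0) (x :: s))) => [/hasP[z zs dz]|/hasPn nz]; last first.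
  exists s => //; split; first by apply: leq_trans hK; apply: leq_addr.
  have aux p a : path (tree_rel E0) a p -> a \in x :: s -> last a p \in x :: s.
    elim: p a => [|b p IHp] a //= /andP[ab pp] ha; apply: IHp => //.
    have key e : e \in E0 -> e.1 = a \/ e.2 = a -> e.1 \in x :: s /\ e.2 \in x :: s.
      move=> /hE[eE|//] ea; have [d1 d2] := deg_in eE.
      by have := nz a ha; case: ea => <-; rewrite ?d1 ?d2.
    move: ab => /orP[]/key h; first by case: h => //; left.
    by case: h => //; right.
  by move=> v; have /connectP[p pp ->] := conn x v; apply: aux => //; rewrite mem_head.
have hod v : odd (deg E v) = (v == z) (+) (v == z) by rewrite addbb; apply/negbTE.
have [s2 [E' [h1 h2 h3 h4 [h5 h6]]]] := trail hod.
have s2n : 0 < size s2 by have := h6 dz; case: (s2).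
have sz : size E' < m by lia.
have [p1 [p2 [hs hl1]]] : exists p1 p2, s = p1 ++ p2 /\ last x p1 = z.
  move: zs; rewrite inE => /orP[/eqP ->|zs]; first by exists [::], s.
  by case/splitPr: zs => p1 p2; exists (rcons p1 z), p2; rewrite cat_rcons last_rcons.
apply: (IH E' (p1 ++ s2 ++ p2)) => //.
- by rewrite !last_cat hl1 h1 -[in RHS]hl hs last_cat hl1.
- move: hK; rewrite hs !walkc_cat hl1 h1; lia.
- have sub v : v \in x :: s -> v \in x :: p1 ++ s2 ++ p2.
    by rewrite hs !inE !mem_cat => /or3P[] ->; rewrite ?orbT.
  have sub2 v : v \in z :: s2 -> v \in x :: p1 ++ s2 ++ p2.
    rewrite inE => /orP[/eqP ->|]; last by rewrite inE !mem_cat => ->; rewrite !orbT.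
    by apply: sub.
  move=> e /hE[/h4[|[a1 a2]]|[a1 a2]]; first by left.
    by right; split; apply: sub2.
  by right; split; apply: sub.
Qed.

Lemma euler_TSP E : 0 < n -> (forall u v, connect (tree_rel E) u v) ->
  (forall v, ~~ odd (deg E v)) -> TSP w <= cost E.
Proof.
move=> n0 conn hev; pose x := Ordinal n0.
have hE e : e \in E -> e \in E \/ (e.1 \in [:: x] /\ e.2 \in [:: x]) by left.
have [s hl [hK hv]] := @euler_splice E E x [::] (cost E) conn erefl (leqnn _) hev hE.
exact: leq_trans (TSP_walk hl hv) hK.
Qed.

End Euler.

Lemma tree_rel_sym n (T : seq ('I_n * 'I_n)) : symmetric (tree_rel T).
Proof. by move=> u v; rewrite /tree_rel orbC. Qed.

(** * Chords of the tree and the set [C] of covered edges *)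

Section CoverBound.
Variables (n : nat) (w : 'I_n -> 'I_n -> nat).
Hypothesis metw : is_int_metric w.
Variables (r : 'I_n) (par : 'I_n -> 'I_n) (lv : 'I_n -> nat).
Hypothesis rtd : rooted r par lv.

Let om x := w x (par x).
Let V := 'I_n.
Let sp := sep par.

Definition cov (R : seq (V * V)) x : nat := count (fun h => sp x h.1 h.2) R.

(** On the path from [a] to the root every vertex has even degree except the two ends; the loop at
    [r] counts twice and disappears. *)
Lemma incidence_parity (v a : V) :
  \big[addb/false]_x (anc par x a && ((x == v) (+) (par x == v))) =
  (a == v) (+) (v == r).
Proof.
elim/(tree_ind rtd): a => [|a ar IH].
  rewrite (bigD1 r) //= big1 ?addbF.
    by rewrite (anc_root rtd) eqxx (par_root rtd) addbb /= (eq_sym v) addbb.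
  by move=> x xr; rewrite (anc_root rtd) (negbTE xr).
rewrite (bigD1 a) //= anc_refl /=.
have -> : \big[addb/false]_(i | i != a) (anc par i a && ((i == v) (+) (par i == v))) =
   \big[addb/false]_i (anc par i (par a) && ((i == v) (+) (par i == v))).
  rewrite [RHS](bigD1 a) //= (anc_self_par rtd ar) /=; apply: eq_bigr => x xa.
  by rewrite ancE (negbTE xa).
by rewrite IH; case: (a == v); case: (par a == v); case: (v == r).
Qed.

Lemma sep_parity (v a b : V) :
  \big[addb/false]_x (sp x a b && ((x == v) (+) (par x == v))) =
  (a == v) (+) (b == v).
Proof.
have -> : (a == v) (+) (b == v) = ((a == v) (+) (v == r)) (+) ((b == v) (+) (v == r)).
  by case: (a == v); case: (b == v); case: (v == r).
rewrite -!incidence_parity -big_split /=; apply: eq_bigr => x _.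
by rewrite /sp /sep andb_addl.
Qed.

Definition tree_edges (P : pred V) : seq (V * V) := [seq (x, par x) | x <- enum V & P x].

Lemma cost_tree_edges P : cost w (tree_edges P) = wt om P.
Proof. by rewrite /cost /tree_edges big_map big_filter big_enum_cond. Qed.

Lemma deg_cat n' (E1 E2 : seq ('I_n' * 'I_n')) v : deg (E1 ++ E2) v = deg E1 v + deg E2 v.
Proof. by rewrite /deg big_cat. Qed.

(** A tree edge is taken once if an odd number of chords spans it and twice otherwise. Modulo 2 this
    is the sum of the tree paths of the chords, which has odd degree exactly where [R] does. *)
Lemma join_even R v :
  ~~ odd (deg (tree_edges xpredT ++ tree_edges (fun x => ~~ odd (cov R x)) ++ R) v).
Proof.
have te P : odd (deg (tree_edges P) v) =
    \big[addb/false]_x (P x && ((x == v) (+) (par x == v))).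
  rewrite /deg /tree_edges big_map big_filter big_enum_cond /=.
  rewrite (big_morph odd oddD (erefl _)) big_mkcond; apply: eq_bigr => x _.
  by case: (P x); rewrite //= oddD !oddb.
have rr : odd (deg R v) = \big[addb/false]_x (odd (cov R x) && ((x == v) (+) (par x == v))).
  elim: R => [|h R IH]; first by rewrite /deg big_nil big1.
  rewrite /deg big_cons oddD -/(deg R v) IH oddD !oddb -sep_parity -big_split /=.
  apply: eq_bigr => x _; rewrite oddD oddb.
  by rewrite andb_addl.
rewrite !deg_cat !oddD !te rr -!big_split /= big1 // => x _.
by case: (odd _) => /=; rewrite ?addbF ?addbb.
Qed.

Lemma join_connected R u v : connect (tree_rel (tree_edges xpredT ++ R)) u v.
Proof.
have toroot a : connect (tree_rel (tree_edges xpredT ++ R)) a r.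
  elim/(tree_ind rtd): a => [|a ar IH]; first exact: connect0.
  apply: connect_trans (connect1 _) IH; rewrite /tree_rel mem_cat; apply/orP; left.
  apply/orP; left; apply/mapP; exists a => //; by rewrite mem_filter mem_enum.
apply: connect_trans (toroot u) _.
by rewrite (sym_connect_sym (@tree_rel_sym _ _)).
Qed.

(** Derandomised choice of a uniform subset of [H]: an edge spanned by some chord gets odd parity
    for half of the subsets. [pi] is the parity contributed by the chords already decided. *)
Lemma choose_half (H : seq (V * V)) (pi : V -> bool) : exists R,
  2 * wt om (fun x => ~~ (pi x (+) odd (cov R x))) + 2 * cost w R <=
  \sum_x om x * (if 0 < cov H x then 1 else 2 * ~~ pi x) + cost w H.
Proof.
elim: H pi => [|h H IH] pi.
  exists [::]; rewrite /cost !big_nil muln0 !addn0 /wt big_distrr /= big_mkcond /=.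
  apply: leq_sum => x _; by rewrite addbF; case: (pi x); rewrite ?muln0 //= mulnC.
have [R1 h1] := IH pi; have [R2 h2] := IH (fun x => pi x (+) sp x h.1 h.2).
pose a := 2 * wt om (fun x => ~~ (pi x (+) odd (cov R1 x))) + 2 * cost w R1.
pose b := 2 * wt om (fun x => ~~ (pi x (+) odd (cov (h :: R2) x))) + 2 * cost w (h :: R2).
have hb : b = 2 * wt om (fun x => ~~ (pi x (+) sp x h.1 h.2 (+) odd (cov R2 x))) +
     2 * cost w R2 + 2 * w h.1 h.2.
  have e : wt om (fun x => ~~ (pi x (+) odd (cov (h :: R2) x))) =
           wt om (fun x => ~~ (pi x (+) sp x h.1 h.2 (+) odd (cov R2 x))).
    by apply: eq_bigl => x; rewrite /= oddD oddb addbA.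
  rewrite /b e /cost big_cons; set S := \sum_(e <- R2) _; set W := wt _ _.
  by rewrite mulnDr addnA addnAC.
rewrite -/a in h1.
(* Leaving [h] out costs [a] and taking it costs [b]; the better choice is at most the average. *)
suff : a + b <= 2 * (\sum_x om x * (if 0 < cov (h :: H) x then 1 else 2 * ~~ pi x) + cost w (h :: H)).
  move=> hab; have [le|gt] := leqP a b; first by exists R1; lia.
  by exists (h :: R2); lia.
rewrite hb; apply: leq_trans (leq_add h1 (leq_add h2 (leqnn _))) _.
rewrite /cost big_cons -!/(cost _ _).
have key : \sum_x om x * (if 0 < cov H x then 1 else 2 * ~~ pi x) +
   \sum_x om x * (if 0 < cov H x then 1 else 2 * ~~ (pi x (+) sp x h.1 h.2)) <=
   2 * \sum_x om x * (if 0 < cov (h :: H) x then 1 else 2 * ~~ pi x).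
  rewrite -big_split big_distrr /=; apply: leq_sum => x _.
  rewrite -mulnDr mulnCA leq_mul2l; apply/orP; right.
  by case: (sp _ _ _); case: (0 < cov H x) => //=; case: (pi x).
move: key; set A := \sum_x _; set B := \sum_x _; set D := \sum_x _.
clearbody A B D; move: (cost w H) (w h.1 h.2) => X Y; clear; lia.
Qed.

Lemma cover_bound (H : seq (V * V)) : 0 < n ->
  2 * TSP w + wt om (fun x => 0 < cov H x) <= 4 * wt om xpredT + cost w H.
Proof.
move=> n0; have [R hR] := choose_half H (fun=> false).
have := @euler_TSP _ _ metw _ n0 (@join_connected _) (join_even R).
rewrite /cost !big_cat -!/(cost _ _) !cost_tree_edges /= => hT.
have e : \sum_x om x * (if 0 < cov H x then 1 else 2 * ~~ false) +
   wt om (fun x => 0 < cov H x) = 2 * wt om xpredT.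
  rewrite /wt [X in _ + X]big_mkcond -big_split big_distrr /=; apply: eq_bigr => x _.
  case: ifP; lia.
have e2 : wt om (fun x => ~~ (false (+) odd (cov R x))) = wt om (fun x => ~~ odd (cov R x)) by [].
rewrite e2 in hR; move: hT hR e.
set A := wt om _; set B := wt om _; set D := wt om _; set S := \sum_x _.
by rewrite /cost; lia.
Qed.

(** A pair violating the first clause is added as a chord. It newly covers more than 1.01 times its
    own length, so 101 times the cost stays below 100 times the covered weight. In [cover_bound] the
    cost then eats up all but 1/101 of the covered weight, whence 202 and 404. *)
Theorem cover_structure : 0 < n -> exists C : {set V},
  (forall u v, 100 * dist par om (fun x => x \notin C) u v <= 101 * w u v) /\
  wt om (fun x => x \in C) + 202 * TSP w <= 404 * wt om xpredT.
Proof.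
move=> n0.
suff [H [hH hc]] : exists H, 101 * cost w H <= 100 * wt om (fun x => 0 < cov H x) /\
   forall u v, 100 * dist par om (fun x => ~~ (0 < cov H x)) u v <= 101 * w u v.
  exists [set x | 0 < cov H x]; split.
    move=> u v; rewrite (_ : dist _ _ _ _ _ = dist par om (fun x => ~~ (0 < cov H x)) u v) //.
    by apply: eq_bigl => x; rewrite inE.
  have -> : wt om (fun x => x \in [set x | 0 < cov H x]) = wt om (fun x => 0 < cov H x).
    by apply: eq_bigl => x; rewrite inE.
  have := cover_bound H n0; lia.
have : exists H, 101 * cost w H <= 100 * wt om (fun x => 0 < cov H x).
  by exists [::]; rewrite /cost big_nil.
case=> H; have [m] := ubnP #|[pred x | cov H x == 0]|; elim: m H => // m IH H hm hH.
case: (boolP [forall u, forall v, 100 * dist par om (fun x => ~~ (0 < cov H x)) u v <= 101 * w u v]).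
  move=> /forallP h; exists H; split => // u v; by have /forallP := h u; apply.
rewrite negb_forall => /existsP[u]; rewrite negb_forall => /existsP[v]; rewrite -ltnNge => viol.
apply: (IH ((u, v) :: H)).
  rewrite ltnS in hm; apply: leq_trans hm; apply: proper_card; apply/properP; split.
    by apply/subsetP => x; rewrite !inE /= addn_eq0 => /andP[].
  have : dist par om (fun x => ~~ (0 < cov H x)) u v != 0 by lia.
  rewrite /dist sum_nat_eq0 negb_forall => /existsP[x]; rewrite negb_imply.
  rewrite muln_eq0 negb_or => /and3P[h1 _ h2]; exists x; rewrite !inE.
    by rewrite -leqn0 leqNgt.
  by rewrite /= /sp addn_eq0 negb_and h2.
have -> : wt om (fun x => 0 < cov ((u, v) :: H) x) =
   wt om (fun x => 0 < cov H x) + dist par om (fun x => ~~ (0 < cov H x)) u v.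
  rewrite /wt /dist big_mkcond [X in _ = X + _]big_mkcond [X in _ = _ + X]big_mkcond -big_split /=.
  apply: eq_bigr => x _; rewrite addn_gt0 /sp; case: (sep _ _ _ _); case: (0 < cov H x) => /=; lia.
rewrite /cost big_cons -/(cost _ _) /=; move: viol hH; set A := wt _ _; set B := dist _ _ _ _ _; move: (cost w H) => X; clearbody A B; clear; lia.
Qed.

End CoverBound.

(** * Minimum spanning trees *)

Section FromSpanningTree.
Variables (n : nat) (T : seq ('I_n * 'I_n)) (r : 'I_n).
Hypothesis spT : is_spanning_tree T.

(** [lv] is the distance from [r] inside [T], and the parent is the last but one vertex of a
    shortest path. *)
Lemma spanning_rooted : exists (par : {ffun 'I_n -> 'I_n}) (lv : 'I_n -> nat),
  rooted r par lv /\ forall v, v != r -> tree_rel T v (par v).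
Proof.
have [_ conn] := spT.
pose P v k := [exists p : k.-tuple 'I_n, path (tree_rel T) r p && (last r p == v)].
have PI v (p : seq 'I_n) : path (tree_rel T) r p -> last r p = v -> P v (size p).
  by move=> h1 h2; apply/existsP; exists (in_tuple p); rewrite h1 h2 eqxx.
have exP v : exists k, P v k.
  by have /connectP[p h1 h2] := conn r v; exists (size p); apply: PI.
pose lv v := ex_minn (exP v).
have lvP v : P v (lv v) /\ forall k, P v k -> lv v <= k.
  by rewrite /lv; case: ex_minnP => k h1 h2; split.
have /fin_all_exists[f hf] v : exists u, if v == r then u = r else
    tree_rel T v u /\ lv v = (lv u).+1.
  case: eqVneq => [_|vr]; first by exists r.
  have [/existsP[p /andP[pp /eqP hl]] hmin] := lvP v.
  have := pp; have := hl; have := size_tuple p; case/lastP: (tval p) => [|p' z].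
    by move=> _ /= e; rewrite e eqxx in vr.
  rewrite last_rcons size_rcons rcons_path => hs -> /andP[pp' hz].
  exists (last r p'); split; first by rewrite tree_rel_sym.
  have [/existsP[p2 /andP[pp2 /eqP hl2]] hmin2] := lvP (last r p').
  have a1 : lv (last r p') <= size p' by apply: hmin2; apply: PI.
  have a2 : lv v <= (lv (last r p')).+1.
    apply: hmin; have := PI v (rcons p2 v); rewrite size_rcons size_tuple; apply.
      by rewrite rcons_path pp2 hl2 hz.
    by rewrite last_rcons.
  lia.
exists [ffun v => f v], lv; split; last first.
  by move=> v vr; rewrite ffunE; have := hf v; rewrite (negbTE vr) => -[].
split; first by rewrite ffunE; have := hf r; rewrite eqxx.
by move=> v vr; rewrite ffunE; have := hf v; rewrite (negbTE vr) => -[].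
Qed.

Variables (par : 'I_n -> 'I_n) (lv : 'I_n -> nat).
Hypothesis rtd : rooted r par lv.
Hypothesis parT : forall v, v != r -> tree_rel T v (par v).
Variable w : 'I_n -> 'I_n -> nat.
Hypothesis metw : is_int_metric w.

Let om x := w x (par x).

(** [T] has [n.-1] entries and contains the [n.-1] distinct parent edges, each in some orientation,
    so it is a permutation of them. *)
Lemma tree_weightE : tree_weight w T = wt om xpredT.
Proof.
have [w0 _ wC _] := metw; have [sT _] := spT.
pose e x := if (x, par x) \in T then (x, par x) else (par x, x).
pose L := [seq e x | x <- enum 'I_n & x != r].
have einj : {in [pred x | x != r] &, injective e}.
  move=> x y; rewrite !inE => xr yr; have ly := lv_par rtd yr; have lx := lv_par rtd xr.
  rewrite /e; case: ifP => _; case: ifP => _ [h1 h2] //; exfalso.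
    by move: lx ly; rewrite h2 -h1; lia.
  by move: lx ly; rewrite h1 -h2; lia.
have uL : uniq L.
  rewrite map_inj_in_uniq; first by apply: filter_uniq; apply: enum_uniq.
  by move=> x y; rewrite !mem_filter => /andP[hx _] /andP[hy _]; apply: einj.
have sub : {subset L <= T}.
  move=> z /mapP[x]; rewrite mem_filter => /andP[xr _] ->; rewrite /e.
  by case: ifP => // h; have := parT xr; rewrite /tree_rel h.
have sL : size L = n.-1.
  rewrite size_map size_filter -sum1_count big_enum_cond /= -[n in RHS]card_ord.
  by rewrite -(cardC1 r) -sum1_card; apply: eq_bigl => x; rewrite !inE.
have sz : size T <= size L by rewrite sT sL.
have pL : perm_eq T L.
  apply: uniq_perm => //; first exact: leq_size_uniq sub sz.
  by have [_ /(_ _) h] := uniq_min_size uL sub sz; move=> x; rewrite h.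
rewrite /tree_weight (perm_big _ pL) big_map big_filter big_enum_cond /=.
rewrite /wt [RHS](bigD1 r) //= {1}/om (par_root rtd) w0 add0n; apply: eq_bigr => x xr.
by rewrite /e; case: ifP => //= _; rewrite wC.
Qed.

Hypothesis mst : is_MST w T.

(** Exchange: the pair reconnects the vertices below [x] with the others, so it can replace the edge
    of [x] in the spanning tree. *)
Lemma mst_cut x u v : sep par x u v -> om x <= w u v.
Proof.
have [w0 _ wC _] := metw; have [_ hmin] := mst.
wlog : u v / anc par x u && ~~ anc par x v.
  move=> H; case: (boolP (anc par x u && ~~ anc par x v)) => [|h] s; first by move=> /H; apply.
  rewrite wC; apply: H; last by rewrite sepC.
  by move: h s; rewrite /sep; case: anc; case: anc.
move=> /andP[xu nxv] s; have xr := sep_nroot rtd s.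
pose L := [seq (y, par y) | y <- enum 'I_n & (y != r) && (y != x)].
have hcost : tree_weight w L + om x = wt om xpredT.
  rewrite /tree_weight /L big_map big_filter big_enum_cond /wt /=.
  rewrite [RHS](bigD1 r) //= {2}/om (par_root rtd) w0 add0n [RHS](bigD1 x) //= addnC.
  by congr (_ + _); apply: eq_bigl => y.
have sp' : is_spanning_tree ((u, v) :: L).
  split.
    rewrite /= size_map size_filter -sum1_count big_enum_cond /= -[n in RHS]card_ord.
    rewrite -(cardC1 r) (cardD1 x) !inE xr add1n; congr S.
    by rewrite -sum1_card; apply: eq_bigl => y; rewrite !inE andbC.
  have symc := sym_connect_sym (@tree_rel_sym _ ((u, v) :: L)).
  have step y : y != r -> y != x -> connect (tree_rel ((u, v) :: L)) y (par y).
    move=> yr yx; apply: connect1; apply/orP; left; rewrite inE; apply/orP; right.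
    by apply/mapP; exists y => //; rewrite mem_filter yr yx mem_enum.
  have up a : ~~ anc par x a -> connect (tree_rel ((u, v) :: L)) a r.
    elim/(tree_ind rtd): a => [|a ar IH] na; first exact: connect0.
    apply: connect_trans (step a ar _) (IH _).
      by apply: contraNneq na => ->; apply: anc_refl.
    by apply: contra na; apply: anc_par.
  have dn a : anc par x a -> connect (tree_rel ((u, v) :: L)) a x.
    elim/(tree_ind rtd): a => [|a ar IH]; first by rewrite (anc_root rtd) (negbTE xr).
    have [-> _|ax] := eqVneq a x; first exact: connect0.
    rewrite ancE eq_sym (negbTE ax) /= => h; exact: connect_trans (step a ar ax) (IH h).
  have all_r a : connect (tree_rel ((u, v) :: L)) a r.
    case: (boolP (anc par x a)) => [h|]; last exact: up.
    apply: connect_trans (dn a h) _; apply: connect_trans (_ : connect _ x u) _.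
      by rewrite symc; apply: dn.
    apply: connect_trans (connect1 _) (up v nxv).
    by rewrite /tree_rel mem_head.
  move=> a b; apply: connect_trans (all_r a) _; by rewrite symc.
have h := hmin _ sp'; rewrite tree_weightE -hcost in h.
have e : tree_weight w ((u, v) :: L) = tree_weight w L + w u v.
  by rewrite /tree_weight big_cons addnC.
by rewrite e leq_add2l in h.
Qed.

Lemma w_le_dist u v : w u v <= dist par om xpredT u v.
Proof.
have [w0 _ wC wT] := metw.
have [k] := ubnP #|[pred z | sep par z u v]|; elim: k v => // k IH v hk.
have [->|vu] := eqVneq v u; first by rewrite w0.
have [b' [y [yr hb hz]]] := sep_step rtd vu.
have sy : sep par y u v by rewrite (hz y).1 eqxx.
have ny : ~~ sep par y u b' by have := (hz y).2; rewrite eqxx => /negbT.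
have hd : dist par om xpredT u v = dist par om xpredT u b' + om y.
  rewrite /dist (bigD1 y) //= [in RHS](bigD1 y) //= sy (negbTE ny) muln1 muln0 add0n addnC.
  congr (_ + _); apply: eq_bigr => z zy; by rewrite (hz z).1 (negbTE zy).
have hb' : w b' v = om y by case: hb => -[-> ->]; rewrite /om // wC.
apply: leq_trans (wT u b' v) _; rewrite hb' hd leq_add2r; apply: IH.
rewrite ltnS in hk; apply: leq_trans hk; apply: proper_card; apply/properP; split.
  by apply/subsetP => z; rewrite !inE => h; rewrite (hz z).1 h orbT.
by exists y; rewrite !inE.
Qed.

End FromSpanningTree.

(** * Nets and soundness of the witnesses *)

Section Nets.
Variables (V : finType) (r : V) (par : V -> V) (lv : V -> nat) (om : V -> nat).
Hypothesis rtd : rooted r par lv.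

Notation dep := (depth par om).

Definition cross (rho s : nat) v := (dep (par v) + s) %/ rho < (dep v + s) %/ rho.

Definition netpt (E : pred V) rho s v := istop r E v || cross rho s v.

(** Go up from [v] to the first edge that is in [E] or passes a multiple of [rho] in shifted depth.
    No multiple is passed on the way, so the depth drops by less than [rho]. *)
Lemma net_anc E rho s v : 0 < rho -> exists p,
  [/\ anc par p v, netpt E rho s p, top r par lv E p = top r par lv E v &
      dep v < dep p + rho].
Proof.
move=> rho0; pose E' y := E y || cross rho s y.
exists (top r par lv E' v).
have ha := top_anc rtd E' v.
have hq : (dep v + s) %/ rho = (dep (top r par lv E' v) + s) %/ rho.
  elim/(tree_ind rtd): v {ha} => [|v vr IH].
    by rewrite (top_id rtd) // /istop eqxx.
  case: (boolP (E' v)) => h.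
    by rewrite (top_id rtd) // /istop h orbT.
  rewrite -(top_par rtd vr h) -IH; apply/eqP; rewrite eqn_leq; apply/andP; split.
    by move: h; rewrite negb_or -leqNgt => /andP[_ ->].
  by rewrite leq_div2r // leq_add2r depth_mono // anc_parl.
split => //.
- by have := top_istop rtd E' v; rewrite /istop /netpt /E' /istop orbA.
- by apply: top_sub => // x Ex; rewrite /E' Ex.
- have e1 := divn_eq (dep v + s) rho.
  have e2 := divn_eq (dep (top r par lv E' v) + s) rho.
  have m1 : (dep v + s) %% rho < rho by rewrite ltn_mod.
  rewrite hq in e1; lia.
Qed.

Lemma hermite rho d : 0 < rho -> \sum_(s < rho) (d + s) %/ rho = d.
Proof.
move=> rho0; elim: d => [|d IH].
  by apply: big1 => s _; rewrite add0n divn_small.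
have e : \sum_(s < rho.+1) (d + s) %/ rho = d + (d + rho) %/ rho.
  by rewrite big_ord_recr /= IH.
rewrite big_ord_recl /= addn0 in e.
have -> : \sum_(s < rho) (d.+1 + s) %/ rho = \sum_(i < rho) (d + bump 0 i) %/ rho.
  by apply: eq_bigr => i _; rewrite /bump add1n addSnnS.
move: e; rewrite divnDr // divnn rho0 /=; lia.
Qed.

(** By Hermite's identity the edge of [v] crosses for at most [om v] of the shifts; the best shift
    therefore has at most the average number of crossings ([net_size]). *)
Lemma cross_sum rho : 0 < rho ->
  \sum_(s < rho) #|[pred v | cross rho s v]| <= wt om xpredT.
Proof.
move=> rho0.
under eq_bigr => s _ do rewrite -sum1_card big_mkcond.
rewrite exchange_big /=; apply: leq_sum => v _.
have h : \sum_(s < rho) (if cross rho s v then 1 else 0) + dep (par v) <= dep v.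
  rewrite -{1}(hermite (dep (par v)) rho0) -(hermite (dep v) rho0) -big_split /=.
  apply: leq_sum => s _; rewrite /cross; case: ifP => [|_]; first by rewrite add1n.
  by rewrite add0n leq_div2r // leq_add2r depth_mono // anc_parl.
rewrite (eq_bigr (fun s : 'I_rho => if cross rho s v then 1 else 0)) //.
move: h; have [->|vr] := eqVneq v r; last first.
  by rewrite (depth_par rtd om vr) addnC leq_add2l.
by rewrite (par_root rtd); move: (\sum_(_ < _) _) (dep r) => a b; lia.
Qed.

Definition bestshift rho : nat :=
  if rho is k.+1 then
    nat_of_ord [arg min_(s < (ord0 : 'I_k.+1)) #|[pred v | cross rho s v]|]
  else 0.

Lemma net_size rho : 0 < rho ->
  rho * #|[pred v | cross rho (bestshift rho) v]| <= wt om xpredT.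
Proof.
case: rho => // k _; apply: leq_trans (cross_sum (ltn0Sn k)).
rewrite /bestshift; case: arg_minnP => // s _ hs.
rewrite -[X in X * _](card_ord k.+1) -sum_nat_const.
by apply: leq_sum => i _; apply: hs.
Qed.

End Nets.

Section Vitali.
Variables (V : finType) (om tt : V -> nat) (Y : V -> {set V}).

(** Vitali covering: take the member [g] of largest scale, drop all members whose set meets [Y g],
    and continue with [C] deprived of [Y g]. The chosen sets are disjoint, so their parts of [C] add
    up, while each choice disposes of weight at most [Lam * tt g]. *)
Lemma vitali (Lam : nat) (R C : {set V}) :
  (forall x, x \in R -> tt x <= 10 * wt om (fun y => (y \in C) && (y \in Y x))) ->
  (forall g, g \in R -> wt om (fun f => [&& f \in R, tt f <= tt g &
      (f == g) || ~~ [disjoint Y f & Y g]]) <= Lam * tt g) ->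
  wt om (fun x => x \in R) <= 10 * Lam * wt om (fun x => x \in C).
Proof.
have [m] := ubnP #|R|; elim: m R C => // m IH R C hm h1 h2.
have [->|[x0 x0R]] := set_0Vmem R.
  by rewrite /wt big_pred0 // => x; rewrite inE.
pose g := [arg max_(x > x0 | x \in R) tt x].
have [gR gmax] : g \in R /\ forall x, x \in R -> tt x <= tt g.
  by rewrite /g; case: arg_maxnP.
pose R' := [set f in R | (f != g) && [disjoint Y f & Y g]].
pose C' := C :\: Y g.
have sub : R' \subset R by apply/subsetP => f; rewrite inE => /andP[].
have IH' : wt om (fun x => x \in R') <= 10 * Lam * wt om (fun x => x \in C').
  apply: IH.
  - rewrite ltnS in hm; apply: leq_trans hm; apply: proper_card; apply/properP; split => //.
    by exists g; rewrite ?inE ?eqxx ?andbF.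
  - move=> x; rewrite inE => /and3P[xR xg dj]; apply: leq_trans (h1 x xR) _.
    rewrite leq_mul2l /=; rewrite leq_eqVlt; apply/orP; left; apply/eqP.
    apply: eq_bigl => y; rewrite inE; case: (boolP (y \in Y x)) => yx; rewrite ?andbF //.
    by rewrite (disjointFr dj yx).
  - move=> x xR'; have xR := subsetP sub x xR'.
    apply: leq_trans (h2 x xR); rewrite /wt big_mkcond [X in _ <= X]big_mkcond /=.
    apply: leq_sum => f _; case: (boolP (f \in R')) => //= fR'.
    by rewrite (subsetP sub f fR') /=.
have hR : wt om (fun x => x \in R) <= Lam * tt g + wt om (fun x => x \in R').
  apply: leq_trans (leq_add (h2 g gR) (leqnn _)).
  rewrite /wt big_mkcond [X in _ <= X + _]big_mkcond [X in _ <= _ + X]big_mkcond -big_split /=.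
  apply: leq_sum => f _; rewrite inE; case: (boolP (f \in R)) => //= fR.
  rewrite (gmax f fR) /=; case: (f == g) => /=; first exact: leq_addr.
  by case: [disjoint _ & _]; rewrite /= ?addn0.
have hC : wt om (fun x => x \in C) =
    wt om (fun y => (y \in C) && (y \in Y g)) + wt om (fun x => x \in C').
  rewrite /wt (bigID (fun x => x \in Y g)) /=; congr (_ + _).
  by apply: eq_bigl => y; rewrite inE andbC.
have hg := h1 g gR.
have : Lam * tt g <= 10 * Lam * wt om (fun y => (y \in C) && (y \in Y g)).
  by rewrite (mulnC 10) -mulnA leq_mul2l hg orbT.
rewrite hC mulnDr; move: hR IH'.
move: (wt _ _) (wt _ _) (wt _ _) (wt _ _) (Lam * tt g) (10 * Lam) => a b c d e f; clear; nia.
Qed.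

End Vitali.

Section Soundness.
Variables (V : finType) (r : V) (par : V -> V) (lv : V -> nat) (om : V -> nat).
Hypothesis rtd : rooted r par lv.
Variables (w : V -> V -> nat) (C : {set V}).
Hypothesis cutC : forall u v, 100 * dist par om (fun x => x \notin C) u v <= 101 * w u v.

Notation dep := (depth par om).
Notation tp := (top r par lv).

Lemma chain_wt x p : anc par x p ->
  wt om (fun y => anc par x y && anc par y p) = om x + dist par om xpredT x p.
Proof.
move=> xp; rewrite /wt (bigD1 x) /=; last by rewrite anc_refl xp.
congr (_ + _); rewrite dist_wt; apply: eq_bigl => y /=; rewrite sep_anc //.
apply/idP/idP => [/andP[/andP[h1 h2] h3]|/andP[h1 h2]].
  by rewrite h2 /=; apply: contra h3 => h; rewrite (anc_anti rtd h h1).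
rewrite h1 andbT; have := anc_total rtd xp h1; rewrite (negbTE h2) orbF => -> /=.
by apply: contraNneq h2 => ->; apply: anc_refl.
Qed.

Definition long_witness x p q :=
  [&& x != r, anc par x p, ~~ anc par x q & 4 * w p q <= dep p - dep x].

(** The path from [p] to [q] contains the chain from [p] up to the edge [x]. Outside [C] it has
    length at most 1.01 times [w p q], little more than a quarter of the chain, so at least half of
    the chain lies in [C]. *)
Lemma long_sound (Z : pred V) :
  (forall x, Z x -> exists p q, long_witness x p q) ->
  wt om Z <= 2 * wt om (fun x => x \in C).
Proof.
move=> hZ; apply: (resource_bound rtd); last first.
  by apply/negP => /hZ[p [q]]; rewrite /long_witness eqxx.
move=> x /hZ[p [q /and4P[xr xp nxq hw]]]; exists p => //.
have e := chain_wt xp; have hd := depth_anc om xp.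
have eI : wt om (fun y => anc par x y && anc par y p) =
   wt om (fun y => [&& y \in C, anc par x y & anc par y p]) +
   wt om (fun y => [&& y \notin C, anc par x y & anc par y p]).
  by rewrite /wt (bigID (fun y => y \in C)) /=; congr (_ + _); apply: eq_bigl => y; rewrite andbC.
have hU : wt om (fun y => [&& y \notin C, anc par x y & anc par y p]) <=
   dist par om (fun x => x \notin C) p q.
  rewrite dist_wt /wt big_mkcond [X in _ <= X]big_mkcond /=; apply: leq_sum => y _.
  case: ifP => // /and3P[-> xy yp]; rewrite /sep yp /=.
  have -> : anc par y q = false by apply/negbTE; apply: contra nxq; apply: anc_trans.
  by [].
have := cutC p q.
move: (wt _ _) (wt _ _) (wt _ _) (dist _ _ _ _ _) (dist _ _ _ _ _) e eI hU hd hw => a b c d f.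
clear; lia.
Qed.

Section OneLevel.
Variables (t t' rho : nat).
Hypotheses (t_big : 64 * 100 <= t) (tt' : t < t') (t'_le : 99 * t' <= 100 * t) (rho_le : 64 * rho <= t).

Definition lvl x := t <= om x < t'.
Definition bigE x := t <= om x.
Definition bigE' x := t' <= om x.

Definition lchild B y := lvl y && (tp bigE (par y) == B).

Definition repl_witness x a v :=
  [&& x != r, lvl x, tp bigE a == x, tp bigE v == tp bigE (par x),
      w a v <= t' + rho & om x + t %/ 2 <= dist par om xpredT a v + rho].

(** As [x] is outside [C], [cutC] leaves less than t / 25 for the other edges outside [C], while the
    two sides of [x] have total length nearly t / 2; so one side lies mostly in [C]. The lower side
    is a descending chain, suited to [resource_bound]. The upper side need not be one; it is trimmed
    to length at most 2t, for [vitali]. *)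
Lemma repl_sides x a v : repl_witness x a v -> x \notin C ->
  (2 * (om x + dist par om xpredT x a) <=
     2 * 8 * (wt om (fun y => [&& y \in C, anc par x y & anc par y a]))) \/
  exists v', [/\ (forall z, sep par z (par x) v' -> om z < t),
     dist par om xpredT (par x) v' <= 2 * t &
     t <= 10 * dist par om (fun y => y \in C) (par x) v'].
Proof.
move=> /and5P[xr /andP[lx1 lx2] /eqP ha /eqP hv /andP[hw hd]] xC.
have xtop : istop r bigE x by rewrite /istop /bigE lx1 orbT.
have xa : anc par x a by rewrite -ha; apply: top_anc.
have nxv : ~~ anc par x v.
  rewrite -(anc_top rtd v xtop) hv (anc_top rtd _ xtop); by rewrite (anc_self_par rtd xr).
have hall := dist_through rtd om xpredT xa nxv.
have hU := dist_through rtd om (fun y => y \notin C) xa nxv.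
have hcut := cutC a v.
rewrite xC mul1n in hU; rewrite mul1n in hall.
rewrite (distC _ _ _ a x) in hall; rewrite (distC _ _ _ a x) in hU.
have splitC u u' : dist par om xpredT u u' =
    dist par om (fun y => y \in C) u u' + dist par om (fun y => y \notin C) u u'.
  by rewrite /dist (bigID (fun y => y \in C)).
have [sideA|sideB] := leqP (24 * t) (100 * dist par om xpredT x a).
  left.
  have e : wt om (fun y => [&& y \in C, anc par x y & anc par y a]) =
      dist par om (fun y => y \in C) x a.
    rewrite dist_wt; apply: eq_bigl => y; rewrite sep_anc //.
    case: (boolP (y \in C)) => //= yC; apply/idP/idP => [/andP[h1 h2]|/andP[h1 h2]].
      rewrite h2 /=; apply: contraL yC => h; by rewrite (anc_anti rtd h h1).
    by rewrite h1; have := anc_total rtd xa h1; rewrite (negbTE h2) orbF => ->.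
  rewrite e; have := splitC x a; lia.
right.
have om_lt z : sep par z (par x) v -> om z < t.
  move=> sz; rewrite ltnNge; apply/negP => hz.
  by have /eqP/(top_eqP rtd) := hv; move=> /(_ z hz); rewrite sepC sz.
have sb : t %/ 5 <= dist par om xpredT (par x) v by lia.
have [v' [h1 h2 h3]] := path_trim rtd sb (fun z hz => ltnW (om_lt z hz)).
exists v'; split; [by move=> z /h1/om_lt | lia |].
have hle : dist par om (fun y => y \notin C) (par x) v' <=
           dist par om (fun y => y \notin C) (par x) v.
  by apply: leq_dist => z -> /h1 ->.
have := splitC (par x) v'; lia.
Qed.

Definition far_witness A B a b :=
  [&& tp bigE a == A, tp bigE b == B & w a b <= t' + 2 * rho].

(** Each edge of [C] of this level marks the two parts it joins. *)
Definition coverX D := ((D \in C) && lvl D) || [exists y, (y \in C) && lchild D y].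

(** Parts that are not adjacent are separated by two distinct edges of weight at least [t]; were
    both outside [C], [cutC] would give 2t at most 1.01 (t' + 2 rho), which is false. The two edges
    can be chosen incident to [A] and to [B], hence visible to [coverX], and lying inside one part
    of the next level they belong to the present level. *)
Lemma conflict_cover A B a b :
  A != B -> tp bigE' A = tp bigE' B ->
  tp bigE (par A) != B -> tp bigE (par B) != A ->
  istop r bigE A -> istop r bigE B -> far_witness A B a b ->
  coverX A || coverX B.
Proof.
move=> AB same nAB nBA tA tB /and3P[/eqP ha /eqP hb hw].
have aA : anc par A a by rewrite -ha; apply: top_anc.
have bB : anc par B b by rewrite -hb; apply: top_anc.
have two x y : x != y -> t <= om x -> t <= om y -> sep par x a b -> sep par y a b ->
    (x \in C) || (y \in C).
  move=> xy hx hy sx sy; apply: contraT; rewrite negb_or => /andP[nx ny].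
  have := cutC a b; rewrite /dist (bigD1 x) //= (bigD1 y) /=; last by rewrite ny eq_sym.
  rewrite sx sy !muln1; move: hx hy hw t'_le rho_le t_big.
  move: (\sum_(_ | _) _) (om x) (om y) (w a b) => S ox oy W; clear; lia.
have ancAb D : istop r bigE D -> anc par D b = anc par D B.
  by move=> hD; rewrite -(anc_top rtd b hD) hb.
have ancAa D : istop r bigE D -> anc par D a = anc par D A.
  by move=> hD; rewrite -(anc_top rtd a hD) ha.
have lv_of D D' : tp bigE' D = tp bigE' D' -> istop r bigE D -> ~~ anc par D D' -> lvl D.
  move=> e hD nD; have Dr : D != r by apply: contraNneq nD => ->; apply: (anc_rootl rtd).
  have := hD; rewrite /istop (negbTE Dr) /= /bigE => h; rewrite /lvl h /= ltnNge.
  apply: contra nD => hD'.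
  have : istop r bigE' D by rewrite /istop /bigE' hD' orbT.
  by move=> /(top_id rtd) <-; rewrite e; apply: top_anc.
(* a proper ancestor B' of A' : the edge below B' on the way to A' *)
have vert A' B' a' b' : A' != B' -> tp bigE' A' = tp bigE' B' -> tp bigE (par A') != B' ->
    istop r bigE A' -> istop r bigE B' ->
    (forall D, istop r bigE D -> sep par D a' b' = anc par D A' (+) anc par D B') ->
    (forall x y, x != y -> t <= om x -> t <= om y -> sep par x a' b' -> sep par y a' b' ->
      (x \in C) || (y \in C)) ->
    anc par B' A' -> coverX A' || coverX B'.
  move=> AB' same' nAB' tA' tB' hs two' BA.
  have nAB2 : ~~ anc par A' B' by apply: contra AB' => h; rewrite (anc_anti rtd h BA).
  have lA := lv_of A' B' same' tA' nAB2.
  pose P y := [&& anc par y A', istop r bigE y, anc par B' y & y != B'].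
  have PA : P A' by rewrite /P anc_refl tA' BA.
  pose y := [arg min_(y < A' | P y) lv y].
  have [yP ymin] : P y /\ forall z, P z -> lv y <= lv z by rewrite /y; case: arg_minnP.
  have /and4P[yA ty By yB] := yP.
  have nyB : ~~ anc par y B' by apply: contra yB => h; rewrite (anc_anti rtd h By).
  have yr : y != r by apply: contraNneq nyB => ->; apply: (anc_rootl rtd).
  have hz : tp bigE (par y) = B'.
    apply/eqP; apply: contraT => zB.
    have : P (tp bigE (par y)).
      rewrite /P zB (top_istop rtd) (anc_trans (top_anc rtd _ _)) /=; last first.
        exact: anc_trans (anc_parl _ _) yA.
      rewrite andbT; apply: (top_max rtd) => //.
      by move: By; rewrite ancE eq_sym (negbTE yB).
    have hle : lv (tp bigE (par y)) <= lv (par y).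
      have [->//|ne] := eqVneq (tp bigE (par y)) (par y).
      exact: ltnW (anc_lv rtd (top_anc rtd _ _) ne).
    by move=> /ymin h; have := leq_trans h hle; rewrite (lv_par rtd yr) ltnn.
  have ly : lvl y.
    apply: (lv_of y B') => //; apply/eqP/(top_eqP rtd) => z Ez.
    apply/negP; rewrite /sep => h.
    have zt : istop r bigE z by rewrite /istop /bigE (leq_trans (ltnW tt') Ez) orbT.
    have ztop : istop r bigE' z by rewrite /istop Ez orbT.
    have e := anc_top rtd A' ztop; rewrite same' (anc_top rtd B' ztop) in e.
    case zy : (anc par z y) h; rewrite /= => h.
      by move: h; rewrite e (anc_trans zy yA).
    have zB : anc par z B' by rewrite h.
    by rewrite (anc_trans zB By) in zy.
  have sA : sep par A' a' b' by rewrite hs // anc_refl (negbTE nAB2).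
  have sy : sep par y a' b' by rewrite hs // yA (negbTE nyB).
  have yA' : A' != y by apply: contraNneq nAB' => ->; rewrite hz.
  have := two' A' y yA' (proj1 (andP lA)) (proj1 (andP ly)) sA sy.
  case/orP => h; first by rewrite /coverX h lA.
  apply/orP; right; apply/orP; right; apply/existsP; exists y.
  by rewrite h /lchild ly hz eqxx.
case: (boolP (anc par B A)) => [BA|nBA'].
  by apply: (vert A B a b) BA => // D hD; rewrite /sep ancAa // ancAb.
case: (boolP (anc par A B)) => [AB'|nAB'].
  rewrite orbC; apply: (vert B A b a) AB' => //; first by rewrite eq_sym.
    by move=> D hD; rewrite /sep ancAa // ancAb.
  by move=> x y h1 h2 h3; rewrite !(sepC _ _ b); apply: two.
have lA := lv_of A B same tA nAB'; have lB := lv_of B A (esym same) tB nBA'.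
have : (A \in C) || (B \in C).
  apply: two => //; [by case/andP: lA | by case/andP: lB | |].
    by rewrite /sep aA ancAb // (negbTE nAB').
  by rewrite /sep bB ancAa // (negbTE nBA').
by rewrite /coverX; case/orP => ->; rewrite ?lA ?lB ?orbT.
Qed.

End OneLevel.
End Soundness.

Section Levels.
Variables (th : nat -> nat).
Hypothesis thS : forall j, th j < th j.+1.

Lemma th_mono i j : i <= j -> th i <= th j.
Proof.
move=> /subnK <-; elim: (j - i) => // k IH.
by apply: leq_trans IH _; rewrite addSn; apply: ltnW.
Qed.

Lemma th_lt_inv i j : th i < th j -> i < j.
Proof. by move=> h; rewrite ltnNge; apply/negP => /th_mono; lia. Qed.

Lemma th_ge j : j <= th j.
Proof. by elim: j => // j IH; apply: leq_ltn_trans IH (thS j). Qed.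

(** The search range is large enough because [j <= th j]. Below [th 0] the value is 0. *)
Definition level (a : nat) : nat := \max_(j < a.+1 | th j <= a) j.

Lemma level_uniq a j : th j <= a < th j.+1 -> level a = j.
Proof.
move=> /andP[h1 h2]; apply/eqP; rewrite eqn_leq; apply/andP; split.
  by apply/bigmax_leqP => i hi; rewrite -ltnS; apply: th_lt_inv; apply: leq_ltn_trans hi h2.
have ja : j < a.+1 by rewrite ltnS; apply: leq_trans (th_ge j) h1.
exact: (@leq_bigmax_cond _ (fun i : 'I_a.+1 => th i <= a) (fun i => nat_of_ord i) (Ordinal ja)).
Qed.

Lemma level_bounds a : th 0 <= a -> th (level a) <= a < th (level a).+1.
Proof.
move=> h0.
have [j hj] : exists j, th j <= a < th j.+1.
  have ex : exists j, a < th j.+1 by exists a; have := th_ge a.+1.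
  have := ex_minnP ex; case=> j h1 h2; exists j; rewrite h1 andbT.
  case: j h1 h2 => // j _ h2; rewrite leqNgt; apply/negP => /h2; lia.
by rewrite (level_uniq hj).
Qed.

Variable Lam : nat.
Hypothesis th_geo : forall m a, th m <= a -> \sum_(j < m.+1) th j.+1 <= Lam * a.

Lemma th_geo_cond N a : \sum_(j < N | th j <= a) th j.+1 <= Lam * a.
Proof.
elim: N => [|N IH]; first by rewrite big_ord0.
have [h|h] := leqP (th N) a.
  apply: leq_trans (th_geo h); rewrite big_mkcond /=.
  by apply: leq_sum => j _; case: ifP.
by rewrite big_mkcond big_ord_recr /= (leqNgt (th N)) h addn0 -big_mkcond.
Qed.

End Levels.

Section PathTops.
Variables (V : finType) (r : V) (par : V -> V) (lv : V -> nat).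
Hypothesis rtd : rooted r par lv.
Notation tp := (top r par lv).

(** A path enters another part only through an edge of [E]. *)
Lemma path_tops (E : pred V) a b : exists L : seq V,
  [/\ size L <= 1 + #|[pred z | sep par z a b && E z]|, tp E a \in L, tp E b \in L &
      forall z, sep par z a b -> ~~ E z -> tp E z \in L].
Proof.
have [k] := ubnP #|[pred z | sep par z a b]|; elim: k b => // k IH b hk.
have [->|ba] := eqVneq b a.
  exists [:: tp E a]; split; rewrite ?mem_head // => z; by rewrite sepxx.
have [b' [y [yr hb hz]]] := sep_step rtd ba.
have sy : sep par y a b by rewrite (hz y).1 eqxx.
have ny : ~~ sep par y a b' by have := (hz y).2; rewrite eqxx => /negbT.
have sub z : sep par z a b' -> sep par z a b by move=> h; rewrite (hz z).1 h orbT.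
have [|L [h1 h2 h3 h4]] := IH b'.
  rewrite ltnS in hk; apply: leq_trans hk; apply: proper_card; apply/properP; split.
    by apply/subsetP => z; rewrite !inE; apply: sub.
  by exists y; rewrite !inE.
case: (boolP (E y)) => Ey.
  exists (tp E b :: L); split; rewrite ?inE ?eqxx ?h2 ?orbT //.
    rewrite /= add1n ltnS; apply: leq_trans h1 _; rewrite add1n.
    apply: proper_card; apply/properP; split.
      by apply/subsetP => z; rewrite !inE => /andP[/sub -> ->].
    by exists y; rewrite !inE ?sy ?Ey // (negbTE ny).
  move=> z; rewrite (hz z).1 => /orP[/eqP ->|/h4 h /h]; first by rewrite Ey.
  by rewrite inE => ->; rewrite orbT.
have e : tp E b = tp E b' by case: hb => -[-> ->]; rewrite (top_par rtd yr Ey).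
have ey : tp E y = tp E b' by case: hb => -[_ ->] //; rewrite (top_par rtd yr Ey).
exists L; split => //; last first.
- by move=> z; rewrite (hz z).1 => /orP[/eqP -> _|/h4 h /h //]; rewrite ey.
- by rewrite e.
- apply: leq_trans h1 _; rewrite leq_add2l; apply: subset_leq_card; apply/subsetP => z.
  by rewrite !inE => /andP[/sub -> ->].
Qed.

End PathTops.

(** * Soundness of the replacement test *)

Section ReplaceSound.
Variables (V : finType) (r : V) (par : V -> V) (lv : V -> nat) (om : V -> nat).
Hypothesis rtd : rooted r par lv.
Variables (w : V -> V -> nat) (C : {set V}).
Hypothesis cutC : forall u v, 100 * dist par om (fun x => x \notin C) u v <= 101 * w u v.
Variables (th rho : nat -> nat) (Lam : nat).
Hypothesis thS : forall j, th j < th j.+1.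
Hypothesis th_big : forall j, 64 * 100 <= th j.
Hypothesis th_ratio : forall j, 99 * th j.+1 <= 100 * th j.
Hypothesis th_geo : forall m a, th m <= a -> \sum_(j < m.+1) th j.+1 <= Lam * a.
Hypothesis rho_le : forall j, 64 * rho j <= th j.

Notation tp := (top r par lv).
Notation Ej j := (bigE om (th j)).

(** Otherwise one bad path inside a part could be blamed by arbitrarily many of its children. The
    bound 2 suits completeness: on average a part has two ends of long hops, so parts with three or
    more children are exceptional ([many_bound]). *)
Definition few_children j B := #|[pred y | lchild r par lv om (th j) (th j.+1) B y]| <= 2.

Let goodv j x v := [&& [forall z, sep par z (par x) v ==> (om z < th j)],
   dist par om xpredT (par x) v <= 2 * th j &
   th j <= 10 * dist par om (fun y => y \in C) (par x) v].

Let R := [set x | [&& lvl om (th (level th (om x))) (th (level th (om x)).+1) x,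
  few_children (level th (om x)) (tp (Ej (level th (om x))) (par x)) &
  [exists v, goodv (level th (om x)) x v]]].

Let Y x := if [pick v | goodv (level th (om x)) x v] is Some v
           then [set z | sep par z (par x) v] else set0.

(** A common edge [e] is lighter than the threshold of [f], hence inside the part of [par f]: the
    path of [g] runs through that part. *)
Lemma side_hits f g : f \in R -> g \in R -> ~~ [disjoint Y f & Y g] ->
  exists2 e, e \in Y g & om e < th (level th (om f)) /\
    tp (Ej (level th (om f))) (par f) = tp (Ej (level th (om f))) e.
Proof.
move=> fR gR /pred0Pn[e /andP[/= ef eg]]; exists e => //.
move: ef; rewrite /Y; case: pickP => [v /and3P[/forallP hv _ _]|_]; last by rewrite inE.
rewrite inE => se; set j := level th (om f) in hv *.
have := hv e; rewrite se /= => lte; split => //.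
have top_all u u' : sep par e u u' -> anc par e u ->
    (forall z, sep par z u u' -> om z < th j) -> tp (Ej j) u = tp (Ej j) e.
  move=> s eu h; apply/eqP/(top_eqP rtd) => z Ez; rewrite sepC sep_anc //.
  apply/negP => /andP[zu nze].
  have ez : anc par e z by have := anc_total rtd eu zu; rewrite (negbTE nze) orbF.
  have neu' : ~~ anc par e u' by move: s; rewrite /sep eu.
  have : sep par z u u'.
    rewrite /sep zu /=; apply: contra neu'; exact: anc_trans.
  by move=> /h; rewrite ltnNge (Ez : th j <= om z).
have hv' z : sep par z (par f) v -> om z < th j by move=> s; have := hv z; rewrite s.
case: (boolP (anc par e (par f))) => h; first exact: top_all se h hv'.
have ev : anc par e v by move: se; rewrite /sep (negbTE h).
have <- : tp (Ej j) v = tp (Ej j) e.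
  apply: (top_all v (par f)) => //; first by rewrite sepC.
  by move=> z; rewrite sepC; apply: hv'.
by apply/eqP/(top_eqP rtd) => z Ez; apply/negP => /hv'; rewrite ltnNge (Ez : th j <= om z).
Qed.

(** The path of [g] meets at most [1 + N j] parts of level [j], each with at most two child edges of
    weight below [th j.+1]. Over the levels up to that of [g], the 1 contributes [2 * Lam * th J];
    the [N j] contribute [4 * Lam * th J], since an edge counts only for levels up to its own and
    the path has length at most [2 * th J]. *)
Lemma replace_B_sound : wt om (fun x => x \in R) <= 10 * (6 * Lam) * wt om (fun x => x \in C).
Proof.
apply: (@vitali _ om (fun x => th (level th (om x))) Y).
  move=> x; rewrite inE => /and3P[_ _ /existsP[v0 hv0]].
  rewrite /Y; case: pickP => [v /and3P[_ _ h]|/(_ v0)]; last by rewrite hv0.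
  apply: leq_trans h _; rewrite leq_mul2l /= dist_wt leq_eqVlt; apply/orP; left; apply/eqP.
  by apply: eq_bigl => y; rewrite inE.
move=> g gR; set J := level th (om g).
have [v [hY hd]] : exists v, Y g = [set z | sep par z (par g) v] /\
    dist par om xpredT (par g) v <= 2 * th J.
  have := gR; rewrite inE => /and3P[_ _ /existsP[v0 hv0]].
  rewrite /Y; case: pickP => [v /and3P[_ h _]|/(_ v0)]; last by rewrite hv0.
  by exists v.
pose N j := #|[pred z | (z \in Y g) && Ej j z]|.
have perlevel j : \sum_(f | [&& f \in R, level th (om f) == j & (f == g) || ~~ [disjoint Y f & Y g]]) om f
    <= 2 * th j.+1 * (1 + N j).
  have [L [hL hLa _ hLz]] := path_tops rtd (Ej j) (par g) v.
  have hLN : size L <= 1 + N j.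
    by apply: leq_trans hL _; rewrite leq_add2l; apply: subset_leq_card; apply/subsetP => z; rewrite !inE hY inE.
  apply: leq_trans (_ : 2 * th j.+1 * size L <= _); last by rewrite leq_mul2l hLN orbT.
  apply: leq_trans (_ : \sum_(B <- L) \sum_(f | [&& f \in R, level th (om f) == j & tp (Ej j) (par f) == B]) om f <= _).
    apply: leq_trans (_ : \sum_f \sum_(B <- L) (if [&& f \in R, level th (om f) == j & tp (Ej j) (par f) == B] then om f else 0) <= _); last first.
      by rewrite exchange_big /=; apply: leq_sum => B _; rewrite [X in _ <= X]big_mkcond.
    rewrite big_mkcond /=; apply: leq_sum => f _; case: ifP => // /and3P[fR /eqP lf hf].
    have inL : tp (Ej j) (par f) \in L.
      case/orP: hf => [/eqP ->//|hf]; have [e eg [h1 h2]] := side_hits fR gR hf.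
      rewrite lf in h1 h2; rewrite h2; apply: hLz; first by move: eg; rewrite hY inE.
      by rewrite /bigE -ltnNge.
    rewrite (big_rem _ inL) /= fR lf !eqxx /=; exact: leq_addr.
  have -> : 2 * th j.+1 * size L = \sum_(B <- L) 2 * th j.+1.
    by rewrite big_const_seq count_predT iter_addn_0.
  apply: leq_sum => B _.
  case: (pickP [pred f | [&& f \in R, level th (om f) == j & tp (Ej j) (par f) == B]]) => [f0|none]; last by rewrite big_pred0.
  move=> /= /and3P[f0R /eqP lf0 /eqP hf0].
  have fc : few_children j B by move: f0R; rewrite inE lf0 hf0 => /and3P[].
  apply: leq_trans (_ : \sum_(f | lchild r par lv om (th j) (th j.+1) B f) th j.+1 <= _).
    rewrite big_mkcond [X in _ <= X]big_mkcond /=; apply: leq_sum => f _.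
    case: ifP => // /and3P[fR /eqP lf hf].
    have := fR; rewrite inE lf => /and3P[lvf _ _]; rewrite /lchild lvf hf /=.
    by apply: ltnW; case/andP: lvf.
  by rewrite sum_nat_const leq_mul2r; apply/orP; right.
have geo := th_geo_cond th_geo.
apply: leq_trans (_ : \sum_(j < J.+1) 2 * th j.+1 * (1 + N j) <= _).
  apply: leq_trans (_ : \sum_(j < J.+1) \sum_(f | [&& f \in R, level th (om f) == j & (f == g) || ~~ [disjoint Y f & Y g]]) om f <= _); last by apply: leq_sum.
  rewrite /wt [X in X <= _]big_mkcond /=.
  under [X in _ <= X]eq_bigr => j _ do rewrite big_mkcond.
  rewrite exchange_big /=; apply: leq_sum => f _; case: ifP => // /and3P[fR tf hf].
  have lJ : level th (om f) < J.+1.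
    by rewrite ltnS leqNgt; apply/negP => h; have := th_mono thS h; have := thS J; rewrite -/J in tf; lia.
  by rewrite (bigD1 (Ordinal lJ)) //= fR eqxx hf /= leq_addr.
have hN : \sum_(j < J.+1) th j.+1 * N j <= Lam * (2 * th J).
  apply: leq_trans (_ : \sum_(z | z \in Y g) Lam * om z <= _); last first.
    rewrite -big_distrr leq_mul2l /=; apply/orP; right; apply: leq_trans hd.
    by rewrite dist_wt /wt leq_eqVlt; apply/orP; left; apply/eqP; apply: eq_bigl => z; rewrite hY inE.
  apply: leq_trans (_ : \sum_(z | z \in Y g) \sum_(j < J.+1 | th j <= om z) th j.+1 <= _); last first.
    by apply: leq_sum => z _; apply: geo.
  rewrite leq_eqVlt; apply/orP; left; apply/eqP.
  under [RHS]eq_bigr => z _ do rewrite big_mkcond.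
  rewrite exchange_big /=; apply: eq_bigr => j _.
  rewrite -big_mkcondr /= /N -sum1_card big_distrr /=.
  by apply: eq_big => [z|z _]; rewrite ?muln1.
have g1 : \sum_(j < J.+1) th j.+1 <= Lam * th J by apply: th_geo.
have -> : \sum_(j < J.+1) 2 * th j.+1 * (1 + N j) =
    2 * (\sum_(j < J.+1) th j.+1) + 2 * \sum_(j < J.+1) th j.+1 * N j.
  by rewrite !big_distrr -big_split /=; apply: eq_bigr => j _; lia.
move: g1 hN; rewrite -/J; move: (\sum_(_ < _) _) (\sum_(_ < _) _) (th J) => a b c; clear; nia.
Qed.

(** [Z] splits into edges of [C] (factor 1), edges with a heavy lower side (factor 8) and edges with
    a heavy upper side ([replace_B_sound]). *)
Theorem replace_sound (Z : pred V) :
  (forall x, Z x -> exists j a v, repl_witness r par lv om w (th j) (th j.+1) (rho j) x a v /\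
     few_children j (tp (Ej j) (par x))) ->
  wt om Z <= (9 + 60 * Lam) * wt om (fun x => x \in C).
Proof.
move=> hZ.
pose ZA x := [&& x != r, x \notin C & [exists a, anc par x a &&
  (om x + dist par om xpredT x a <= 8 * wt om (fun y => [&& y \in C, anc par x y & anc par y a]))]].
have hA : wt om ZA <= 8 * wt om (fun x => x \in C).
  apply: (resource_bound rtd); last by rewrite /ZA eqxx.
  move=> x /and3P[_ _ /existsP[a /andP[xa h]]]; exists a => //.
  by rewrite (chain_wt om rtd xa).
have hB := replace_B_sound.
have cover x : Z x -> [|| x \in C, ZA x | x \in R].
  move=> /hZ[j [a [v [hw fc]]]]; case: (boolP (x \in C)) => //= xC.
  have /and5P[xr lx /eqP ha _ _] := hw.
  have lj : level th (om x) = j by apply: (level_uniq thS).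
  case: (repl_sides rtd cutC (th_big j) (thS j) (th_ratio j) (rho_le j) hw xC) => [h|[v' [h1 h2 h3]]].
    apply/orP; left; rewrite /ZA xr xC /=; apply/existsP; exists a.
    have -> : anc par x a by rewrite -ha; apply: (top_anc rtd).
    by rewrite /=; move: h; rewrite -mulnA leq_mul2l.
  apply/orP; right; rewrite inE lj lx fc /=; apply/existsP; exists v'.
  by rewrite /goodv h2 h3 !andbT; apply/forallP => z; apply/implyP; apply: h1.
apply: leq_trans (_ : wt om (fun x => x \in C) + wt om ZA + wt om (fun x => x \in R) <= _).
  rewrite /wt big_mkcond [X in _ <= X + _ + _]big_mkcond [X in _ <= _ + X + _]big_mkcond [X in _ <= _ + X]big_mkcond.
  rewrite -!big_split /=; apply: leq_sum => x _; case: ifP => // /cover.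
  by case: (x \in C); case: (ZA x); case: (x \in R) => //= _; lia.
move: hA hB; move: (wt _ _) (wt _ _) (wt _ _) => a b c; clear; nia.
Qed.

Lemma coverX_count j (O : seq V) : uniq O ->
  count (coverX r par lv om C (th j) (th j.+1)) O <=
  2 * #|[pred y | (y \in C) && lvl om (th j) (th j.+1) y]|.
Proof.
move=> uO; set F := [pred y | _].
have -> : count (coverX r par lv om C (th j) (th j.+1)) O =
    #|[pred D | (D \in O) && coverX r par lv om C (th j) (th j.+1) D]|.
  rewrite -size_filter -(card_uniqP (filter_uniq _ uO)); apply: eq_card => D.
  by rewrite mem_filter !inE andbC.
apply: leq_trans (_ : #|F| + #|[set tp (Ej j) (par y) | y in F]| <= _); last first.
  by rewrite mul2n -addnn leq_add2l leq_imset_card.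
apply: leq_trans (leq_trans (_ : _ <= #|[predU F & [set tp (Ej j) (par y) | y in F]]|) _); last first.
- by rewrite -cardUI leq_addr.
- by apply: leqnn.
apply: subset_leq_card; apply/subsetP => D; rewrite !inE => /andP[_ /orP[->//|/existsP[y /and3P[yC ly /eqP <-]]]].
by apply/orP; right; apply/imsetP; exists y => //; rewrite inE yC ly.
Qed.

End ReplaceSound.

(** * Hops of a tour *)

Lemma card_onto (A B : finType) (f : A -> B) (P : pred A) (Q : pred B) :
  (forall y, Q y -> exists2 x, P x & f x = y) -> #|Q| <= #|P|.
Proof.
move=> h; apply: leq_trans (leq_imset_card f P); apply: subset_leq_card.
apply/subsetP => y /h[x Px <-]; exact: imset_f.
Qed.

Lemma card_count2 (I : finType) (P Q1 Q2 : pred I) :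
  \sum_(i | P i) (Q1 i + Q2 i) =
  #|[pred i | P i && Q1 i]| + #|[pred i | P i && Q2 i]|.
Proof.
rewrite big_split /=; congr (_ + _).
  by rewrite -sum1_card [RHS]big_mkcondr; apply: eq_bigr => i _; case: (Q1 i).
by rewrite -sum1_card [RHS]big_mkcondr; apply: eq_bigr => i _; case: (Q2 i).
Qed.

Section Crossings.
Variables (V : finType) (r : V) (par : V -> V) (lv : V -> nat) (om : V -> nat).
Hypothesis rtd : rooted r par lv.
Hypothesis om_r : om r = 0.
Variables (w : V -> V -> nat).
Hypothesis cut : forall x u v, sep par x u v -> om x <= w u v.
Variables (I : finType) (a b : I -> V).
Hypothesis cyc : forall S : pred V, (exists u, S u) -> (exists v, ~~ S v) ->
  exists i, S (a i) && ~~ S (b i).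

Notation tp := (top r par lv).
Definition hop_len i := w (a i) (b i).

(** Cutting a non-empty [E] leaves [#|E|.+1] parts, and the tour leaves each of them at least
    once. *)
Lemma crossing_card (E : pred V) : ~~ E r ->
  #|E| <= #|[pred i | tp E (a i) != tp E (b i)]|.
Proof.
move=> nEr; case: (pickP E) => [e Ee|h0]; last by rewrite eq_card0.
apply: leq_trans (_ : #|[pred y | istop r E y]| <= _).
  by apply: subset_leq_card; apply/subsetP => y hy; rewrite inE /istop; move: hy; rewrite unfold_in => ->; rewrite orbT.
apply: (@card_onto _ _ (fun i => tp E (a i))) => y; rewrite inE => hy.
have er : e != r by apply: contraTneq Ee => ->.
case: (cyc (S := fun v => tp E v == y)).
- by exists y; rewrite (top_id rtd).
- have [->|ye] := eqVneq y r; first by exists e; rewrite (top_id rtd) // /istop Ee orbT.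
  by exists r; rewrite (top_id rtd) /istop ?eqxx // eq_sym.
- by move=> i /andP[/eqP h1 h2]; exists i => //; rewrite inE h1 eq_sym.
Qed.

Definition long_hop t i := t <= hop_len i.
(** For positive [t] the subtraction is exact by [big_hops]. Summed over [t], this is the length of
    the tour minus the weight of the tree. *)
Definition excess t := #|long_hop t| - #|bigE om t|.

Lemma bigE_root t : 0 < t -> ~~ bigE om t r.
Proof. by rewrite /bigE om_r -ltnNge. Qed.

Lemma change_long t i : tp (bigE om t) (a i) != tp (bigE om t) (b i) -> long_hop t i.
Proof.
apply: contraR; rewrite /long_hop -ltnNge => h; apply/(top_eqP rtd) => x hx.
by apply/negP => /cut hc; move: (leq_trans hx hc); rewrite leqNgt h.
Qed.

Lemma big_hops t : 0 < t -> #|bigE om t| <= #|long_hop t|.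
Proof.
move=> t0; apply: leq_trans (crossing_card (bigE_root t0)) _.
by apply: subset_leq_card; apply/subsetP => i; rewrite inE => /change_long.
Qed.

Lemma excess_eq t : 0 < t -> #|long_hop t| = excess t + #|bigE om t|.
Proof. by move=> /big_hops h; rewrite /excess subnK. Qed.

Lemma tops_card t : 0 < t -> #|[pred y | istop r (bigE om t) y]| = #|bigE om t|.+1.
Proof.
move=> t0; rewrite (cardD1 r) !inE /istop eqxx add1n; congr S; apply: eq_card => y.
rewrite !inE [RHS]unfold_in; case: eqVneq => [->|] //=.
by apply/esym/negbTE; apply: bigE_root.
Qed.

(* Every sub-cluster has a large hop leaving and a large hop entering it. *)
Lemma ends_bound t (S : pred V) : 0 < t ->
  \sum_(i | long_hop t i) (S (tp (bigE om t) (a i)) + S (tp (bigE om t) (b i))) <=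
  2 * #|[pred y | istop r (bigE om t) y && S y]| + 2 * excess t.
Proof.
move=> t0; set E := bigE om t.
have tot : \sum_(i | long_hop t i) (S (tp E (a i)) + S (tp E (b i))) +
    \sum_(i | long_hop t i) (~~ S (tp E (a i)) + ~~ S (tp E (b i))) = 2 * #|long_hop t|.
  rewrite -big_split /= mulnC -sum_nat_const; apply: eq_bigr => i _.
  by case: (S (tp E (a i))); case: (S (tp E (b i))).
have hX := excess_eq t0; have hT := tops_card t0.
have hS : #|[pred y | istop r E y]| = #|[pred y | istop r E y && S y]| + #|[pred y | istop r E y && ~~ S y]|.
  rewrite -!sum1_card (bigID S) /=; congr (_ + _); by apply: eq_bigl => y; rewrite !inE.
case: (pickP E) => [e Ee|h0]; last first.
  move: tot; rewrite hX (eq_card0 h0); move: (\sum_(_ | _) _) (\sum_(_ | _) _) => p q; lia.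
have er : e != r by apply: contraTneq Ee => ->; exact: bigE_root.
have other y : exists v, tp E v != y.
  have [->|ye] := eqVneq y r; first by exists e; rewrite (top_id rtd) // /istop Ee orbT.
  by exists r; rewrite (top_id rtd) /istop ?eqxx // eq_sym.
have nonA : #|[pred y | istop r E y && ~~ S y]| <= #|[pred i | long_hop t i && ~~ S (tp E (a i))]|.
  apply: (@card_onto _ _ (fun i => tp E (a i))) => y; rewrite inE => /andP[hy nS].
  case: (cyc (S := fun v => tp E v == y)) => [||i /andP[/eqP h1 h2]].
  - by exists y; rewrite (top_id rtd).
  - exact: other.
  - exists i => //; rewrite inE h1 nS andbT; apply: change_long; by rewrite -/E h1 eq_sym.
have nonB : #|[pred y | istop r E y && ~~ S y]| <= #|[pred i | long_hop t i && ~~ S (tp E (b i))]|.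
  apply: (@card_onto _ _ (fun i => tp E (b i))) => y; rewrite inE => /andP[hy nS].
  case: (cyc (S := fun v => tp E v != y)) => [||i /andP[h1]].
  - exact: other.
  - by exists y; rewrite (top_id rtd) // negbK.
  - rewrite negbK => /eqP h2.
    by exists i => //; rewrite inE h2 nS andbT; apply: change_long; rewrite -/E h2.
have := card_count2 (long_hop t) (fun i => ~~ S (tp E (a i))) (fun i => ~~ S (tp E (b i))).
move: tot; set p := \sum_(_ | _) _; set q := \sum_(_ | _) _ => tot e'.
move: nonA nonB tot e' hX hT hS; clearbody p q.
move: #|_| #|_| #|_| #|_| #|_| #|_| #|_| => *; lia.
Qed.

(** At least [#|bigE om t|] hops change part, and these are long; long hops that stay in their part
    are therefore in excess. *)
Lemma null_bound t : 0 < t ->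
  #|[pred i | long_hop t i && (tp (bigE om t) (a i) == tp (bigE om t) (b i))]| <= excess t.
Proof.
move=> t0; rewrite -(leq_add2r #|bigE om t|) -excess_eq //.
apply: leq_trans (leq_add (leqnn _) (crossing_card (bigE_root t0))) _.
rewrite -!sum1_card [X in _ <= X](bigID (fun i => tp (bigE om t) (a i) == tp (bigE om t) (b i))) /=.
apply: leq_add; first by rewrite leq_eqVlt; apply/orP; left; apply/eqP; apply: eq_bigl => i; rewrite !inE.
rewrite leq_eqVlt; apply/orP; left; apply/eqP; apply: eq_bigl => i; rewrite !inE.
by case: (boolP (_ == _)); rewrite ?andbF //= andbT => /change_long.
Qed.

(** Cut the uncovered edges in addition to those of weight at least [t']: still only hops of length
    at least [t'] change part, so these hops outnumber both kinds of edges together. *)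
Lemma uncovered_bound t t' : 0 < t' ->
  #|[pred x | [&& x != r, t <= om x < t' & [forall i, (hop_len i < t') ==> ~~ sep par x (a i) (b i)]]]| <= excess t'.
Proof.
move=> t0; set U := [pred x | _].
rewrite -(leq_add2r #|bigE om t'|) -excess_eq //.
pose E x := U x || bigE om t' x.
have nEr : ~~ E r by rewrite /E /U /= eqxx /= bigE_root.
have -> : #|U| + #|bigE om t'| = #|E|.
  rewrite -cardUI [X in _ + X]eq_card0 ?addn0.
    by apply: eq_card => x; rewrite inE.
  move=> x; rewrite !inE; apply/negP => /andP[/and3P[_ /andP[_ h1] _]].
  by rewrite unfold_in /bigE leqNgt h1.
apply: leq_trans (crossing_card nEr) _; apply: subset_leq_card; apply/subsetP => i.
rewrite inE; apply: contraR; rewrite unfold_in /long_hop -ltnNge => hW; apply/(top_eqP rtd) => x.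
case/orP => [/and3P[_ _ /forallP/(_ i)]|hx]; first by rewrite hW.
by apply/negP => /cut hc; move: (leq_trans hx hc); rewrite leqNgt hW.
Qed.

Lemma two_crossings x : x != r -> 2 <= #|[pred i | sep par x (a i) (b i)]|.
Proof.
move=> xr.
have h1 : exists u, anc par x u by exists x; apply: anc_refl.
have h2 : exists v, ~~ anc par x v by exists r; rewrite (anc_root rtd).
have [i /andP[i1 i2]] := cyc h1 h2.
have h3 : exists v, ~~ ~~ anc par x v by case: h1 => u hu; exists u; rewrite hu.
have [i' /andP[i1' i2']] := cyc (S := fun v => ~~ anc par x v) h2 h3.
have ii : i != i' by apply: contraNneq i1' => <-.
rewrite (cardD1 i) (cardD1 i') !inE eq_sym (negbTE ii) /sep i1 (negbTE i2) (negbTE i1').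
by move: i2'; rewrite negbK => ->.
Qed.

Lemma layer_sum (J : finType) (f : J -> nat) N : (forall x, f x <= N) ->
  \sum_x f x = \sum_(t < N) #|[pred x | t < f x]|.
Proof.
move=> hN; under [RHS]eq_bigr => t _ do rewrite -sum1_card big_mkcond.
rewrite exchange_big /=; apply: eq_bigr => x _.
have aux m : \sum_(t < m) (if t < f x then 1 else 0) = minn (f x) m.
  elim: m => [|m IH]; first by rewrite big_ord0 minn0.
  by rewrite big_ord_recr /= IH; case: ifP; lia.
by rewrite -[LHS](minn_idPl (hN x)) -aux; apply: eq_bigr => t _; rewrite inE.
Qed.

Lemma excess_sum N d : (forall x, om x <= N) -> (forall i, hop_len i <= N) ->
  \sum_i hop_len i <= wt om xpredT + d -> \sum_(t < N) excess t.+1 <= d.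
Proof.
move=> h1 h2; rewrite /wt (layer_sum h1) (layer_sum h2).
have e (t : 'I_N) : #|[pred i | t < hop_len i]| = excess t.+1 + #|[pred x | t < om x]|.
  have := excess_eq (ltn0Sn t); by [].
by rewrite (eq_bigr _ (fun t _ => e t)) big_split /= addnC leq_add2l.
Qed.

End Crossings.

(** * Where the covering by the hops of a short tour comes from *)

Section Accounting.
Variables (V : finType) (r : V) (par : V -> V) (lv : V -> nat) (om : V -> nat).
Hypothesis rtd : rooted r par lv.
Hypothesis om_r : om r = 0.
Variables (w : V -> V -> nat).
Hypothesis wC : forall u v, w u v = w v u.
Hypothesis cut : forall x u v, sep par x u v -> om x <= w u v.
Hypothesis wD : forall u v, w u v <= dist par om xpredT u v.
Variables (I : finType) (a b : I -> V).
Hypothesis cyc : forall S : pred V, (exists u, S u) -> (exists v, ~~ S v) ->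
  exists i, S (a i) && ~~ S (b i).
Variables (th : nat -> nat) (wmin J : nat).
Hypothesis thS : forall j, th j < th j.+1.
Hypothesis th_pos : forall j, 0 < th j.
Hypothesis th_two : forall j, th j.+1 <= 2 * th j.
Hypothesis th0 : forall x, x != r -> th 0 <= om x.

Notation tp := (top r par lv).
Notation dep := (depth par om).
Notation W := (hop_len w a b).
Notation M := (wt om xpredT).
Notation Ej j := (bigE om (th j)).
Notation X := (excess om w a b).

Variable Lset : pred V.
Hypothesis HL : forall z u v, ~~ Lset z -> anc par z u -> ~~ anc par z v ->
  dep u - dep z <= 6 * maxn (w u v) wmin.

Definition hop_level i := level th (W i).
Hypothesis levJ : forall i, hop_level i < J.
Hypothesis levJ' : forall x, level th (om x) < J.

Definition low_hop i := (W i < wmin) || (W i == 0).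

Lemma W_level i : ~~ low_hop i -> th (hop_level i) <= W i < th (hop_level i).+1.
Proof.
rewrite negb_or => /andP[_ Wi]; apply: level_bounds => //.
have : 0 < dist par om xpredT (a i) (b i) by apply: leq_trans (wD _ _); rewrite lt0n.
rewrite lt0n /dist sum_nat_eq0 negb_forall => /existsP[x].
rewrite muln_eq0 negb_or => /andP[h1 h2].
have sx : sep par x (a i) (b i) by case: sep h2.
exact: leq_trans (th0 (sep_nroot rtd sx)) (cut sx).
Qed.

(** The selected edges lie on one chain; below the topmost one the chain has length at most [s], and
    that edge itself adds at most [m]. *)
Lemma chain_bound u s m :
  wt om (fun z => [&& anc par z u, dep u - dep z <= s & om z <= m]) <= s + m.
Proof.
pose P z := [&& anc par z u, dep u - dep z <= s & om z <= m].
case: (pickP P) => [z0 hz0|none]; last by rewrite /wt big_pred0.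
pose y := [arg min_(z < z0 | P z) lv z].
have [/and3P[yu h1 h2] ymin] : P y /\ forall z, P z -> lv y <= lv z by rewrite /y; case: arg_minnP.
apply: leq_trans (_ : om y + dist par om xpredT y u <= _); last first.
  by have := depth_anc om yu; lia.
rewrite -(chain_wt om rtd yu) /wt big_mkcond [X in _ <= X]big_mkcond /=.
apply: leq_sum => z _; case: ifP => // hz; have /and3P[zu _ _] := hz.
rewrite zu andbT; have := anc_total rtd yu zu; case: (boolP (anc par y z)) => //= nyz zy.
have zy' : z != y by apply: contraNneq nyz => ->; apply: anc_refl.
have := anc_lv rtd zy zy'; have := ymin z hz; lia.
Qed.

Definition scov i := dist par om (fun z => ~~ Lset z) (a i) (b i).

(** 14 = 2 (6 + 1): at either end of the hop, the separating edges outside [Lset] reach a depth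
    difference of at most 6m by [HL], and each weighs at most m by [cut]. *)
Lemma scov_le i : scov i <= 14 * maxn (W i) wmin.
Proof.
set m := maxn _ _.
apply: leq_trans (_ : (6 * m + m) + (6 * m + m) <= _); last by lia.
apply: leq_trans (leq_add (chain_bound (a i) (6 * m) m) (chain_bound (b i) (6 * m) m)).
rewrite /scov dist_wt /wt big_mkcond [X in _ <= X + _]big_mkcond [X in _ <= _ + X]big_mkcond -big_split /=.
apply: leq_sum => z _; case: ifP => // /andP[nL s].
have hom : om z <= m by apply: leq_trans (cut s) (leq_maxl _ _).
move: s; rewrite /sep hom !andbT.
case: (boolP (anc par z (a i))) => ha; case: (boolP (anc par z (b i))) => hb //= _.
  by rewrite (HL nL ha hb) addn0.
by have := HL nL hb ha; rewrite wC -/(W i) -/m => ->.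
Qed.

(* The sub-clusters of level j are the components left by the tree edges of weight at least
   [th j].  A hop of level j is null, simple or multi according to whether the sub-clusters of
   its ends are equal, joined by a tree edge, or neither. *)
Definition hA i := tp (Ej (hop_level i)) (a i).
Definition hB i := tp (Ej (hop_level i)) (b i).
Definition hnull i := hA i == hB i.
Definition simp1 i := (hA i != hB i) && (tp (Ej (hop_level i)) (par (hA i)) == hB i).
Definition simp2 i := (hA i != hB i) && (tp (Ej (hop_level i)) (par (hB i)) == hA i).
Definition hsimple i := simp1 i || simp2 i.
Definition hmulti i := ~~ hnull i && ~~ hsimple i.
Definition hf i := if simp1 i then hA i else hB i.
Definition hgood i := [&& ~~ low_hop i, hsimple i & W i + 2 * om (hf i) <= 2 * scov i].

Lemma parent_related (E : pred V) u v (x := tp E u) :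
  x != tp E v -> tp E (par x) = tp E v ->
  [/\ x != r, E x, anc par x u, ~~ anc par x v & forall y, E y -> sep par y u v -> y = x].
Proof.
move=> xv hp; have xt : istop r E x by apply: top_istop.
have xr : x != r.
  apply: contra_neq xv => e; rewrite -hp e (par_root rtd) -[LHS]e.
  by rewrite -{2}e (topK rtd) // e.
have Ex : E x by move: xt; rewrite /istop (negbTE xr).
have xu : anc par x u by apply: top_anc.
have nxv : ~~ anc par x v.
  by rewrite -(anc_top rtd v xt) -hp (anc_top rtd _ xt) (anc_self_par rtd xr).
split => // y Ey; have := sep_through rtd y xu nxv.
have e1 : tp E u == tp E x by rewrite /x (topK rtd).
have e2 : tp E (par x) == tp E v by rewrite hp.
have /(top_eqP rtd)/(_ y Ey)/negbTE -> := e1.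
have /(top_eqP rtd)/(_ y Ey)/negbTE -> := e2.
rewrite add0n addn0; case: (sep par y u v) => //; by case: eqVneq.
Qed.

Lemma simple_facts i : hsimple i -> [/\ hf i != r, Ej (hop_level i) (hf i),
  sep par (hf i) (a i) (b i), istop r (Ej (hop_level i)) (hf i) &
  forall y, Ej (hop_level i) y -> sep par y (a i) (b i) -> y = hf i].
Proof.
rewrite /hsimple /hf; case: (boolP (simp1 i)) => [/andP[h1 /eqP h2] _|n1 /= /andP[h1 /eqP h2]].
  have [p1 p2 p3 p4 p5] := parent_related h1 h2.
  by split => //; [rewrite /sep p3 (negbTE p4) | rewrite /istop p2 orbT].
rewrite eq_sym in h1; have [p1 p2 p3 p4 p5] := parent_related h1 h2.
split => //; [by rewrite /sep p3 addbT | by rewrite /istop p2 orbT |].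
by move=> y Ey; rewrite sepC; apply: p5.
Qed.

(** Low, null, multi and good hops get 28 = 2 * 14 from [scov_le]. A remaining hop is simple and not
    good, so twice its covering is below [W + 2 * om (hf i)], at most 3W since the hop crosses
    [hf i]. The ratio 3/2 falls short of the 2 required by [total_cover]. *)
Lemma hop_split i :
  2 * scov i <= 28 * (low_hop i * wmin) + 28 * ((~~ low_hop i && hnull i) * W i) +
     28 * ((~~ low_hop i && hmulti i) * W i) + 3 * W i + 28 * (hgood i * W i).
Proof.
have hs := scov_le i; case: (boolP (low_hop i)) => hl /=.
  case/orP: hl => [h|/eqP h].
    by move: hs; rewrite (maxn_idPr (ltnW h)); lia.
  suff -> : scov i = 0 by lia.
  apply: big1 => z _; case: (boolP (sep par z (a i) (b i))) => [/cut|]; last by rewrite muln0.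
  by rewrite -/(W i) h leqn0 => /eqP ->.
have hWm : wmin <= W i by move: hl; rewrite negb_or -leqNgt => /andP[].
rewrite (maxn_idPl hWm) in hs.
rewrite /hgood hl /hmulti /=; case: (hnull i) => /=; first by case: (hsimple i) => /=; lia.
case: (boolP (hsimple i)) => /= si; last by lia.
have [_ _ /cut hf1 _ _] := simple_facts si; rewrite -/(W i) in hf1.
by case: leqP => h /=; lia.
Qed.

Lemma total_cover : 2 * M <= 2 * wt om Lset + \sum_i scov i.
Proof.
have -> : \sum_i scov i = \sum_(z | ~~ Lset z) om z * #|[pred i | sep par z (a i) (b i)]|.
  rewrite /scov /dist exchange_big /=; apply: eq_bigr => z _.
  rewrite -big_distrr /=; congr (_ * _); rewrite -sum1_card [RHS]big_mkcond /=.
  by apply: eq_bigr => i _; rewrite !inE; case: sep.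
have -> : M = wt om Lset + wt om (fun z => ~~ Lset z) by rewrite /wt (bigID Lset).
rewrite mulnDr leq_add2l /wt big_distrr /=; apply: leq_sum => z _.
have [->|zr] := eqVneq z r; first by rewrite om_r muln0.
by rewrite mulnC leq_mul2l (two_crossings rtd cyc zr) orbT.
Qed.

Lemma by_level (P : pred I) : (forall i, P i -> ~~ low_hop i) ->
  \sum_(i | P i) W i <= \sum_(j < J) th j.+1 * #|[pred i | P i && (hop_level i == j)]|.
Proof.
move=> hP.
apply: leq_trans (_ : \sum_(i | P i) th (hop_level i).+1 <= _).
  by apply: leq_sum => i /hP/W_level/andP[_ /ltnW].
rewrite (partition_big (fun i => Ordinal (levJ i)) xpredT) //=; apply: leq_sum => j _.
rewrite -sum1_card big_distrr /= leq_eqVlt; apply/orP; left; apply/eqP.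
apply: eq_big => [i|i /andP[_ /eqP <-]]; last by rewrite muln1.
by rewrite inE -val_eqE.
Qed.

Lemma low_level_long i j : ~~ low_hop i -> hop_level i == j -> long_hop w a b (th j) i.
Proof. by move=> /W_level/andP[h _] /eqP <-. Qed.

Definition chi1 := \sum_(j < J) th j.+1 * X (th j).
Definition chi2 := \sum_(j < J) th j.+1 * X (th j.+1).
Definition Wmulti := \sum_(i | ~~ low_hop i && hmulti i) W i.

Lemma null_weight : \sum_(i | ~~ low_hop i && hnull i) W i <= chi1.
Proof.
apply: leq_trans (by_level _) _; first by move=> i /andP[].
apply: leq_sum => j _; rewrite leq_mul2l; apply/orP; right.
apply: leq_trans (null_bound rtd om_r cut cyc (th_pos j)); apply: subset_leq_card.
apply/subsetP => i; rewrite !inE => /andP[/andP[nl nu] lj].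
by rewrite (low_level_long nl lj) /=; move: nu lj; rewrite /hnull /hA /hB => h /eqP <-.
Qed.

Definition repl' (j : nat) x := [exists i, [&& hgood i, hop_level i == j & hf i == x]].

Lemma simple_ends j (P : pred V) : 
  #|[pred i | [&& ~~ low_hop i, hsimple i, hop_level i == j & P (hA i) || P (hB i)]]| <=
  2 * #|[pred y | istop r (Ej j) y && P y]| + 2 * X (th j).
Proof.
apply: leq_trans (ends_bound rtd om_r cut cyc P (th_pos j)).
rewrite -sum1_card big_mkcond [X in _ <= X]big_mkcond /=; apply: leq_sum => i _.
rewrite !inE; case: ifP => // /and4P[nl _ lj hP]; rewrite (low_level_long nl lj).
by move: hP lj; rewrite /hA /hB => h /eqP <-; case/orP: h => ->; rewrite ?addn1.
Qed.

Lemma hf_end i : hsimple i -> hf i = hA i \/ hf i = hB i.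
Proof. by rewrite /hf; case: ifP; [left|right]. Qed.

Lemma good_weight : \sum_(i | hgood i) W i <=
  2 * \sum_(j < J) th j.+1 * #|repl' j| + 2 * chi1.
Proof.
apply: leq_trans (by_level _) _; first by move=> i /and3P[].
rewrite !big_distrr -big_split /=; apply: leq_sum => j _.
apply: leq_trans (_ : th j.+1 * (2 * #|repl' j| + 2 * X (th j)) <= _); last by rewrite mulnDr !(mulnCA (th _) 2).
rewrite leq_mul2l; apply/orP; right.
apply: leq_trans (leq_trans (simple_ends j (repl' j)) _).
  apply: subset_leq_card; apply/subsetP => i; rewrite !inE => /andP[g lj].
  have /and3P[-> si _] := g; rewrite si lj /=.
  have : repl' j (hf i) by apply/existsP; exists i; rewrite g lj eqxx.
  by case: (hf_end si) => <- ->; rewrite ?orbT.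
rewrite leq_add2r leq_mul2l /=; apply: subset_leq_card; apply/subsetP => y.
by rewrite inE => /andP[].
Qed.

Definition manyB (j : nat) B := ~~ few_children r par lv om th j B.
Definition Fl j y := lvl om (th j) (th j.+1) y.
Definition Func (j : nat) y := Fl j y && [forall i, ~~ [&& ~~ low_hop i, hsimple i, hop_level i == j & hf i == y]].

Lemma Fl_root j y : Fl j y -> y != r.
Proof. by apply: contraTneq => ->; rewrite /Fl /lvl om_r leqNgt th_pos. Qed.

Lemma simple_parent_top i : hsimple i ->
  tp (Ej (hop_level i)) (par (hf i)) = hA i \/ tp (Ej (hop_level i)) (par (hf i)) = hB i.
Proof.
rewrite /hsimple /hf; case: (boolP (simp1 i)) => [/andP[_ /eqP ->]|_ /= /andP[_ /eqP ->]].
  by right.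
by left.
Qed.

(** Each part counted has at least three child edges, and such an edge is in [Func] or carries a
    simple hop ending in the part. By [simple_ends] the latter number at most two per part plus the
    excess: 3|S| is at most |Func| + 2|S| + 2X. *)
Lemma many_bound j :
  #|[pred B | istop r (Ej j) B && manyB j B]| <= #|Func j| + 2 * X (th j).
Proof.
set S := [pred B | _].
have h3 : 3 * #|S| <= #|[pred y | Fl j y && S (tp (Ej j) (par y))]|.
  rewrite -[X in _ <= X]sum1_card (partition_big (fun y => tp (Ej j) (par y)) S) /=; last first.
    by move=> y; rewrite inE => /andP[].
  rewrite mulnC -sum_nat_const; apply: leq_sum => B hB.
  move: (hB); rewrite inE => /andP[_]; rewrite /manyB /few_children -ltnNge => h.
  apply: leq_trans h _; rewrite -sum1_card leq_eqVlt; apply/orP; left; apply/eqP.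
  apply: eq_bigl => y; rewrite !inE /lchild /Fl; case: eqP => [->|]; rewrite ?andbF ?andbT //.
  by move: hB; rewrite inE => ->; rewrite andbT.
have h4 : #|[pred y | Fl j y && S (tp (Ej j) (par y))]| <= #|Func j| +
   #|[pred i | [&& ~~ low_hop i, hsimple i, hop_level i == j & S (hA i) || S (hB i)]]|.
  have -> : #|[pred y | Fl j y && S (tp (Ej j) (par y))]| =
     #|[pred y | [&& Fl j y, S (tp (Ej j) (par y)) & Func j y]]| +
     #|[pred y | [&& Fl j y, S (tp (Ej j) (par y)) & ~~ Func j y]]|.
    by rewrite -!sum1_card (bigID (Func j)) /=; congr (_ + _); apply: eq_bigl => y; rewrite !inE -andbA.
  apply: leq_add.
    by apply: subset_leq_card; apply/subsetP => y; rewrite inE => /and3P[].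
  apply: (@card_onto _ _ hf) => y; rewrite inE => /and3P[fy Sy].
  rewrite /Func fy /= => /forallPn[i]; rewrite negbK => /and4P[nl si lj /eqP fe].
  exists i => //; apply/and4P; split => //.
  have := simple_parent_top si; rewrite fe (eqP lj) => -[e|e]; apply/orP; [left|right]; by rewrite -e.
have h5 := simple_ends j S.
have h6 : #|[pred y | istop r (Ej j) y && S y]| = #|S|.
  by apply: eq_card => y; rewrite !inE andbA andbb.
rewrite h6 in h5; lia.
Qed.

Definition IIbad (j : nat) x := repl' j x && manyB j (tp (Ej j) (par x)).

Lemma bad_bound j : #|IIbad j| <= 2 * #|Func j| + 6 * X (th j).
Proof.
pose S := [pred B | istop r (Ej j) B && manyB j B].
have h1 : #|IIbad j| <= #|[pred i | [&& ~~ low_hop i, hsimple i, hop_level i == j & S (hA i) || S (hB i)]]|.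
  apply: (@card_onto _ _ hf) => x /andP[/existsP[i /and3P[g lj /eqP fe]] hm].
  exists i => //; have /and3P[nl si _] := g; apply/and4P; split => //.
  have tt : S (tp (Ej j) (par x)) by rewrite inE /= (top_istop rtd) hm.
  have := simple_parent_top si; rewrite fe (eqP lj) => -[e|e]; apply/orP; [left|right]; by rewrite -e.
have h5 := simple_ends j S; have h7 := many_bound j.
have h6 : #|[pred y | istop r (Ej j) y && S y]| = #|S|.
  by apply: eq_card => y; rewrite !inE andbA andbb.
rewrite h6 in h5; rewrite -/S in h7; lia.
Qed.

(** A hop shorter than [th j.+1] that crosses an edge of level [j] is low or has level [j] itself;
    it is then not null, and for an edge of [Func] not simple either. So such an edge escapes all
    short hops, is in [Lset], or lies on the path of a low or multi hop, where [scov] pays for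
    it. *)
Lemma func_weight : \sum_(j < J) th j.+1 * #|Func j| <=
  2 * (wt om Lset + \sum_(i | low_hop i || hmulti i) scov i) + chi2.
Proof.
pose Unc j := [pred x | [&& x != r, th j <= om x < th j.+1 &
   [forall i, (W i < th j.+1) ==> ~~ sep par x (a i) (b i)]]].
pose Rest y := Lset y || [exists i, [&& low_hop i || hmulti i, ~~ Lset y & sep par y (a i) (b i)]].
have hsub j y : Func j y -> Unc j y || Rest y.
  move=> /andP[fy /forallP hn]; rewrite /Unc /= (Fl_root fy) (fy : th j <= om y < th j.+1) /=.
  case: (boolP [forall i, _]) => //= /forallPn[i]; rewrite negb_imply negbK => /andP[hW s].
  rewrite /Rest; case: (boolP (Lset y)) => //= nL; apply/existsP; exists i; rewrite s andbT.
  case: (boolP (low_hop i)) => //= nl; apply: contraT => nm.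
  have lj : hop_level i = j.
    apply: (level_uniq thS); rewrite hW andbT.
    by apply: leq_trans (cut s); case/andP: fy.
  have Ey : Ej (hop_level i) y by rewrite lj /bigE; case/andP: fy.
  have nn : ~~ hnull i.
    by apply/negP => /(top_eqP rtd)/(_ y Ey); rewrite s.
  have si : hsimple i by move: nm; rewrite /hmulti nn /= negbK.
  have [_ _ _ _ /(_ y Ey s) e] := simple_facts si.
  by have := hn i; rewrite nl si lj e !eqxx.
have hcard j : th j.+1 * #|Func j| <= th j.+1 * X (th j.+1) +
    \sum_(y | Fl j y && Rest y) 2 * om y.
  apply: leq_trans (_ : th j.+1 * (#|Unc j| + #|[pred y | Fl j y && Rest y]|) <= _).
    rewrite leq_mul2l; apply/orP; right.
    apply: leq_trans (_ : #|[predU Unc j & [pred y | Fl j y && Rest y]]| <= _); last first.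
      by rewrite -cardUI leq_addr.
    apply: subset_leq_card; apply/subsetP => y hy.
    have /andP[fy _] : Func j y := hy; rewrite inE.
    have := hsub j y hy; case/orP => h; apply/orP; first by left.
    by right; rewrite inE fy h.
  rewrite mulnDr; apply: leq_add.
    by rewrite leq_mul2l (uncovered_bound rtd om_r cut cyc) ?orbT.
  rewrite mulnC -sum_nat_const; apply: leq_sum => y; rewrite inE => /andP[/andP[h _] _].
  by apply: leq_trans (th_two j) _; rewrite leq_mul2l h orbT.
apply: leq_trans (leq_sum _ (fun (j : 'I_J) _ => hcard j)) _.
rewrite big_split /= addnC leq_add2r.
apply: leq_trans (_ : \sum_(y | Rest y) 2 * om y <= _).
  under eq_bigr => j _ do rewrite big_mkcond.
  rewrite exchange_big [X in _ <= X]big_mkcond /=; apply: leq_sum => y _.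
  case: (boolP (Rest y)) => hR; last by rewrite big1 // => j _; rewrite andbF.
  rewrite (bigD1 (Ordinal (levJ' y))) //= big1 ?addn0; first by case: ifP.
  move=> j hj; case: ifP => // /andP[fy _].
  by move: hj; rewrite -val_eqE /= (level_uniq thS fy) eqxx.
rewrite -big_distrr /= leq_mul2l /=.
apply: leq_trans (_ : wt om Lset + \sum_(y | ~~ Lset y) \sum_(i | (low_hop i || hmulti i) && sep par y (a i) (b i)) om y <= _).
  rewrite /wt (bigID Lset) /=; apply: leq_add.
    by rewrite big_mkcond [X in _ <= X]big_mkcond; apply: leq_sum => y _ /=; case: (Lset y); rewrite ?andbF // andbT; case: ifP.
  rewrite big_mkcond [X in _ <= X]big_mkcond; apply: leq_sum => y _ /=.
  case: (boolP (Lset y)) => nL; rewrite ?andbF ?andbT //=; case: ifP => //.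
  rewrite /Rest (negbTE nL) /= => /existsP[i /andP[h1 h2]].
  by rewrite (bigD1 i) /= ?h1 ?h2 // leq_addr.
rewrite leq_add2l (exchange_big_dep (fun i => low_hop i || hmulti i)) /=; last by move=> y i _ /andP[].
apply: leq_sum => i hi; rewrite /scov dist_wt /wt leq_eqVlt; apply/orP; left; apply/eqP.
by apply: eq_bigl => y; rewrite hi.
Qed.

Lemma multi_low_cover : \sum_(i | low_hop i || hmulti i) scov i <= 14 * (#|I| * wmin) + 14 * Wmulti.
Proof.
rewrite /Wmulti (bigID low_hop) /= !big_distrr /= -sum1_card big_distrl big_distrr /=; apply: leq_add.
  rewrite big_mkcond; apply: leq_sum => i _; rewrite mul1n; case: ifP => // /andP[_ hl].
  case/orP: hl => [h|/eqP h]; first by have := scov_le i; rewrite (maxn_idPr (ltnW h)).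
  by have := scov_le i; rewrite h max0n.
rewrite big_mkcond [X in _ <= X]big_mkcond; apply: leq_sum => i _.
case: (boolP (low_hop i)) => hl; rewrite ?andbF ?andbT //=; case: ifP => // _.
have hWm : wmin <= W i by move: hl; rewrite negb_or -leqNgt => /andP[].
by have := scov_le i; rewrite (maxn_idPl hWm).
Qed.

Definition IIgood (j : nat) x := repl' j x && few_children r par lv om th j (tp (Ej j) (par x)).

(** A linear combination of the preceding bounds. Good hops are charged to the edges they replace;
    those whose upper part has many children are charged through [bad_bound] to [Func], and from
    there to [Lset], to low and multi hops, and to the excess. *)
Theorem accounting dM : \sum_i W i <= M + dM ->
  M <= 228 * wt om Lset + 3164 * (#|I| * wmin) + 3164 * Wmulti +
       112 * wt om (fun x => IIgood (level th (om x)) x) +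
       3 * dM + 420 * chi1 + 112 * chi2.
Proof.
move=> hd.
have t1 := total_cover.
have t2 : 2 * \sum_i scov i <= 28 * (#|I| * wmin) + 28 * \sum_(i | ~~ low_hop i && hnull i) W i +
   28 * Wmulti + 3 * \sum_i W i + 28 * \sum_(i | hgood i) W i.
  rewrite big_distrr /=; apply: leq_trans (leq_sum _ (fun i _ => hop_split i)) _.
  do 4!rewrite big_split /=; rewrite -!big_distrr /=.
  apply: leq_add; [apply: leq_add => //; apply: leq_add; [apply: leq_add|]|]; rewrite leq_mul2l /=.
  - rewrite -sum1_card big_distrl /=; apply: leq_sum => i _; by case: (low_hop i); rewrite ?mul1n.
  - rewrite [X in _ <= X]big_mkcond; apply: leq_sum => i _ /=; case: ifP; by rewrite ?mul1n.
  - rewrite /Wmulti [X in _ <= X]big_mkcond; apply: leq_sum => i _ /=; case: ifP; by rewrite ?mul1n.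
  - rewrite [X in _ <= X]big_mkcond; apply: leq_sum => i _ /=; case: ifP; by rewrite ?mul1n.
have t3 := null_weight; have t4 := good_weight.
have t5 := func_weight; have t6 := multi_low_cover.
have t7 : \sum_(j < J) th j.+1 * #|repl' j| <=
   2 * wt om (fun x => IIgood (level th (om x)) x) + 2 * \sum_(j < J) th j.+1 * #|Func j| + 6 * chi1.
  have s1 (j : 'I_J) : th j.+1 * #|repl' j| <= \sum_(x | Fl j x && IIgood j x) 2 * om x +
      (2 * (th j.+1 * #|Func j|) + 6 * (th j.+1 * X (th j))).
    apply: leq_trans (_ : th j.+1 * (#|[pred x | Fl j x && IIgood j x]| + #|IIbad j|) <= _).
      rewrite leq_mul2l; apply/orP; right.
      apply: leq_trans (_ : #|[predU [pred x | Fl j x && IIgood j x] & IIbad j]| <= _); last first.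
        by rewrite -cardUI leq_addr.
      apply: subset_leq_card; apply/subsetP => x hx.
      have hx' : repl' j x := hx.
      have fx : Fl j x.
        have /existsP[i /and3P[/and3P[nl si _] /eqP lj /eqP fe]] := hx'.
        have [_ h1 /cut h2 _ _] := simple_facts si; have /andP[_ h3] := W_level nl.
        rewrite fe lj in h1 h2 h3; rewrite /Fl /lvl (h1 : th j <= om x) /=.
        exact: leq_ltn_trans h2 h3.
      rewrite inE; apply/orP; rewrite inE fx /IIgood /= hx' /=.
      case: (boolP (few_children _ _ _ _ _ _ _)) => h; [by left | right].
      by rewrite unfold_in /IIbad hx' /manyB h.
    rewrite mulnDr; apply: leq_add.
      rewrite mulnC -sum_nat_const; apply: leq_sum => y; rewrite inE => /andP[/andP[h _] _].
      by apply: leq_trans (th_two j) _; rewrite leq_mul2l h orbT.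
    apply: leq_trans (_ : th j.+1 * (2 * #|Func j| + 6 * X (th j)) <= _); last by rewrite mulnDr (mulnCA (th _) 2) (mulnCA (th _) 6).
    by rewrite leq_mul2l bad_bound orbT.
  apply: leq_trans (leq_sum _ (fun (j : 'I_J) _ => s1 j)) _.
  do 2!rewrite big_split /=; rewrite -!big_distrr /= addnA !leq_add2r /wt.
  under eq_bigr => j _ do rewrite big_mkcond.
  rewrite exchange_big big_distrr [X in _ <= X]big_mkcond /=; apply: leq_sum => x _.
  case: ifP => hI.
    rewrite (bigD1 (Ordinal (levJ' x))) //= big1 ?addn0; first by case: ifP.
    move=> j hj; case: ifP => // /andP[fy _].
    by move: hj; rewrite -val_eqE /= (level_uniq thS fy) eqxx.
  rewrite big1 // => j _; case: ifP => // /andP[fy hj].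
  by rewrite (level_uniq thS fy) hj in hI.
move: t1 t2 t3 t4 t5 t6 t7 hd; rewrite -/M.
move: M (wt om Lset) (\sum_i scov i) (#|I| * wmin) (\sum_(i | ~~ low_hop i && hnull i) W i) Wmulti
  (\sum_i W i) (\sum_(i | hgood i) W i) chi1 chi2 (\sum_(j < J) th j.+1 * #|Func j|)
  (\sum_(i | low_hop i || hmulti i) scov i) (\sum_(j < J) th j.+1 * #|repl' j|)
  (wt om (fun x => IIgood (level th (om x)) x)).
by clear; lia.
Qed.

End Accounting.

(** * Completeness of the tests *)

Lemma size_filter_enum (V : finType) (P : pred V) : size [seq x <- enum V | P x] = #|P|.
Proof. by rewrite size_filter -[RHS]sum1_card -sum1_count big_enum_cond. Qed.

Lemma sum_uniq_card (V : finType) (f : V -> V) (P : pred V) (O : seq V) : uniq O ->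
  \sum_(y <- O) #|[pred x | P x && (f x == y)]| <= #|P|.
Proof.
move=> uO; rewrite -[X in _ <= X]sum1_card.
under eq_bigr => y _ do rewrite -sum1_card big_mkcond.
rewrite exchange_big /= [X in _ <= X]big_mkcond; apply: leq_sum => x _.
rewrite (eq_bigr (fun y => if P x && (pred1 (f x) y) then 1 else 0)); last by move=> y _; rewrite inE /= eq_sym.
rewrite unfold_in; case: (P x) => /=; last by rewrite big1_eq.
by rewrite -big_mkcond sum1_count count_uniq_mem // leq_b1.
Qed.

Section Tests.
Variables (V : finType) (r : V) (par : V -> V) (lv : V -> nat) (om : V -> nat).
Hypothesis rtd : rooted r par lv.
Hypothesis om_r : om r = 0.
Variables (w : V -> V -> nat).
Hypothesis wC : forall u v, w u v = w v u.
Hypothesis wT : forall u v x, w u x <= w u v + w v x.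
Hypothesis cut : forall x u v, sep par x u v -> om x <= w u v.
Hypothesis wD : forall u v, w u v <= dist par om xpredT u v.
Variables (th rho : nat -> nat) (wmin : nat) (act : pred nat).
Hypothesis thS : forall j, th j < th j.+1.
Hypothesis th_pos : forall j, 0 < th j.
Hypothesis th_two : forall j, th j.+1 <= 2 * th j.
Hypothesis th0 : forall x, x != r -> th 0 <= om x.
Hypothesis rho_pos : forall j, 0 < rho j.

Notation tp := (top r par lv).
Notation dep := (depth par om).
Notation M := (wt om xpredT).
Notation Ej j := (bigE om (th j)).
Notation lvlj j := (lvl om (th j) (th j.+1)).

Lemma dist_tri U u v x : dist par om U u x <= dist par om U u v + dist par om U v x.
Proof.
rewrite /dist -big_split /=; apply: leq_sum => z _; rewrite -mulnDr leq_mul2l; apply/orP; right.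
by rewrite (sep_trans par v z u x); case: sep; case: sep.
Qed.

Lemma dist_anc_lt p u d : anc par p u -> dep u < dep p + d -> dist par om xpredT p u < d.
Proof. by move=> /(depth_anc om) ->; rewrite ltn_add2l. Qed.

Definition net (j : nat) y : seq V :=
  [seq a <- enum V | (tp (Ej j) a == y) &&
     netpt r par om (Ej j) (rho j) (bestshift par om (rho j)) a].

Lemma mem_net j y a : (a \in net j y) = (tp (Ej j) a == y) &&
  netpt r par om (Ej j) (rho j) (bestshift par om (rho j)) a.
Proof. by rewrite mem_filter mem_enum andbT. Qed.

Lemma net_near j u : exists a, [/\ anc par a u, a \in net j (tp (Ej j) u) & dist par om xpredT a u < rho j].
Proof.
have [a [h1 h2 h3 h4]] := net_anc om rtd (Ej j) (bestshift par om (rho j)) u (rho_pos j).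
by exists a; rewrite mem_net h3 eqxx h2; split => //; apply: dist_anc_lt.
Qed.

(** A part contributes at most its top, and all parts together at most M / rho crossing points. *)
Lemma net_total j (O : seq V) : uniq O ->
  rho j * \sum_(y <- O) size (net j y) <= rho j * size O + M.
Proof.
move=> uO; apply: leq_trans (leq_add (leqnn _) (net_size om rtd (rho_pos j))).
rewrite -mulnDr leq_mul2l; apply/orP; right.
apply: leq_trans (_ : \sum_(y <- O) (1 + #|[pred x | cross par om (rho j) (bestshift par om (rho j)) x && (tp (Ej j) x == y)]|) <= _).
  apply: leq_sum => y _; rewrite size_filter_enum.
  rewrite -(card1 y) -cardUI; apply: leq_trans (leq_addr _ _); apply: subset_leq_card.
  apply/subsetP => a; rewrite !inE => /andP[/eqP <- /orP[/(top_id rtd) ->|->]]; first by rewrite eqxx.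
  by rewrite eqxx orbT.
rewrite big_split /= sum1_size leq_add2l; exact: sum_uniq_card.
Qed.

Section Long.
Variables (b K : nat).
Hypothesis b_pos : 0 < b.
Hypothesis b_small : forall x D, x != r -> 6 * om x <= D -> 6 * wmin <= D -> 16 * b <= D.
Hypothesis K_big : M < 16 * b * 2 ^ K.

(** The bounds 16 and 32 tie [x] to the scales at which a witness can occur. They also confine the
    edges that use a given net point to a chain of weight at most 48 times the scale
    ([chain_bound]), which is the 48 of [longnet_cost]. *)
Definition longpts i x := [seq p <- enum V |
  [&& cross par om (b * 2 ^ i) (bestshift par om (b * 2 ^ i)) p, anc par x p,
      om x <= 16 * (b * 2 ^ i) & dep p - dep x <= 32 * (b * 2 ^ i)]].

Definition longnet x := flatten [seq longpts i x | i <- iota 0 K].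

Definition Ltest x := has (fun p => [exists q, long_witness r par om w x p q]) (longnet x).

Lemma depth_le_M v : dep v <= M.
Proof. by rewrite /depth /wt; apply: leq_sum => x _; case: anc; rewrite ?muln1 ?muln0. Qed.

(** For a depth difference D take the scale between D / 32 and D / 16, and the net point [p] less
    than one scale above [u]. If D exceeds the bound, then [w p v] is below D / 6 + D / 16, and four
    times this is less than D - D / 16. *)
Lemma Ltest_complete z u v : ~~ Ltest z -> anc par z u -> ~~ anc par z v ->
  dep u - dep z <= 6 * maxn (w u v) wmin.
Proof.
move=> nL zu nzv; rewrite leqNgt; apply: contra nL => hD.
have zr : z != r by apply: contraNneq nzv => ->; apply: (anc_rootl rtd).
have hcut : om z <= w u v by apply: cut; rewrite /sep zu (negbTE nzv).
have [i [iK h1 h2]] : exists i, [/\ i < K, 16 * (b * 2 ^ i) <= dep u - dep z & dep u - dep z < 32 * (b * 2 ^ i)].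
  have hb : 16 * b <= dep u - dep z by apply: (b_small zr); lia.
  have hM : dep u - dep z < 16 * b * 2 ^ K by have := depth_le_M u; lia.
  have hex : exists i, dep u - dep z < 16 * b * 2 ^ i.+1.
    by case: (K) hM => [|K' h]; [rewrite expn0 muln1 ltnNge hb | exists K'].
  case: (ex_minnP hex) => i hi imin; exists i; split.
  - case: (leqP K i) => // Ki; case: (K) Ki hM => [|K'] Ki hM; last by have := imin _ hM; lia.
    by move: hM; rewrite expn0 muln1 ltnNge hb.
  - case: i hi imin => [|i] hi imin; first by rewrite expn0 muln1.
    rewrite leqNgt; apply/negP => h.
    by have := imin i; rewrite -mulnA => /(_ h); rewrite ltnn.
  - by move: hi; rewrite expnS -mulnA; lia.
have rp : 0 < b * 2 ^ i by rewrite muln_gt0 b_pos expn_gt0.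
have [p [pu hp _ hd]] := net_anc om rtd pred0 (bestshift par om (b * 2 ^ i)) u rp.
have pz : anc par z p.
  have := anc_total rtd zu pu; case: (boolP (anc par z p)) => //= _ /(depth_mono om); lia.
have pr : p != r by apply: contraTneq pz => ->; rewrite (anc_root rtd).
have hp' : cross par om (b * 2 ^ i) (bestshift par om (b * 2 ^ i)) p.
  by move: hp; rewrite /netpt /istop (negbTE pr).
have hpu := depth_mono om pu.
apply/hasP; exists p.
  apply/flattenP; exists (longpts i z); first by apply: map_f; rewrite mem_iota.
  rewrite mem_filter mem_enum andbT hp' pz /=; move: (b * 2 ^ i) h1 h2 hpu => rr h1 h2 hpu.
  by apply/andP; split; lia.
apply/existsP; exists v; rewrite /long_witness zr pz nzv /=.
have hw : w p v <= w u v + dist par om xpredT p u.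
  by rewrite addnC; apply: leq_trans (wT p u v) _; rewrite leq_add2r.
have := dist_anc_lt pu hd; move: hw; move: (dist _ _ _ _ _) (b * 2 ^ i) h1 h2 hpu hd => dd rr *; lia.
Qed.

Lemma longnet_cost : \sum_x om x * size (longnet x) <= 48 * K * M.
Proof.
have e x : size (longnet x) = \sum_(i <- iota 0 K) size (longpts i x).
  by rewrite size_flatten /shape -map_comp sumnE big_map.
under eq_bigr => x _ do rewrite e big_distrr.
rewrite exchange_big /= -{2}[K](size_iota 0) -mulnA -sum1_size big_distrl big_distrr /=.
apply: leq_sum => i _; rewrite mul1n.
set rh := b * 2 ^ i; have rp : 0 < rh by rewrite muln_gt0 b_pos expn_gt0.
apply: leq_trans (_ : 48 * (rh * #|[pred p | cross par om rh (bestshift par om rh) p]|) <= _); last first.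
  by rewrite leq_mul2l /= (net_size om rtd rp).
rewrite mulnA -sum1_card big_distrr /= .
under eq_bigr => x _ do rewrite /longpts -/rh size_filter_enum -sum1_card big_distrr /= big_mkcond.
rewrite exchange_big /= [X in _ <= X]big_mkcond; apply: leq_sum => p _.
rewrite inE; case: (boolP (cross _ _ _ _ _)) => hc; last first.
  by rewrite big1 // => x _; rewrite unfold_in (negbTE hc).
rewrite muln1; apply: leq_trans (leq_trans (_ : _ <= _) (chain_bound rtd om_r p (32 * rh) (16 * rh))) _; last by lia.
rewrite /wt [X in _ <= X]big_mkcond; apply: leq_sum => x _.
by rewrite unfold_in hc /= muln1; case: (anc par x p) => //=; rewrite andbC.
Qed.

End Long.

Definition lvlset j := [set x | lvlj j x].

Lemma one_level (s : seq nat) x c : uniq s -> \sum_(i <- s | lvlj i x) c <= c.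
Proof.
move=> us; rewrite big_const_seq iter_addn_0 -{2}[c]muln1 leq_mul2l; apply/orP; right.
apply: leq_trans (_ : count (pred1 (level th (om x))) s <= _).
  by apply: sub_count => i /(level_uniq thS) /= ->.
by rewrite count_uniq_mem // leq_b1.
Qed.

Lemma level_sum (s : seq nat) (P : nat -> pred V) : uniq s ->
  \sum_(i <- s) th i.+1 * #|[pred x | lvlj i x && P i x]| <=
    2 * wt om (fun x => has (fun i => lvlj i x && P i x) s).
Proof.
move=> us; apply: leq_trans (_ : \sum_(i <- s) \sum_(x | lvlj i x && P i x) 2 * om x <= _).
  apply: leq_sum => i _; rewrite -sum1_card big_distrr /=; apply: leq_sum => x /andP[/andP[h _] _].
  by rewrite muln1; apply: leq_trans (th_two i) _; rewrite leq_mul2l h orbT.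
under eq_bigr => i _ do rewrite big_mkcond.
rewrite exchange_big /wt /= big_distrr [X in _ <= X]big_mkcond /=; apply: leq_sum => x _.
case: (boolP (has _ _)) => [_|/hasPn h]; last first.
  by rewrite big_seq big1 // => i /h/negbTE ->.
rewrite -big_mkcond /=; apply: leq_trans (one_level x (2 * om x) us).
rewrite big_mkcond [X in _ <= X]big_mkcond /=; apply: leq_sum => i _.
by case: (lvlj i x); rewrite ?andbF //=; case: ifP.
Qed.

Hypothesis th_rho : forall j, th j.+1 <= 256 * rho j.

Lemma net_weight j (O : seq V) : uniq O ->
  th j.+1 * \sum_(y <- O) size (net j y) <= th j.+1 * size O + 256 * M.
Proof.
move=> /(net_total j); move: (\sum_(y <- O) _) (size O) (th_rho j) => s o ht h.
have [so|os] := leqP s o; first by apply: leq_trans (leq_addr _ _); rewrite leq_mul2l so orbT.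
rewrite -(subnKC (ltnW os)) mulnDr leq_add2l.
apply: leq_trans (leq_mul ht (leqnn _)) _; rewrite -mulnA leq_mul2l /=.
by rewrite -(leq_add2l (rho j * o)) -mulnDr subnKC // ltnW.
Qed.

Section Replace.

Definition IItest x := let j := level th (om x) in
  [&& act j, few_children r par lv om th j (tp (Ej j) (par x)) &
   has (fun a => [exists v, repl_witness r par lv om w (th j) (th j.+1) (rho j) x a v]) (net j x)].

Definition replnet x := let j := level th (om x) in
  if act j then net j x else [::].

Lemma replnet_cost (j0 m : nat) : (forall j, act j -> j0 <= j < j0 + m) ->
  \sum_x om x * size (replnet x) <= (2 + 256 * m) * M.
Proof.
move=> hact; pose s := index_iota j0 (j0 + m); have us : uniq s by apply: iota_uniq.
have h x : om x * size (replnet x) <=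
    \sum_(j <- s) (if lvlj j x then th j.+1 * size (net j x) else 0).
  rewrite /replnet; case: ifP => [/hact hj|_]; last by rewrite muln0.
  have [->|xr] := eqVneq x r; first by rewrite om_r.
  have hl : lvlj (level th (om x)) x := level_bounds thS (th0 xr).
  rewrite (bigD1_seq (level th (om x))) /= ?mem_index_iota //.
  by rewrite hl; apply: leq_trans (leq_addr _ _); rewrite leq_mul2r ltnW ?orbT //; case/andP: hl.
apply: leq_trans (leq_sum _ (fun x _ => h x)) _.
rewrite exchange_big /=.
apply: leq_trans (_ : \sum_(j <- s) (th j.+1 * #|[pred x | lvlj j x && true]| + 256 * M) <= _).
  apply: leq_sum => j _; have := net_weight j (enum_uniq (lvlset j)); rewrite -cardE.
  rewrite big_enum big_distrr [X in X <= _ -> _]big_mkcond /= => h'; apply: leq_trans (leq_trans _ h') _.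
    by apply: leq_sum => x _; rewrite inE.
  by rewrite (_ : #|lvlset j| = #|[pred x | lvlj j x && true]|) //; apply: eq_card => x; rewrite !inE andbT.
rewrite big_split /= sum_nat_const_nat addKn mulnDl leq_add //; last by lia.
apply: leq_trans (level_sum (fun _ => predT) us) _; rewrite leq_mul2l /= /wt.
by rewrite big_mkcond; apply: leq_sum => x _; case: ifP.
Qed.

End Replace.

Section Conflicts.
Variable j : nat.

(** Those parts of level [j] that share a part of level [j.+1] with another one; the others have no
    conflict. Their number is within a factor 2 of the number of edges of level [j], so a uniform
    object costs about as much as an edge drawn by weight. *)
Definition objs : seq V := enum (lvlset j :|: [set tp (Ej j.+1) x | x in lvlset j]).

Lemma objs_uniq : uniq objs. Proof. exact: enum_uniq. Qed.

Lemma objs_size : #|lvlset j| <= size objs <= 2 * #|lvlset j|.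
Proof.
rewrite /objs -cardE; apply/andP; split; first by apply: subset_leq_card; apply: subsetUl.
by apply: leq_trans (leq_card_setU _ _) _; rewrite mul2n -addnn leq_add2l leq_imset_card.
Qed.

Lemma bigE_S x : Ej j.+1 x -> Ej j x.
Proof. by apply: leq_trans; apply: ltnW. Qed.

Lemma objs_top y : y \in objs -> istop r (Ej j) y.
Proof.
rewrite mem_enum !inE => /orP[/andP[h _]|/imsetP[x _ ->]]; first by rewrite /istop /bigE h orbT.
have := top_istop rtd (Ej j.+1) x; rewrite /istop => /orP[->//|/bigE_S ->]; by rewrite orbT.
Qed.

Lemma objs_pair A B : istop r (Ej j) A -> istop r (Ej j) B -> A != B ->
  tp (Ej j.+1) A = tp (Ej j.+1) B -> A \in objs.
Proof.
move=> hA hB AB e; rewrite mem_enum !inE.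
have hl D : istop r (Ej j) D -> ~~ istop r (Ej j.+1) D -> lvlj j D.
  rewrite /istop => h1; rewrite negb_or => /andP[h2 h3]; move: h1; rewrite (negbTE h2) /= /bigE /lvl => ->.
  by rewrite ltnNge.
case: (boolP (istop r (Ej j.+1) A)) => hA'; last by rewrite (hl A).
case: (boolP (istop r (Ej j.+1) B)) => hB'; first by move: AB; rewrite -(top_id rtd hA') -(top_id rtd hB') e eqxx.
apply/orP; right; apply/imsetP; exists B; first by rewrite inE hl.
by rewrite -e (top_id rtd).
Qed.

Definition conf y x := (y == x) || [&& tp (Ej j.+1) y == tp (Ej j.+1) x,
  tp (Ej j) (par y) != x, tp (Ej j) (par x) != y &
  has (fun a => has (fun b => w a b <= th j.+1 + 2 * rho j) (net j x)) (net j y)].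

Lemma conf_refl : reflexive conf. Proof. by move=> x; rewrite /conf eqxx. Qed.

Lemma conf_sym : symmetric conf.
Proof.
suff h x y : conf x y -> conf y x by move=> x y; apply/idP/idP; apply: h.
case/orP => [/eqP ->|/and4P[h1 h2 h3 /hasP[a ha /hasP[b hb hw]]]]; first exact: conf_refl.
rewrite /conf [tp _ y == _]eq_sym h1 h2 h3 /=; apply/orP; right; apply/hasP; exists b => //.
by apply/hasP; exists a => //; rewrite wC.
Qed.

Lemma conf_cover (C : {set V}) :
  (forall u v, 100 * dist par om (fun x => x \notin C) u v <= 101 * w u v) ->
  64 * 100 <= th j -> 99 * th j.+1 <= 100 * th j -> 64 * rho j <= th j ->
  forall x y, x \in objs -> y \in objs -> x != y -> conf x y ->
  coverX r par lv om C (th j) (th j.+1) x || coverX r par lv om C (th j) (th j.+1) y.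
Proof.
move=> cutC hb hr hrho x y xO yO xy; rewrite /conf (negbTE xy) /=.
case/and4P => /eqP h1 h2 h3 /hasP[a ha /hasP[b hb' hw]].
apply: (conflict_cover rtd cutC hb (thS j) hr hrho xy h1 h2 h3 (objs_top xO) (objs_top yO) (a := a) (b := b)).
by move: ha hb'; rewrite !mem_net /far_witness hw => /andP[-> _] /andP[-> _].
Qed.

End Conflicts.

Section Tour.
Variables (I : finType) (a b : I -> V).
Hypothesis cyc : forall S : pred V, (exists u, S u) -> (exists v, ~~ S v) ->
  exists i, S (a i) && ~~ S (b i).
Hypothesis act_ok : forall t, th 0 <= t -> wmin <= t -> t <= M -> act (level th t).

Notation W := (hop_len w a b).
Notation low := (low_hop w a b wmin).
Notation lev := (hop_level w a b th).

Lemma W_le_M i : W i <= M.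
Proof.
apply: leq_trans (wD _ _) _; rewrite /dist /wt; apply: leq_sum => x _.
by case: sep; rewrite ?muln1 ?muln0.
Qed.

Lemma act_lev i : ~~ low i -> act (lev i).
Proof.
move=> nl; have /andP[h1 _] := W_level rtd cut wD thS th0 nl.
apply: act_ok; [exact: leq_trans (th_mono thS _) h1| | exact: W_le_M].
by move: nl; rewrite negb_or -leqNgt => /andP[].
Qed.

(** The end of the good hop below [x] is moved to a net point less than [rho] away; the two terms
    [rho] in [repl_witness] absorb the move. *)
Lemma IIgood_test Lset x : IIgood r par lv om w a b th wmin Lset (level th (om x)) x -> IItest x.
Proof.
set j := level th (om x); have lx : level th (om x) = j by [].
clearbody j => /andP[/existsP[i /and3P[/and3P[nl si hg] /eqP lj /eqP fx]] fc].
rewrite /IItest lx fc -{1}lj act_lev //=.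
have [xr Ex /cut hx xtop _] := simple_facts rtd si; rewrite fx lj in xr Ex hx xtop.
have /andP[hW1 hW2] := W_level rtd cut wD thS th0 nl; rewrite lj in hW1 hW2.
have hs : scov par om a b Lset i <= dist par om xpredT (a i) (b i) by apply: leq_dist.
rewrite fx in hg.
have key u v : tp (Ej j) u = x -> tp (Ej j) v = tp (Ej j) (par x) -> w u v = W i ->
    dist par om xpredT u v = dist par om xpredT (a i) (b i) ->
    has (fun a => [exists v, repl_witness r par lv om w (th j) (th j.+1) (rho j) x a v]) (net j x).
  move=> hu hv hw hd; have [a' [h1 h2 h3]] := net_near j u; rewrite hu in h2.
  apply/hasP; exists a' => //; apply/existsP; exists v.
  rewrite /repl_witness xr hv eqxx; move: h2; rewrite mem_net => /andP[-> _] /=.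
  rewrite /lvl (Ex : th j <= om x) (leq_ltn_trans hx hW2) /=.
  have t1 := wT a' u v; have t2 := wD a' u; have t3 := dist_tri xpredT u a' v.
  rewrite (distC _ _ _ u a') in t3; rewrite hw in t1; rewrite hd in t3.
  move: hg hW1 hW2 hs h3 t1 t2 t3.
  move: (w a' v) (w a' u) (W i) (dist par om xpredT a' u) (dist par om xpredT (a i) (b i)) (dist par om xpredT a' v) (scov _ _ _ _ _ _) (th j) (th j.+1) (rho j) (om x).
  by clear; lia.
move: si fx; rewrite /hsimple /hf; case: (boolP (simp1 _ _ _ _ _ _ _ _ _)) => [/andP[_ /eqP h2] _ fx|_ /= /andP[_ /eqP h2] fx].
  by apply: (key (a i) (b i)); rewrite // -?lj //; rewrite -fx.
have k1 : tp (Ej j) (b i) = x by rewrite -lj.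
have k2 : tp (Ej j) (a i) = tp (Ej j) (par x) by rewrite -fx -lj.
exact: key k1 k2 (wC _ _) (distC _ _ _ _ _).
Qed.

Notation multi := (hmulti r par lv om w a b th).

(** The two parts joined by a multi hop of level [j] are in conflict, as net points near its ends
    show. So one end lies in the vertex cover, and [ends_bound] allows two ends per part plus the
    excess. *)
Lemma multi_bound j (S : pred V) :
  (forall x y, x \in objs j -> y \in objs j -> x != y -> conf j x y -> S x || S y) ->
  #|[pred i | (~~ low i && multi i) && (lev i == j)]| <= 2 * count S (objs j) + 2 * excess om w a b (th j).
Proof.
move=> vc; pose S' y := (y \in objs j) && S y.
have -> : count S (objs j) = #|[pred y | istop r (Ej j) y && S' y]|.
  rewrite -size_filter -(card_uniqP (filter_uniq _ (objs_uniq j))); apply: eq_card => y.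
  rewrite mem_filter !inE /S' andbC; case: (boolP (y \in objs j)) => //= hy; last by rewrite andbF.
  by rewrite (objs_top hy).
apply: leq_trans (ends_bound rtd om_r cut cyc S' (th_pos j)).
rewrite -sum1_card big_mkcond [X in _ <= X]big_mkcond /=; apply: leq_sum => i _.
rewrite !inE; case: ifP => // /andP[/andP[nl /andP[nn ns]] /eqP lj].
have /andP[hW1 hW2] := W_level rtd cut wD thS th0 nl; rewrite lj in hW1 hW2.
rewrite /long_hop hW1.
move: nn ns; rewrite /hnull /hsimple /simp1 /simp2 /hA /hB lj.
set A := tp _ (a i); set B := tp _ (b i) => AB; rewrite AB /= negb_or => /andP[n1 n2].
have same : tp (Ej j.+1) A = tp (Ej j.+1) B.
  rewrite /A /B !(top_sub rtd) ?/A; last 2 first.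
  - by move=> x; apply: bigE_S.
  - by move=> x; apply: bigE_S.
  apply/eqP/(top_eqP rtd) => x Ex; apply/negP => /cut.
  by rewrite leqNgt (leq_trans hW2).
have tA : istop r (Ej j) A by apply: top_istop.
have tB : istop r (Ej j) B by apply: top_istop.
have AO := objs_pair tA tB AB same.
have BO : B \in objs j by apply: (objs_pair tB tA); rewrite // eq_sym.
have : S A || S B.
  apply: vc => //; rewrite /conf (negbTE AB) same eqxx n1 n2 /=.
  have [a' [_ h2 h3]] := net_near j (a i); have [b' [_ k2 k3]] := net_near j (b i).
  apply/hasP; exists a' => //; apply/hasP; exists b' => //.
  have t1 := wT a' (a i) b'; have t2 := wT (a i) (b i) b'; have t3 := wD a' (a i); have t4 := wD b' (b i).
  rewrite wC in t4; move: hW2 h3 k3 t1 t2 t3 t4; rewrite /hop_len.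
  move: (w a' b') (w a' (a i)) (w (a i) b') (w (a i) (b i)) (w (b i) b') (dist _ _ _ _ _) (dist _ _ _ _ _).
  by clear; lia.
by rewrite /S' AO BO /=; case/orP => ->; rewrite ?addn1 ?add1n.
Qed.

Lemma Wmulti_bound (J : nat) (tau : nat -> nat) : (forall i, lev i < J) ->
  (forall j, act j -> #|[pred i | (~~ low i && multi i) && (lev i == j)]| <= tau j) ->
  Wmulti r par lv om w a b th wmin <= \sum_(j < J | act j) th j.+1 * tau j.
Proof.
move=> levJ hb.
have hP i : ~~ low i && multi i -> ~~ low i by case/andP.
apply: leq_trans (by_level rtd cut wD thS th0 levJ hP) _.
rewrite [X in _ <= X]big_mkcond; apply: leq_sum => j _; case: (boolP (act j)) => aj.
  by rewrite leq_mul2l hb ?orbT.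
rewrite eq_card0 ?muln0 // => i; rewrite !inE; apply: contraNF aj => /andP[/andP[nl _] /eqP <-].
exact: act_lev.
Qed.

End Tour.
End Tests.

(** * The grid of thresholds *)

Section Growth.
Variables (f : nat -> nat) (c : nat).
Hypothesis growth : forall j, f j + c * f j <= c * f j.+1.
Hypothesis f_mono : forall i j, i <= j -> f i <= f j.

Lemma growth_iter j k : k * f j + c * f j <= c * f (j + k).
Proof.
elim: k => [|k IH]; first by rewrite addn0.
have := growth (j + k); have := f_mono (leq_addr k j); rewrite addnS.
move: IH; rewrite mulSn; move: (k * f j) (c * f j) (c * f (j + k)) (c * _) => A B C D; lia.
Qed.

Hypothesis c_pos : 0 < c.

Lemma growth_double j k : 2 ^ k * f j <= f (j + c * k).
Proof.
elim: k => [|k IH]; first by rewrite muln0 addn0 mul1n.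
rewrite expnS -mulnA; apply: leq_trans (leq_mul (leqnn 2) IH) _.
by have := growth_iter (j + c * k) c; rewrite addnn -mul2n mulnCA leq_pmul2l // mulnSr addnA.
Qed.

End Growth.

Section Grid.
Variable q : nat.
Hypothesis q_pos : 0 < q.

(** An integral geometric progression of ratio about 1 + 1/q; starting at [q] keeps the rounded
    increments positive. *)
Fixpoint tau i := if i is i'.+1 then tau i' + tau i' %/ q else q.

Lemma tau_ge i : q <= tau i.
Proof. by elim: i => //= i IH; apply: leq_trans IH (leq_addr _ _). Qed.

Lemma tau_step i : 0 < tau i %/ q. Proof. by rewrite divn_gt0 // tau_ge. Qed.

Lemma tauS i : tau i < tau i.+1.
Proof. by rewrite /= -ltn_subLR ?subnn ?tau_step. Qed.

Lemma tau_growth i : tau i + (2 * q) * tau i <= (2 * q) * tau i.+1.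
Proof.
rewrite /= mulnDr addnC leq_add2l; have := tau_step i; have := ltn_ceil (tau i) q_pos.
by move: (tau i %/ q) => d; rewrite mulSn; nia.
Qed.

(** Integral form of: (1 + 1/q)^k is at most 1 / (1 - k/q). *)
Lemma tau_upper i k : k <= q -> tau (i + k) * (q - k) <= q * tau i.
Proof.
elim: k => [|k IH] kq; first by rewrite addn0 subn0 mulnC.
have {}IH := IH (ltnW kq); rewrite addnS -(leq_pmul2l q_pos).
have h : q * tau (i + k).+1 <= tau (i + k) * q.+1.
  by rewrite /= mulnDr mulnS addnC [q * tau _]mulnC leq_add2r mulnC leq_trunc_div.
apply: leq_trans (leq_mul (leqnn q) IH).
rewrite mulnA; apply: leq_trans (leq_mul h (leqnn _)) _.
rewrite -mulnA [X in _ <= X]mulnCA leq_mul2l; apply/orP; right; nia.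
Qed.

Variable R : nat.
Hypothesis R_pos : 0 < R.
Hypothesis qR : q = 100 * R.
Variable s : nat.
Hypothesis sR : s < R.

(** Every [R]-th point of the fine grid, with offset [s]. The successor keeps one fine interval,
    from [tau (s + R * j)] to [thr j], just below each threshold, for the counting by [gap]. *)
Definition thr j := tau (s + R * j).+1.

Lemma thrS j : thr j < thr j.+1.
Proof. by apply: (leq_trans (tauS _)); apply: (th_mono tauS); rewrite mulnS; lia. Qed.

Lemma thr_ge j : q <= thr j. Proof. exact: tau_ge. Qed.

Lemma thr_ratio j : 99 * thr j.+1 <= 100 * thr j.
Proof.
have h : R <= q by lia.
have := tau_upper (s + R * j).+1 h; rewrite /thr (_ : (s + R * j).+1 + R = (s + R * j.+1).+1); last by rewrite mulnS; lia.
have -> : q - R = R * 99 by lia.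
by rewrite qR mulnC -mulnA [100 * R]mulnC -mulnA leq_pmul2l // ; apply.
Qed.

Lemma thr_two j : thr j.+1 <= 2 * thr j.
Proof. by have := thr_ratio j; lia. Qed.

Lemma thr_growth j : thr j + 200 * thr j <= 200 * thr j.+1.
Proof.
have := growth_iter tau_growth (th_mono tauS) (s + R * j).+1 R.
rewrite (_ : (s + R * j).+1 + R = (s + R * j.+1).+1) -/(thr _) -?/(thr _); last by rewrite mulnS; lia.
rewrite -/(thr j) (_ : 2 * q = R * 200); last by rewrite qR; lia.
by rewrite -!mulnA -mulnDr leq_pmul2l.
Qed.

(** Growth by 1/200 per level bounds the sum of the thresholds by 200 times the next one; the two
    index shifts cost a factor 2 each. *)
Lemma thr_geo m a : thr m <= a -> \sum_(j < m.+1) thr j.+1 <= 800 * a.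
Proof.
move=> hm; apply: leq_trans (_ : 800 * thr m <= _); last by rewrite leq_mul2l.
have h : \sum_(j < m.+1) thr j <= 200 * thr m.+1.
  elim: (m.+1) => [|k IH]; first by rewrite big_ord0.
  by rewrite big_ord_recr /=; apply: leq_trans (leq_add IH (leqnn _)) _; rewrite addnC thr_growth.
have h2 : \sum_(j < m.+1) thr j.+1 <= 2 * \sum_(j < m.+1) thr j.
  by rewrite big_distrr /=; apply: leq_sum => j _; apply: thr_two.
apply: leq_trans h2 _; apply: leq_trans (leq_mul (leqnn 2) h) _.
by rewrite mulnA; apply: leq_trans (leq_mul (leqnn _) (thr_two m)) _; rewrite mulnA.
Qed.

Lemma thr0_le : thr 0 <= 2 * q.
Proof.
have h : s.+1 <= q by lia.
have := tau_upper 0 h; rewrite add0n /thr muln0 addn0 [tau 0]/=.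
have : q <= 2 * (q - s.+1) by lia.
move: (tau s.+1) (q - s.+1) => t d h1 h2.
have : t * q <= (2 * q) * q by nia.
by rewrite leq_pmul2r.
Qed.

Lemma thr_double j k : 2 ^ k * thr j <= thr (j + 200 * k).
Proof. exact: (growth_double thr_growth (th_mono thrS)). Qed.

End Grid.

Section Offset.
Variables (V : finType) (om : V -> nat) (q R B : nat).
Hypothesis q_pos : 0 < q.

Definition gap i := #|[pred x | tau q i < om x < tau q i.+1]|.

Definition gap_cost s := \sum_(j < B) thr q R s j * gap (s + R * j).

Definition best_offset : nat :=
  if R is k.+1 then nat_of_ord [arg min_(s < (ord0 : 'I_k.+1)) gap_cost s] else 0.

Lemma best_offset_lt : 0 < R -> best_offset < R.
Proof. by rewrite /best_offset; case: R. Qed.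

(** Distinct pairs of offset and level have disjoint fine intervals, so an edge is counted at most
    once over all offsets; the factor 2 compares the threshold with the weight of the edge. *)
Lemma best_offset_cost : 0 < R -> R * gap_cost best_offset <= 2 * wt om xpredT.
Proof.
move=> R0; apply: leq_trans (_ : \sum_(s < R) gap_cost s <= _).
  rewrite /best_offset; case: R R0 => // k _.
  case: arg_minnP => // s _ hs; rewrite -[X in X * _](card_ord k.+1) -sum_nat_const.
  by apply: leq_sum => i _; apply: hs.
have tau2 i : tau q i.+1 <= 2 * tau q i.
  by rewrite /= mul2n -addnn leq_add2l leq_div.
apply: leq_trans (_ : \sum_(s < R) \sum_(j < B) \sum_x (tau q (s + R * j) < om x < tau q (s + R * j).+1) * (2 * om x) <= _).
  apply: leq_sum => s _; apply: leq_sum => j _.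
  rewrite /gap -sum1_card big_distrr big_mkcond /=; apply: leq_sum => x _.
  rewrite inE; case: ifP => // /andP[h1 _]; rewrite mul1n muln1.
  by apply: leq_trans (tau2 _) _; rewrite leq_mul2l ltnW.
under eq_bigr => s _ do rewrite exchange_big.
rewrite exchange_big /= /wt big_distrr /=; apply: leq_sum => x _.
rewrite pair_big /= -big_distrl /= -[X in _ <= X]mul1n leq_mul2r; apply/orP; right.
rewrite -big_mkcond /= sum1_card; apply/card_le1_eqP => -[s j] [s' j'].
rewrite !unfold_in /= => /andP[h1 h2] /andP[h3 h4].
have e1 : level (tau q) (om x) = s + R * j by apply: (level_uniq (tauS q_pos)); rewrite h2 ltnW.
have e2 : level (tau q) (om x) = s' + R * j' by apply: (level_uniq (tauS q_pos)); rewrite h4 ltnW.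
have e : s + R * j = s' + R * j' by rewrite -e1.
have es : s = s' :> nat by have := congr1 (modn^~ R) e; rewrite /= ![R * _]mulnC ![_ + _ * R]addnC !modnMDl !modn_small.
by congr pair; apply: val_inj => //=; move: e; rewrite es => /addnI/eqP; rewrite eqn_mul2l; case: R R0 => // k _ /eqP.
Qed.

End Offset.

Section ExcessBound.
Variables (V : finType) (r : V) (par : V -> V) (lv : V -> nat) (om : V -> nat).
Hypothesis rtd : rooted r par lv.
Hypothesis om_r : om r = 0.
Variables (w : V -> V -> nat).
Hypothesis cut : forall x u v, sep par x u v -> om x <= w u v.
Variables (I : finType) (a b : I -> V).
Hypothesis cyc : forall S : pred V, (exists u, S u) -> (exists v, ~~ S v) ->
  exists i, S (a i) && ~~ S (b i).
Variables (q R s : nat).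
Hypothesis q_pos : 0 < q.
Hypothesis R_pos : 0 < R.
Notation X := (excess om w a b).
Notation M := (wt om xpredT).
Notation th := (thr q R s).

(** The number of long hops only decreases as [t] grows, and the heavy edges lost are those of
    weight between [lo] and [t']. *)
Lemma excess_gap t t' lo : 0 < t -> lo < t -> t <= t' ->
  X t' <= X t + #|[pred x | lo < om x < t']|.
Proof.
move=> t0 lt tt'; have e1 := excess_eq rtd om_r cut cyc t0.
have e2 := excess_eq rtd om_r cut cyc (leq_trans t0 tt').
have h1 : #|long_hop w a b t'| <= #|long_hop w a b t|.
  by apply: subset_leq_card; apply/subsetP => i; apply: leq_trans.
have h2 : #|bigE om t| <= #|bigE om t'| + #|[pred x | lo < om x < t']|.
  rewrite -cardUI; apply: leq_trans (leq_addr _ _); apply: subset_leq_card.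
  apply/subsetP => x hx; rewrite !inE !unfold_in; case: (leqP t' (om x)) => h; rewrite /bigE ?h //.
  by rewrite (leq_trans lt hx) orbT.
lia.
Qed.

(** Up to the gap, the excess at [th j] is a lower bound for the excess on the whole fine interval
    below, whose length is at least [th j] / 4q. A sum over the interval thus controls the value at
    its end. *)
Lemma excess_window j : th j * X (th j) <=
  4 * q * (\sum_(tau q (s + R * j) <= t < th j) X t.+1) + th j * gap om q (s + R * j).
Proof.
set i := s + R * j; set e := gap _ _ _.
have [h|h] := leqP (X (th j)) e.
  by apply: leq_trans (leq_addl _ _); rewrite leq_mul2l h orbT.
rewrite -{1}(subnK (ltnW h)) mulnDr leq_add2r.
have hd : th j <= 4 * q * (th j - tau q i).
  rewrite /thr -/i; have := tau_growth q_pos i; have := tauS q_pos i.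
  move: (tau q i.+1) (tau q i) => A B; nia.
apply: leq_trans (leq_mul hd (leqnn _)) _; rewrite -!mulnA !leq_mul2l /=; apply/orP; right.
rewrite -sum_nat_const_nat big_nat_cond [X in _ <= X]big_nat_cond; apply: leq_sum => t /andP[/andP[h1 h2] _].
have := @excess_gap t.+1 (th j) (tau q i) (ltn0Sn t) h1 h2.
by rewrite -/e /e /gap leq_subLR addnC.
Qed.

Lemma excess_total dM B : \sum_i hop_len w a b i <= M + dM ->
  \sum_(j < B) th j * X (th j) <= 4 * q * dM + gap_cost om q R B s.
Proof.
move=> hd; apply: leq_trans (leq_sum _ (fun (j : 'I_B) _ => excess_window j)) _.
rewrite big_split /= leq_add2r -big_distrr /= leq_mul2l; apply/orP; right.
(* The fine intervals are disjoint, so all of them together see at most the total excess. *)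
have h k : \sum_(j < k) \sum_(tau q (s + R * j) <= t < th j) X t.+1 <= \sum_(0 <= t < tau q (s + R * k)) X t.+1.
  elim: k => [|k IH]; first by rewrite big_ord0.
  rewrite big_ord_recr /=; have l1 : tau q (s + R * k) <= th k := ltnW (tauS q_pos _).
  have l2 : th k <= tau q (s + R * k.+1) by apply: (th_mono (tauS q_pos)); rewrite mulnS; lia.
  rewrite [X in _ <= X](@big_cat_nat _ _ _ (tau q (s + R * k))) //= ?(leq_trans l1) //.
  apply: leq_add => //; rewrite [X in _ <= X](@big_cat_nat _ _ _ (th k)) //=; exact: leq_addr.
apply: leq_trans (h B) _; set N := tau _ _.
apply: leq_trans (_ : \sum_(0 <= t < N + (M + dM)) X t.+1 <= _).
  by rewrite [X in _ <= X](@big_cat_nat _ _ _ N) ?leq_addr.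
rewrite big_mkord; apply: (excess_sum rtd om_r cut cyc) => // [x|i].
  by apply: leq_trans (leq_addl _ _); apply: leq_trans (leq_addr _ _); rewrite /wt (bigD1 x) //= leq_addr.
by apply: leq_trans (leq_addl _ _); apply: leq_trans hd; rewrite (bigD1 i) //= leq_addr.
Qed.

Hypothesis th_two : forall j, th j.+1 <= 2 * th j.

Lemma chi_bound dM J : \sum_i hop_len w a b i <= M + dM ->
  chi1 om w a b th J <= 2 * (4 * q * dM + gap_cost om q R J.+1 s) /\
  chi2 om w a b th J <= 4 * q * dM + gap_cost om q R J.+1 s.
Proof.
move=> hd; have h := excess_total J.+1 hd; split.
  apply: leq_trans (leq_mul (leqnn 2) h); rewrite /chi1 big_ord_recr /= mulnDr big_distrr /=.
  apply: leq_trans (leq_addr _ _); apply: leq_sum => j _.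
  by rewrite mulnA leq_mul2r th_two orbT.
by apply: leq_trans h; rewrite /chi2 big_ord_recl /= leq_addl.
Qed.

End ExcessBound.

(** * Experiments *)

Local Open Scope ring_scope.

Section RowPrograms.
Variables (n : nat) (w : 'I_n -> 'I_n -> nat).
Local Notation V := 'I_n.
Local Notation row := {ffun V -> nat}.

Definition has_prog (vs : seq V) (test : V -> row -> bool) : rprog n bool :=
  rbind (rexplore vs) (fun rows => RRet n (has (fun vr => test vr.1 vr.2) (zip vs rows))).

Lemma rrun_has vs test : rrun w (has_prog vs test) = has (fun v => test v (wrow w v)) vs.
Proof. by rewrite rrun_bind rrun_explore /=; elim: vs => //= v vs ->. Qed.

Lemma rcost_has vs test : rcost w (has_prog vs test) = size vs.
Proof. by rewrite rcost_bind rcost_explore /= addn0. Qed.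

Section Greedy.
Variables (net : V -> seq V) (nbr : seq row -> rel V).

Definition nbrel : rel V := fun y => nbr [seq wrow w a | a <- net y] y.

Fixpoint prefix_prog (l : seq (option V)) : rprog n (pred V * pred V) :=
  if l is y :: l' then
    rbind (prefix_prog l') (fun AK =>
      if y is Some y' then
        rbind (rexplore (net y')) (fun rows => let nb := nbr rows y' in
          RRet n (fun x => AK.1 x && ~~ (nb x && AK.1 y'),
                  fun x => AK.2 x || (AK.1 x && [&& nb x, AK.1 y' & y' != x])))
      else RRet n (fun x => AK.1 x && true, fun x => AK.2 x || (AK.1 x && false)))
  else RRet n (xpredT, xpred0).

Lemma rrun_prefix l : rrun w (prefix_prog l) = (alive xpredT nbrel l, killed xpredT nbrel l).
Proof.
elim: l => //= -[y|] l IH; rewrite rrun_bind IH //=.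
by rewrite rrun_bind rrun_explore.
Qed.

Lemma rcost_prefix l : rcost w (prefix_prog l) = steps_cost (fun y => size (net y)) l.
Proof.
elim: l => [|y l IH] /=; first by rewrite /steps_cost big_nil.
rewrite rcost_bind IH /steps_cost big_cons addnC; congr (_ + _)%N.
by case: y => [y|] //=; rewrite rcost_bind rcost_explore /= addn0.
Qed.

Variables (L1 K1 : pred V).

(** The rows of [x] are returned with its status, so that later draws are tested for adjacency
    without new queries. The relation is thereby read from the side of [x], which is where symmetry
    enters. Another vertex is evaluated only if it threatens an [x] that is still alive. *)
Fixpoint eval_prog (l : seq (option V)) (x : V) : rprog n (seq row * (bool * bool)) :=
  if l is y :: l' then
    rbind (eval_prog l' x) (fun s =>
      if y is Some y' then
        if s.2.1 && [&& nbr s.1 x y', L1 y' & L1 x] then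
          rbind (eval_prog l' y') (fun s' =>
            RRet n (s.1, (s.2.1 && ~~ s'.2.1, s.2.2 || (s'.2.1 && (y' != x)))))
        else RRet n s
      else RRet n s)
  else rbind (rexplore (net x)) (fun rows => RRet n (rows, (L1 x, K1 x))).

Hypothesis nb_sym : symmetric nbrel.
Let nb2 y x := [&& nbrel y x, L1 y & L1 x].

Lemma eval_progP l x :
  rrun w (eval_prog l x) =
    ([seq wrow w a | a <- net x], (alive L1 nb2 l x, K1 x || killed L1 nb2 l x)) /\
  rcost w (eval_prog l x) = rec_cost (fun y => size (net y)) L1 nb2 l x.
Proof.
elim: l x => [|y l IH] x /=.
  by rewrite rrun_bind rcost_bind rrun_explore rcost_explore /= orbF addn0.
have [e1 e2] := IH x; rewrite rrun_bind rcost_bind e1 e2 /=.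
case: y => [y|] /=; last by rewrite addn0 andbT andbF orbF.
have -> : nbr [seq wrow w a | a <- net x] x y = nbrel y x by rewrite nb_sym.
have -> : [&& nbrel y x, L1 y & L1 x] = nb2 y x by [].
case ax : (alive L1 nb2 l x) => /=; last by rewrite orbF addn0.
case: (nb2 y x) => /=; last by rewrite orbF addn0.
have [f1 f2] := IH y; rewrite rrun_bind rcost_bind f1 f2 /= addn0.
by rewrite orbA.
Qed.

End Greedy.

(* The first [size l1] steps of the greedy process are explored explicitly, the later ones
   only as far as the status of [x] depends on them. *)
Definition greedy_prog (net : V -> seq V) (nbr : seq row -> rel V) (l1 l2 : seq (option V)) (x : V) : rprog n bool :=
  rbind (prefix_prog net nbr l1) (fun AK =>
    rbind (eval_prog net nbr AK.1 AK.2 l2 x) (fun s => RRet n s.2.2)).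

Lemma killed_cat (nb : rel V) l2 l1 x (L1 := alive xpredT nb l1)
    (nb2 := fun y x => [&& nb y x, L1 y & L1 x]) :
  killed xpredT nb l1 x || killed L1 nb2 l2 x = killed xpredT nb (l2 ++ l1) x.
Proof.
elim: l2 => [|y l2 IH] /=; first by rewrite orbF.
rewrite orbA IH; congr (_ || _); rewrite /nb2 /L1 (alive_cat nb l2 l1 x).
case: y => // y; rewrite (alive_cat nb l2 l1 y).
have sub l z : alive xpredT nb (l ++ l1) z -> alive xpredT nb l1 z.
  by elim: l => //= o l IHl /andP[/IHl].
case ax : (alive _ _ (l2 ++ l1) x) => //=; case ay : (alive _ _ (l2 ++ l1) y); rewrite ?andbF //=.
by rewrite (sub _ _ ax) (sub _ _ ay) !andbT.
Qed.

Lemma greedy_progP net nbr l1 l2 x : symmetric (nbrel net nbr) ->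
  rrun w (greedy_prog net nbr l1 l2 x) = killed xpredT (nbrel net nbr) (l2 ++ l1) x /\
  rcost w (greedy_prog net nbr l1 l2 x) =
    (steps_cost (fun y => size (net y)) l1 +
     rec_cost (fun y => size (net y)) (alive xpredT (nbrel net nbr) l1)
       (fun y x => [&& nbrel net nbr y x, alive xpredT (nbrel net nbr) l1 y & alive xpredT (nbrel net nbr) l1 x]) l2 x)%N.
Proof.
move=> sy; rewrite /greedy_prog !rrun_bind !rcost_bind rrun_prefix rcost_prefix /=.
have [-> ->] := eval_progP (alive xpredT (nbrel net nbr) l1) (killed xpredT (nbrel net nbr) l1) sy l2 x.
by rewrite /= addn0 killed_cat.
Qed.

End RowPrograms.

(** Pointwise form of Markov's inequality: the loss by truncation is linear in the cost and can be
    averaged afterwards. *)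
Lemma markov_bound (c F : nat) (z : bool) : (0 < F)%N ->
  z%:R - c%:R / F%:R <= ((c <= F)%N && z)%:R :> rat.
Proof.
move=> F0; case: leqP => /= h; first by rewrite gerBl divr_ge0.
have : 1 <= c%:R / F%:R :> rat by rewrite ler_pdivlMr ?ltr0n // mul1r ler_nat ltnW.
by case: z => /=; lra.
Qed.

Section Experiments.
Variables (n : nat) (w : 'I_n -> 'I_n -> nat).
Local Notation V := 'I_n.
Local Notation experiment := ((bool -> qprog n) -> qprog n).

Definition no_exp : experiment := fun k => k false.

Lemma no_expP B : is_exp w no_exp 0 B.
Proof.
split => [|good k|k b _ hb]; first by rewrite lexx ler01.
  by rewrite /no_exp; ring.
exact: leq_trans hb (leq_addl _ _).
Qed.

Section Sampling.
Variable om : V -> nat.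

(** Repeating each edge as often as its weight turns a draw from the list into a draw by weight. *)
Definition slist : seq V := flatten [seq nseq (om x) x | x <- enum V].

Lemma sum_slist (f : V -> rat) : \sum_(x <- slist) f x = \sum_x (om x)%:R * f x.
Proof.
rewrite big_flatten big_map big_enum; apply: eq_bigr => x _.
by rewrite big_nseq iter_addr_0 mulr_natl.
Qed.

Lemma size_slist : size slist = wt om xpredT.
Proof.
rewrite size_flatten /shape -map_comp sumnE big_map big_enum /wt; apply: eq_bigr => x _.
by rewrite /= size_nseq.
Qed.

Definition sample_exp (e : V -> experiment) : experiment :=
  fun k => draw slist (fun ox => (if ox is Some x then e x else no_exp) k).

Lemma sample_expP e p B : (forall x, is_exp w (e x) (p x) B) ->
  is_exp w (sample_exp e) (drawq slist * \sum_x (om x)%:R * p x) B.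
Proof.
move=> h; rewrite -sum_slist.
have -> : drawq slist * \sum_(x <- slist) p x = Ed slist (fun ox => if ox is Some x then p x else 0).
  by rewrite EdE mulr0 addr0.
apply: exp_draw => -[x|]; [exact: h | exact: no_expP].
Qed.

Definition test_exp fuel (prog : V -> rprog n bool) : experiment :=
  sample_exp (fun x => rexp fuel (prog x)).

Definition test_prob fuel prog : rat := drawq slist *
  \sum_x (om x)%:R * ((rcost w (prog x) <= fuel)%N && rrun w (prog x))%:R.

Lemma test_expP fuel prog : is_exp w (test_exp fuel prog) (test_prob fuel prog) (fuel * n).
Proof. by apply: sample_expP => x; apply: rexpP. Qed.

Lemma test_prob_bounds fuel prog (Z : pred V) (c : V -> nat) : (0 < fuel)%N ->
  (forall x, rrun w (prog x) = Z x) -> (forall x, rcost w (prog x) = c x) ->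
  test_prob fuel prog <= drawq slist * (wt om Z)%:R /\
  drawq slist * ((wt om Z)%:R - (\sum_x om x * c x)%N%:R / fuel%:R) <= test_prob fuel prog.
Proof.
move=> f0 hZ hc.
have wtE : (wt om Z)%:R = \sum_x (om x)%:R * (Z x)%:R :> rat.
  rewrite /wt natr_sum big_mkcond; apply: eq_bigr => x _; by case: (Z x); rewrite ?mulr1 ?mulr0.
split.
- rewrite ler_pM2l ?drawq_gt0 // wtE; apply: ler_sum => x _.
  by rewrite ler_wpM2l ?ler0n // hZ ler_nat; case: (Z x); rewrite ?andbF ?leq_b1.
- rewrite ler_pM2l ?drawq_gt0 // wtE natr_sum mulr_suml -sumrB; apply: ler_sum => x _.
  rewrite natrM -mulrA -mulrBr ler_wpM2l ?ler0n // hZ hc; exact: markov_bound.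
Qed.

End Sampling.

Section GreedyExp.
Variables (O : seq V) (net : V -> seq V) (nbr : seq {ffun V -> nat} -> rel V).
Variables (fuel k R : nat).

Definition greedy_exp : experiment := fun kk =>
  draws O k (fun l1 => draws O R (fun l2 => draw O (fun oy =>
    (if oy is Some y then rexp fuel (greedy_prog net nbr l1 l2 y) else no_exp) kk))).

Definition greedy_prob : rat := En O k (fun l1 => En O R (fun l2 => Ed O (fun oy =>
  if oy is Some y then ((rcost w (greedy_prog net nbr l1 l2 y) <= fuel)%N &&
    rrun w (greedy_prog net nbr l1 l2 y))%:R else 0))).

Lemma greedy_expP : is_exp w greedy_exp greedy_prob (fuel * n).
Proof.
apply: exp_draws => l1; apply: exp_draws => l2; apply: exp_draw => -[y|]; [exact: rexpP|exact: no_expP].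
Qed.

Hypothesis uO : uniq O.
Local Notation nb := (nbrel w net nbr).
Hypotheses (nb_sym : symmetric nb) (nb_refl : reflexive nb).
Hypotheses (fuel0 : (0 < fuel)%N) (k0 : (0 < k)%N).
Local Notation q := (drawq O).
Local Notation c := (fun y => size (net y)).

(** Truncation can only lower the probability, so the upper bound is [killed_le]. In the lower bound
    it costs, relative to the average size of a net, [k] for the explicit steps and [1 + R / k] for
    the lazy evaluation of one vertex. *)
Lemma greedy_prob_bounds :
  (forall X : pred V, (forall x y, x \in O -> y \in O -> x != y -> nb x y -> X x || X y) ->
    greedy_prob <= 2%:R * q * (count X O)%:R) /\
  (forall tau eta : rat,
    (forall S : pred V, (forall x y, x \in O -> y \in O -> x != y -> nb x y -> S x || S y) ->
       tau <= (count S O)%:R) ->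
    1 <= eta * (1 + q * R%:R) ->
    q * (tau - eta * (size O)%:R) -
      (k%:R + 1 + R%:R / k%:R) * (q * \sum_(y <- O) (c y)%:R) / fuel%:R <= greedy_prob).
Proof.
pose cost l1 l2 y := rcost w (greedy_prog net nbr l1 l2 y).
pose ki l1 l2 y : rat := (killed xpredT nb (l2 ++ l1) y)%:R.
pose P l1 l2 (oy : option V) : rat :=
  if oy is Some y then ((cost l1 l2 y <= fuel)%N && killed xpredT nb (l2 ++ l1) y)%:R else 0.
have hP : greedy_prob = En O k (fun l1 => En O R (fun l2 => Ed O (P l1 l2))).
  apply: eq_En => l1 _; apply: eq_En => l2 _; apply: eq_Ed => -[y|] //.
  by have [-> _] := greedy_progP l1 l2 y nb_sym.
rewrite hP.
have EP l1 l2 : Ed O (P l1 l2) = q * \sum_(y <- O) P l1 l2 (Some y) by rewrite EdE mulr0 addr0.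
split.
- move=> X vc; have := killed_le nb_sym (R + k)%N vc.
  rewrite En_cat => h; rewrite mulrAC mulrC; apply: le_trans (_ : q * En O k (fun l1 => En O R (fun l2 => \sum_(y <- O) ki l1 l2 y)) <= _).
    rewrite -EnZ; apply: En_le => l1 _; rewrite -EnZ; apply: En_le => l2 _.
    rewrite EP ler_pM2l ?drawq_gt0 //; apply: ler_sum => y _.
    by rewrite ler_nat; case: (killed _ _ _ y); rewrite ?andbF ?leq_b1.
  by rewrite ler_pM2l ?drawq_gt0.
- move=> tau eta hvc heta.
  have heta' : 1 <= eta * (1 + q * (R + k)%:R).
    have e0 : 0 < eta.
      have : 0 < 1 + q * R%:R by rewrite ltr_wpDr // mulr_ge0 // ltW ?drawq_gt0.
      move=> hp; rewrite -(pmulr_lgt0 _ hp); exact: lt_le_trans ltr01 heta.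
    by apply: le_trans heta _; rewrite ler_pM2l // lerD2l ler_pM2l ?drawq_gt0 // ler_nat leq_addr.
  have := killed_ge uO nb_sym nb_refl hvc heta'; rewrite En_cat => hk.
  have hc1 := steps_cost_E O c k; have hc2 := second_phase_cost O c nb_sym R k0.
  set K := En O k _ in hk; set E2 := En O k _ in hc2.
  pose rc l1 l2 y := rec_cost c (alive xpredT nb l1)
    (fun y x => [&& nb y x, alive xpredT nb l1 y & alive xpredT nb l1 x]) l2 y.
  have F0 : 0 < fuel%:R :> rat by rewrite ltr0n.
  have pw l1 l2 : q * \sum_(y <- O) ki l1 l2 y +
     (- (fuel%:R)^-1) * ((steps_cost c l1)%:R + q * \sum_(y <- O) (rc l1 l2 y)%:R) <= Ed O (P l1 l2).
    rewrite EP; apply: le_trans (_ : q * \sum_(y <- O) (ki l1 l2 y - (cost l1 l2 y)%:R / fuel%:R) <= _); last first.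
      by rewrite ler_pM2l ?drawq_gt0 //; apply: ler_sum => y _; apply: markov_bound.
    rewrite sumrB mulrBr lerD2l mulNr lerN2 -mulr_suml mulrA mulrC ler_wpM2l ?invr_ge0 ?ler0n //.
    have -> : \sum_(y <- O) (cost l1 l2 y)%:R = (size O)%:R * (steps_cost c l1)%:R + \sum_(y <- O) (rc l1 l2 y)%:R :> rat.
      rewrite (eq_bigr (fun y => (steps_cost c l1)%:R + (rc l1 l2 y)%:R)); last first.
        by move=> y _; rewrite /cost; have [_ ->] := greedy_progP l1 l2 y nb_sym; rewrite natrD.
      by rewrite big_split /= big_const_seq count_predT iter_addr_0 mulr_natl.
    by rewrite mulrDr lerD2r mulrA ler_piMl ?ler0n ?drawq_size.
  apply: le_trans (_ : En O k (fun l1 => En O R (fun l2 => q * \sum_(y <- O) ki l1 l2 y +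
     (- (fuel%:R)^-1) * ((steps_cost c l1)%:R + q * \sum_(y <- O) (rc l1 l2 y)%:R))) <= _); last first.
    by apply: En_le => l1 _; apply: En_le => l2 _; apply: pw.
  have -> : En O k (fun l1 => En O R (fun l2 => q * \sum_(y <- O) ki l1 l2 y +
     (- (fuel%:R)^-1) * ((steps_cost c l1)%:R + q * \sum_(y <- O) (rc l1 l2 y)%:R))) =
     q * K + (- (fuel%:R)^-1) * (k%:R * (q * \sum_(y <- O) (c y)%:R) + q * E2).
    rewrite -hc1 -!EnZ -EnD -EnZ -EnD; apply: eq_En => l1 _.
    by rewrite EnD EnZ EnZ EnD En_cst EnZ.
  have q0 : 0 < q by apply: drawq_gt0.
  have t1 : q * (tau - eta * (size O)%:R) <= q * K by rewrite ler_pM2l.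
  have t2 : q * E2 <= q * ((1 + R%:R / k%:R) * \sum_(y <- O) (c y)%:R) by rewrite ler_pM2l.
  rewrite mulNr lerB //; rewrite [X in _ <= X]mulrC ler_wpM2l ?invr_ge0 ?ler0n //.
  move: t2; set Y := q * E2; set r := R%:R / _; set z := \sum_(y <- O) _.
  have -> : (k%:R + 1 + r) * (q * z) = k%:R * (q * z) + q * ((1 + r) * z) by ring.
  by move=> h; rewrite lerD2l.
Qed.

End GreedyExp.
End Experiments.

Lemma or_bounds (x y : rat) : 0 <= x <= 1 -> 0 <= y <= 1 ->
  [/\ 0 <= 1 - (1 - x) * (1 - y) <= 1, x <= 1 - (1 - x) * (1 - y),
      y <= 1 - (1 - x) * (1 - y) & 1 - (1 - x) * (1 - y) <= x + y].
Proof.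
move=> /andP[x0 x1] /andP[y0 y1].
have e : 1 - (1 - x) * (1 - y) = x + y - x * y by ring.
have h1 : x * y <= x by rewrite -[X in _ <= X]mulr1 ler_wpM2l.
have h2 : x * y <= y by rewrite mulrC -[X in _ <= X]mulr1 ler_wpM2l.
have h3 : 0 <= x * y by rewrite mulr_ge0.
have h4 : 0 <= (1 - x) * (1 - y) by rewrite mulr_ge0 // subr_ge0.
by rewrite e in h4 *; split; [apply/andP; split|..]; lra.
Qed.

Lemma three_sum (L c : nat) :
  ((19 + 60 * L) * c)%N%:R = (2 * c)%N%:R + (((9 + 60 * L) * c)%N%:R + 8%:R * c%:R) :> rat.
Proof.
have -> : ((19 + 60 * L) * c = 2 * c + ((9 + 60 * L) * c + 8 * c))%N by lia.
by rewrite (natrD _ (2 * c)) (natrD _ (_ * c)) (natrM _ 8).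
Qed.

Lemma scaled_le (a x y : rat) : 0 <= y -> a * x <= 1 -> a * (x * y) <= y.
Proof. by move=> y0 h; rewrite mulrA -[X in _ <= X]mul1r ler_wpM2r. Qed.

Lemma three_cases (M x y z g u v c1 c2 : nat) :
  (M <= 228 * x + 3164 * u + 3164 * y + 112 * g + 3 * v + 420 * c1 + 112 * c2)%N -> (g <= z)%N ->
  (16 * (3164 * u) <= M)%N -> (16 * (3 * v) <= M)%N -> (8 * (420 * c1 + 112 * c2) <= M)%N ->
  [\/ (M <= 4 * 228 * x)%N, (M <= 4 * 3164 * y)%N | (M <= 4 * 228 * z)%N].
Proof.
move=> h1 h2 h3 h4 h5.
have [hx|hx] := leqP M (4 * 228 * x); first by constructor 1.
have [hy|hy] := leqP M (4 * 3164 * y); first by constructor 2.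
constructor 3; lia.
Qed.

Lemma small_loss1 (dl d1 x y z : rat) : 0 <= y -> 1000%:R * (dl * y) <= d1 * y ->
  1000%:R * (d1 * y) <= y -> z <= dl * y -> y <= 4%:R * 228%:R * x -> 2%:R * (dl * y) <= x - z.
Proof. lra. Qed.

Lemma small_loss2 (dl d1 x y z t : rat) : 0 <= y -> 1000%:R * (dl * y) <= d1 * y ->
  1000%:R * (d1 * y) <= y -> t <= dl * y -> z <= dl * y -> y <= 4%:R * 3164%:R * x ->
  2%:R * (dl * y) <= x / 16%:R - z / 8%:R - dl * y - t.
Proof. lra. Qed.

(** * The base experiment, combining the three tests *)

Section BaseExperiment.
Variables (n : nat) (S : nat).
Local Notation V := 'I_n.
Variables (r : V) (par : V -> V) (lv : V -> nat) (om : V -> nat).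
Variables (th rho : nat -> nat) (j0 m b K : nat).
Variables (fL fR fG k R : nat).

Definition active j := (j0 <= j < j0 + m)%N.

Local Notation netj := (net r par lv om th rho).
Local Notation objj := (objs r par lv om th).
Local Notation tp := (top r par lv).

Definition long_prog x : rprog n bool :=
  has_prog (longnet par om b K x)
    (fun p row => [exists q, long_witness r par om (fun _ u => S * row u)%N x p q]).

Definition repl_prog x : rprog n bool := let j := level th (om x) in
  has_prog (replnet r par lv om th rho active x)
    (fun a row => few_children r par lv om th j (tp (bigE om (th j)) (par x)) &&
      [exists v, repl_witness r par lv om (fun _ u => S * row u)%N (th j) (th j.+1) (rho j) x a v]).

Definition conf_row j (rows : seq {ffun V -> nat}) : rel V := fun y x => (y == x) ||
  [&& tp (bigE om (th j.+1)) y == tp (bigE om (th j.+1)) x,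
      tp (bigE om (th j)) (par y) != x, tp (bigE om (th j)) (par x) != y &
      has (fun row : {ffun V -> nat} => has (fun c => S * row c <= th j.+1 + 2 * rho j)%N (netj j x)) rows].

(** The edge drawn serves only to select a level with probability proportional to its weight; the
    greedy process then runs on all objects of that level. *)
Definition conf_exp := sample_exp om (fun x => let j := level th (om x) in
  if active j then greedy_exp (objj j) (netj j) (conf_row j) fG k R else @no_exp n).

Definition base_exp := exp_or (test_exp om fL long_prog) (exp_or (test_exp om fR repl_prog) conf_exp).

Variable w : V -> V -> nat.
Let sw u v := (S * w u v)%N.
Hypothesis rtd : rooted r par lv.
Hypothesis om_r : om r = 0%N.
Hypothesis wC : forall u v, sw u v = sw v u.
Hypothesis wT : forall u v x, (sw u x <= sw u v + sw v x)%N.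
Hypothesis cut : forall x u v, sep par x u v -> (om x <= sw u v)%N.
Hypothesis wD : forall u v, (sw u v <= dist par om xpredT u v)%N.
Hypothesis thS : forall j, (th j < th j.+1)%N.
Hypothesis th_big : forall j, (64 * 100 <= th j)%N.
Hypothesis th_ratio : forall j, (99 * th j.+1 <= 100 * th j)%N.
Variable Lam : nat.
Hypothesis th_geo : forall m a, (th m <= a)%N -> (\sum_(j < m.+1) th j.+1 <= Lam * a)%N.
Hypothesis th0 : forall x, x != r -> (th 0 <= om x)%N.
Hypothesis rho_pos : forall j, (0 < rho j)%N.
Hypothesis rho_le : forall j, (64 * rho j <= th j)%N.
Hypothesis th_rho : forall j, (th j.+1 <= 256 * rho j)%N.
Hypotheses (fL0 : (0 < fL)%N) (fR0 : (0 < fR)%N) (fG0 : (0 < fG)%N) (k0 : (0 < k)%N) (b0 : (0 < b)%N).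

Local Notation M := (wt om xpredT).
Local Notation Q := (drawq (slist om)).
Local Notation lvlj j := (lvl om (th j) (th j.+1)).

Let th_two j : (th j.+1 <= 2 * th j)%N. Proof. have := th_ratio j; have := th_big j; lia. Qed.
Let th_pos j : (0 < th j)%N. Proof. have := th_big j; lia. Qed.

Lemma long_progP x : rrun w (long_prog x) = Ltest r par om sw b K x /\
  rcost w (long_prog x) = size (longnet par om b K x).
Proof.
split; last exact: rcost_has.
rewrite rrun_has; apply: eq_has => p; apply: eq_existsb => q.
by rewrite /long_witness ffunE.
Qed.

Lemma repl_progP x : rrun w (repl_prog x) = IItest r par lv om sw th rho active x /\
  rcost w (repl_prog x) = size (replnet r par lv om th rho active x).
Proof.
split; last exact: rcost_has.
rewrite rrun_has /IItest /replnet; case: (active _) => //=.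
set F := few_children _ _ _ _ _ _ _; case: F => /=; last by rewrite has_pred0.
by apply: eq_has => a; apply: eq_existsb => v; rewrite /repl_witness ffunE.
Qed.

Lemma nbrel_conf j y x : nbrel w (netj j) (conf_row j) y x = conf r par lv om sw th rho j y x.
Proof.
rewrite /nbrel /conf_row /conf has_map; do 4!congr (_ || _) || congr (_ && _).
by apply: eq_has => a /=; apply: eq_has => c; rewrite ffunE.
Qed.

Lemma nbrel_sym j : symmetric (nbrel w (netj j) (conf_row j)).
Proof. by move=> x y; rewrite !nbrel_conf conf_sym. Qed.

Lemma nbrel_refl j : reflexive (nbrel w (netj j) (conf_row j)).
Proof. by move=> x; rewrite nbrel_conf conf_refl. Qed.

Definition gprob j := greedy_prob w (objj j) (netj j) (conf_row j) fG k R.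
Let s := index_iota j0 (j0 + m).

Lemma level_group (g : nat -> rat) :
  \sum_x (om x)%:R * (if active (level th (om x)) then g (level th (om x)) else 0) =
  \sum_(j <- s) (wt om (lvlj j))%:R * g j.
Proof.
under [RHS]eq_bigr => j _ do rewrite /wt natr_sum big_mkcond mulr_suml.
rewrite exchange_big /=; apply: eq_bigr => x _.
have [->|xr] := eqVneq x r.
  by rewrite om_r mul0r big1 // => j _; case: ifP; rewrite mul0r.
have hl : lvlj (level th (om x)) x := level_bounds thS (th0 xr).
case: ifP => ha.
  rewrite (bigD1_seq (level th (om x))) /= ?mem_index_iota ?iota_uniq // hl.
  rewrite big1 ?addr0 // => j /negP hj; case: ifP => [/(level_uniq thS) e|]; last by rewrite mul0r.
  by case: hj; rewrite e.
rewrite mulr0 big_seq big1 // => j hj; case: ifP => [/(level_uniq thS) e|]; last by rewrite mul0r.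
by move: ha; rewrite e /active -mem_index_iota hj.
Qed.

Definition pconf := Q * \sum_(j <- s) (wt om (lvlj j))%:R * gprob j.

Lemma conf_expP : is_exp w conf_exp pconf (fG * n).
Proof.
rewrite /pconf -level_group; apply: sample_expP => x; cbv zeta; case: (active _).
  exact: greedy_expP.
exact: no_expP.
Qed.

Let us : uniq s. Proof. exact: iota_uniq. Qed.

Lemma wt_lvl_le j : (wt om (lvlj j) <= th j.+1 * #|lvlset om th j|)%N.
Proof.
rewrite mulnC -sum_nat_const /wt [X in (X <= _)%N]big_mkcond [X in (_ <= X)%N]big_mkcond /=.
by apply: leq_sum => x _; rewrite inE; case: ifP => // /andP[_ /ltnW].
Qed.

Lemma wt_lvl_ge j : (th j * #|lvlset om th j| <= wt om (lvlj j))%N.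
Proof.
rewrite mulnC -sum_nat_const /wt [X in (X <= _)%N]big_mkcond [X in (_ <= X)%N]big_mkcond /=.
by apply: leq_sum => x _; rewrite inE; case: ifP => // /andP[].
Qed.

Lemma lvlset_draw j : #|lvlset om th j|%:R * drawq (objj j) <= 1.
Proof.
apply: le_trans (drawq_size (objj j)); rewrite mulrC ler_pM2l ?drawq_gt0 // ler_nat.
by have /andP[] := objs_size r par lv om th j.
Qed.

(** The 8 is made of 2 from [killed_le], 2 from [coverX_count] and 2 from [level_sum]. *)
Lemma pconf_le (C : {set V}) :
  (forall u v, 100 * dist par om (fun x => x \notin C) u v <= 101 * sw u v)%N ->
  pconf <= Q * (8%:R * (wt om (fun x => x \in C))%:R).
Proof.
move=> cutC; rewrite /pconf ler_pM2l ?drawq_gt0 //.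
have h j : (wt om (lvlj j))%:R * gprob j <=
    (4 * (th j.+1 * #|[pred x | lvlj j x && (x \in C)]|))%N%:R.
  have [hb _] := greedy_prob_bounds R (objs_uniq r par lv om th j) (@nbrel_sym j) (@nbrel_refl j) fG0 k0.
  have /hb h1 : forall x y, x \in objj j -> y \in objj j -> x != y ->
     nbrel w (netj j) (conf_row j) x y ->
     coverX r par lv om C (th j) (th j.+1) x || coverX r par lv om C (th j) (th j.+1) y.
    by move=> x y xO yO xy; rewrite nbrel_conf; apply: (conf_cover rtd thS cutC).
  have h2 : (count (coverX r par lv om C (th j) (th j.+1)) (objj j) <= 2 * #|[pred x | lvlj j x && (x \in C)]|)%N.
    apply: leq_trans (coverX_count _ _ _ _ C th j (objs_uniq r par lv om th j)) _.
    by rewrite leq_mul2l /= leq_eqVlt; apply/orP; left; apply/eqP; apply: eq_card => x; rewrite !inE andbC.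
  have q0 := drawq_gt0 (objj j); have q1 := lvlset_draw j.
  have h3 : gprob j <= 4%:R * drawq (objj j) * #|[pred x | lvlj j x && (x \in C)]|%:R.
    apply: le_trans h1 _; rewrite -(ler_nat rat) natrM in h2.
    have -> : 4%:R = 2%:R * 2%:R :> rat by ring.
    by rewrite -!mulrA ler_pM2l // mulrCA ler_pM2l // mulrC mulrA -mulrA.
  have h4 := wt_lvl_le j; rewrite -(ler_nat rat) natrM in h4.
  rewrite natrM natrM.
  set c := #|_|%:R in h3 *; set g := gprob j in h3 *; set W := (wt _ _)%:R in h4 *.
  set B := #|_|%:R in q1 h4; set T := (th j.+1)%:R in h4 *; set q := drawq _ in q0 q1 h3.
  have c0 : 0 <= c by apply: ler0n. have T0 : 0 <= T by apply: ler0n.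
  have W0 : 0 <= W by apply: ler0n.
  apply: le_trans (ler_wpM2l W0 h3) _.
  apply: le_trans (_ : T * B * (4%:R * q * c) <= _).
    by apply: ler_wpM2r h4; rewrite !mulr_ge0 // ltW.
  have -> : T * B * (4%:R * q * c) = 4%:R * (T * c) * (B * q) by ring.
  by rewrite -[X in _ <= X]mulr1 ler_wpM2l // !mulr_ge0.
apply: le_trans (ler_sum _ (fun j _ => h j)) _.
rewrite -natr_sum -natrM ler_nat -big_distrr /= (_ : 8 = 4 * 2)%N // -mulnA leq_mul2l /=.
apply: leq_trans (level_sum om thS th_two (fun _ x => x \in C) us) _; rewrite leq_mul2l /= /wt.
rewrite [X in (X <= _)%N]big_mkcond [X in (_ <= X)%N]big_mkcond; apply: leq_sum => x _.
by case: (boolP (x \in C)) => hx; case: ifP => // /hasP[j _]; rewrite andbF.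
Qed.

(** The 16 collects four factors 2: the one in the hypothesis on [t], the padding of the draw, the
    number of objects per edge of the level, and the ratio of consecutive thresholds. *)
Lemma gprob_ge j (t : nat) (eta : rat) :
  (forall X : pred V, (forall x y, x \in objj j -> y \in objj j -> x != y ->
      conf r par lv om sw th rho j x y -> X x || X y) -> (t <= 2 * count X (objj j))%N) ->
  1 <= eta * (1 + drawq (objj j) * R%:R) ->
  (th j.+1 * t)%N%:R / 16%:R - eta * (wt om (lvlj j))%:R -
    (k%:R + 1 + R%:R / k%:R) / fG%:R * (2 * (th j.+1 * #|lvlset om th j|) + 256 * M)%N%:R <=
  (wt om (lvlj j))%:R * gprob j.
Proof.
move=> ht heta.
have [_ hb] := greedy_prob_bounds R (objs_uniq r par lv om th j) (@nbrel_sym j) (@nbrel_refl j) fG0 k0.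
have {}hb := hb (t%:R / 2%:R) eta.
have {}hb : drawq (objj j) * (t%:R / 2%:R - eta * (size (objj j))%:R) -
   (k%:R + 1 + R%:R / k%:R) * (drawq (objj j) * \sum_(y <- objj j) (size (netj j y))%:R) / fG%:R <= gprob j.
  apply: hb => // X hX; rewrite ler_pdivrMr // -natrM ler_nat mulnC; apply: ht => x y xO yO xy.
  by rewrite -nbrel_conf; apply: hX.
have hT0 : (th j.+1)%:R <= 2%:R * (th j)%:R :> rat by rewrite -natrM ler_nat.
have hN := objs_size r par lv om th j.
have q0 := drawq_gt0 (objj j); have q1 := lvlset_draw j; have q2 := drawq_size (objj j).
have hw1 := wt_lvl_le j; have hw2 := wt_lvl_ge j.
have hn := net_weight om rtd rho_pos th_rho j (objs_uniq r par lv om th j).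
have hsum : (th j.+1 * \sum_(y <- objj j) size (netj j y) <= 2 * (th j.+1 * #|lvlset om th j|) + 256 * M)%N.
  apply: leq_trans hn _; rewrite leq_add2r mulnCA leq_mul2l; case/andP: hN => _ ->; by rewrite orbT.
have main : (th j.+1 * t)%N%:R / 16%:R <= (wt om (lvlj j))%:R * (drawq (objj j) * (t%:R / 2%:R)).
  case: (posnP (size (objj j))) => [z|Npos].
    have e : objj j = [::] by apply/nilP; rewrite /nilp z.
    have /ht : forall x y, x \in objj j -> y \in objj j -> x != y -> conf r par lv om sw th rho j x y -> xpred0 x || xpred0 y.
      by rewrite e.
    by rewrite e /= leqn0 => /eqP ->; rewrite muln0 !mul0r !mulr0.
  have hq := drawq_size_lb Npos.
  have hw : (th j)%:R * (size (objj j))%:R <= 2%:R * (wt om (lvlj j))%:R :> rat.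
    rewrite -!natrM ler_nat; case/andP: hN => _ hN'.
    apply: leq_trans (leq_mul (leqnn _) hN') _; by rewrite mulnCA leq_mul2l hw2.
  have h4 : (th j)%:R <= 4%:R * ((wt om (lvlj j))%:R * drawq (objj j)).
    have hm := ler_wpM2l (ler0n rat (th j)) hq; have hm' := ler_wpM2r (ltW q0) hw; rewrite mulr1 in hm.
    apply: le_trans hm _.
    have -> : (th j)%:R * (2%:R * drawq (objj j) * (size (objj j))%:R) =
       2%:R * ((th j)%:R * (size (objj j))%:R * drawq (objj j)) by ring.
    have -> : 4%:R * ((wt om (lvlj j))%:R * drawq (objj j)) = 2%:R * (2%:R * (wt om (lvlj j))%:R * drawq (objj j)) by ring.
    by rewrite ler_pM2l.
  rewrite natrM; have t0 : 0 <= t%:R :> rat by apply: ler0n.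
  have := ler_wpM2r t0 hT0; have := ler_wpM2r t0 h4.
  move: (t%:R) (drawq _) ((wt _ _)%:R) ((th j)%:R) ((th j.+1)%:R) => /= t' q W T T' a1 a2.
  rewrite ler_pdivrMr //; have -> : W * (q * (t' / 2%:R)) * 16%:R = 2%:R * (4%:R * (W * q) * t') by field.
  by apply: le_trans a2 _; rewrite -[2 * T * t']mulrA ler_pM2l.
have W0 : 0 <= (wt om (lvlj j))%:R :> rat by apply: ler0n.
apply: le_trans (ler_wpM2l W0 hb); rewrite mulrBr.
have e1 : eta * (wt om (lvlj j))%:R >= (wt om (lvlj j))%:R * (drawq (objj j) * (eta * (size (objj j))%:R)).
  have e0 : 0 <= eta.
    have hp : 0 < 1 + drawq (objj j) * R%:R by rewrite ltr_wpDr // mulr_ge0 // ltW.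
    rewrite ltW // -(pmulr_lgt0 _ hp); exact: lt_le_trans ltr01 heta.
  have -> : (wt om (lvlj j))%:R * (drawq (objj j) * (eta * (size (objj j))%:R)) =
     eta * (wt om (lvlj j))%:R * (drawq (objj j) * (size (objj j))%:R) by ring.
  by rewrite -[X in _ <= X]mulr1 ler_wpM2l // mulr_ge0.
have e2 : (wt om (lvlj j))%:R * ((k%:R + 1 + R%:R / k%:R) * (drawq (objj j) * \sum_(y <- objj j) (size (netj j y))%:R) / fG%:R) <=
   (k%:R + 1 + R%:R / k%:R) / fG%:R * (2 * (th j.+1 * #|lvlset om th j|) + 256 * M)%N%:R.
  have A0 : 0 <= (k%:R + 1 + R%:R / k%:R) / fG%:R :> rat by rewrite mulr_ge0 ?invr_ge0 // !addr_ge0 // divr_ge0.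
  have -> : (wt om (lvlj j))%:R * ((k%:R + 1 + R%:R / k%:R) * (drawq (objj j) * \sum_(y <- objj j) (size (netj j y))%:R) / fG%:R) =
    (k%:R + 1 + R%:R / k%:R) / fG%:R * ((wt om (lvlj j))%:R * drawq (objj j) * \sum_(y <- objj j) (size (netj j y))%:R) by ring.
  apply: ler_wpM2l => //.
  rewrite -(ler_nat rat) natrM natr_sum in hsum; apply: le_trans hsum; apply: ler_wpM2r; first by rewrite sumr_ge0.
  rewrite -(ler_nat rat) natrM in hw1; apply: le_trans (ler_wpM2r (ltW q0) hw1) _.
  by rewrite -mulrA -[X in _ <= X]mulr1 ler_wpM2l.
rewrite (mulrBr (drawq _)) mulrBr; apply: lerB => //; apply: lerB => //.
Qed.

Definition plong := test_prob w om fL long_prog.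
Definition prepl := test_prob w om fR repl_prog.
Definition pbase := 1 - (1 - plong) * (1 - (1 - (1 - prepl) * (1 - pconf))).

Lemma base_expP : is_exp w base_exp pbase ((fL + fR + fG) * n).
Proof.
rewrite !mulnDl -addnA; apply: exp_orP; first exact: test_expP.
by apply: exp_orP; [exact: test_expP | exact: conf_expP].
Qed.

Let plong01 : 0 <= plong <= 1. Proof. by have [] := test_expP w om fL long_prog. Qed.
Let prepl01 : 0 <= prepl <= 1. Proof. by have [] := test_expP w om fR repl_prog. Qed.
Let pconf01 : 0 <= pconf <= 1. Proof. by have [] := conf_expP. Qed.

Theorem pbase_le (C : {set V}) :
  (forall u v, 100 * dist par om (fun x => x \notin C) u v <= 101 * sw u v)%N ->
  pbase <= Q * (((19 + 60 * Lam) * wt om (fun x => x \in C))%N)%:R.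
Proof.
move=> cutC; have h3 := pconf_le cutC.
have [h1 _] := test_prob_bounds om fL0 (fun x => (long_progP x).1) (fun x => (long_progP x).2).
have [h2 _] := test_prob_bounds om fR0 (fun x => (repl_progP x).1) (fun x => (repl_progP x).2).
have s1 : (wt om (Ltest r par om sw b K) <= 2 * wt om (fun x => x \in C))%N.
  by apply: (long_sound rtd cutC) => x /hasP[p _ /existsP[q hq]]; exists p, q.
have s2 : (wt om (IItest r par lv om sw th rho active) <= (9 + 60 * Lam) * wt om (fun x => x \in C))%N.
  apply: (replace_sound rtd cutC thS th_big th_ratio th_geo rho_le) => x /and3P[_ fc /hasP[p _ /existsP[v hv]]].
  by exists (level th (om x)), p, v.
rewrite -(ler_nat rat) in s1; rewrite -(ler_nat rat) in s2.
have Q0 := drawq_gt0 (slist om).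
have {}h1 := le_trans h1 (ler_wpM2l (ltW Q0) s1); have {}h2 := le_trans h2 (ler_wpM2l (ltW Q0) s2).
rewrite three_sum !mulrDr.
rewrite -/plong in h1; rewrite -/prepl in h2; rewrite /pbase.
have [b1 _ _ b2] := or_bounds prepl01 pconf01; have [_ _ _ b3] := or_bounds plong01 b1.
apply: le_trans b3 (lerD h1 _); exact: le_trans b2 (lerD h2 h3).
Qed.

Section Completeness.
Variables (I : finType) (a b' : I -> V) (wmin J : nat).
Hypothesis cyc : forall X : pred V, (exists u, X u) -> (exists v, ~~ X v) ->
  exists i, X (a i) && ~~ X (b' i).
Hypothesis act_ok : forall t, (th 0 <= t)%N -> (wmin <= t)%N -> (t <= M)%N -> active (level th t).
Hypothesis sJ : (j0 + m <= J)%N.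
Hypothesis levJ : forall i, (hop_level sw a b' th i < J)%N.
Local Notation Wm := (Wmulti r par lv om sw a b' th wmin).
Local Notation ch1 := (chi1 om sw a b' th J).

Lemma sum_active (F : nat -> nat) : (\sum_(j < J | active j) F j = \sum_(j <- s) F j)%N.
Proof.
rewrite -(big_mkord active F) /s [RHS](@big_nat_widen _ _ _ _ _ J) // [RHS](@big_nat_widenl _ _ _ _ 0) //.
by apply: eq_bigl => j; rewrite andTb andbC.
Qed.

Lemma pconf_ge (eta : rat) : (forall j, 1 <= eta * (1 + drawq (objj j) * R%:R)) ->
  Q * (Wm%:R / 16%:R - ch1%:R / 8%:R - eta * M%:R -
    (k%:R + 1 + R%:R / k%:R) / fG%:R * ((4 + 256 * m) * M)%N%:R) <= pconf.
Proof.
move=> heta; rewrite /pconf ler_pM2l ?drawq_gt0 //.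
pose mu j := #|[pred i | (~~ low_hop sw a b' wmin i && hmulti r par lv om sw a b' th i) && (hop_level sw a b' th i == j)]|.
pose Xj j := excess om sw a b' (th j); pose t j := (mu j - 2 * Xj j)%N.
have ht j : forall X : pred V, (forall x y, x \in objj j -> y \in objj j -> x != y ->
      conf r par lv om sw th rho j x y -> X x || X y) -> (t j <= 2 * count X (objj j))%N.
  move=> X vc; have := multi_bound rtd om_r wC wT cut wD wmin thS th_pos th0 rho_pos cyc vc.
  by rewrite -/(mu j) -/(Xj j) /t => h; rewrite leq_subLR addnC.
apply: le_trans (ler_sum _ (fun j _ => gprob_ge (ht j) (heta j))); rewrite !sumrB -mulr_suml -!mulr_sumr -!natr_sum.
have g1 : Wm%:R / 16%:R - ch1%:R / 8%:R <= (\sum_(j <- s) th j.+1 * t j)%N%:R / 16%:R :> rat.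
  have h1 : (Wm <= \sum_(j <- s) th j.+1 * mu j)%N.
    by rewrite -sum_active; apply: (Wmulti_bound rtd cut wD thS th0 act_ok levJ).
  have h2 : (\sum_(j <- s) th j.+1 * Xj j <= ch1)%N.
    by rewrite -sum_active big_mkcond; apply: leq_sum => j _; case: ifP.
  have h3 : (Wm <= (\sum_(j <- s) th j.+1 * t j) + 2 * ch1)%N.
    apply: leq_trans h1 _; apply: leq_trans (leq_add (leqnn _) (leq_mul (leqnn 2) h2)).
    rewrite big_distrr -big_split /=; apply: leq_sum => j _.
    by rewrite mulnCA -mulnDr leq_mul2l; apply/orP; right; rewrite /t; lia.
  rewrite -(ler_nat rat) natrD natrM in h3; lra.
have g2 : eta * (\sum_(j <- s) wt om (lvlj j))%N%:R <= eta * M%:R.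
  have e0 : 0 <= eta.
    have hp : 0 < 1 + drawq (objj 0) * R%:R by rewrite ltr_wpDr // mulr_ge0 // ltW ?drawq_gt0.
    rewrite ltW // -(pmulr_lgt0 _ hp); exact: lt_le_trans ltr01 (heta 0%N).
  apply: ler_wpM2l => //; have := level_group (fun=> 1); rewrite natr_sum.
  under [X in _ = X]eq_bigr => j _ do rewrite mulr1.
  move=> <-; rewrite /wt natr_sum; apply: ler_sum => x _.
  by case: ifP => _; rewrite ?mulr1 ?mulr0 ?ler0n.
have g3 : (k%:R + 1 + R%:R / k%:R) / fG%:R * (\sum_(j <- s) (2 * (th j.+1 * #|lvlset om th j|) + 256 * M))%N%:R <=
    (k%:R + 1 + R%:R / k%:R) / fG%:R * ((4 + 256 * m) * M)%N%:R :> rat.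
  have A0 : 0 <= (k%:R + 1 + R%:R / k%:R) / fG%:R :> rat by rewrite mulr_ge0 ?invr_ge0 // !addr_ge0 // divr_ge0.
  apply: ler_wpM2l => //; rewrite ler_nat big_split /= -big_distrr /= sum_nat_const_nat addKn mulnDl.
  apply: leq_add; last by rewrite mulnCA mulnA.
  rewrite (_ : 4 = 2 * 2)%N // -mulnA leq_mul2l /=.
  have := level_sum om thS th_two (fun _ => predT) us => h.
  apply: leq_trans (leq_trans _ h) _.
    apply: leq_sum => j _; rewrite leq_mul2l; apply/orP; right; apply: subset_leq_card.
    by apply/subsetP => x; rewrite !inE => ->.
  by rewrite leq_mul2l /= /wt big_mkcond; apply: leq_sum => x _; case: ifP.
by apply: lerB => //; apply: lerB.
Qed.

Hypothesis b_small : forall x D, x != r -> (6 * om x <= D)%N -> (6 * wmin <= D)%N -> (16 * b <= D)%N.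
Hypothesis K_big : (M < 16 * b * 2 ^ K)%N.
Hypothesis levJ' : forall x, (level th (om x) < J)%N.

(** By [three_cases] one of the terms for long, multi and replaceable edges in [accounting] is a
    constant fraction of M, and the corresponding test alone succeeds with probability at least [dl]
    after all truncation losses. The smallness of [dl] is expressed through [d1] in two steps of
    1000. *)
Theorem pbase_ge dM (dl d1 : rat) : (0 < M)%N ->
  (\sum_i hop_len sw a b' i <= M + dM)%N ->
  0 < dl ->
  (16 * (3164 * (#|I| * wmin)) <= M)%N -> (16 * (3 * dM) <= M)%N ->
  (8 * (420 * ch1 + 112 * chi2 om sw a b' th J) <= M)%N ->
  ch1%:R <= dl * M%:R ->
  (forall j, 1 <= dl * (1 + drawq (objj j) * R%:R)) ->
  (48 * K)%N%:R <= dl * fL%:R -> (2 + 256 * m)%N%:R <= dl * fR%:R ->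
  (k%:R + 1 + R%:R / k%:R) * (4 + 256 * m)%N%:R <= dl * fG%:R ->
  1000%:R * dl <= d1 -> 1000%:R * d1 <= 1 ->
  dl <= pbase.
Proof.
move=> M0 hd dl0 c1 c2 c3 c4 c5 c6 c7 c8.
have HL := Ltest_complete rtd om_r wT cut wD b0 b_small K_big.
have acc := accounting rtd om_r wC cut wD cyc thS th_pos th_two th0 HL levJ levJ' hd.
have pc := pconf_ge c5.
have [_ h1] := test_prob_bounds om fL0 (fun x => (long_progP x).1) (fun x => (long_progP x).2).
have [_ h2] := test_prob_bounds om fR0 (fun x => (repl_progP x).1) (fun x => (repl_progP x).2).
have l1 := longnet_cost rtd om_r b0 K_big.
have hact j : active j -> (j0 <= j < j0 + m)%N by [].
have l2 := replnet_cost rtd om_r thS th_two th0 rho_pos th_rho hact.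
set wL := wt om (Ltest _ _ _ _ _ _) in h1 acc; set wII := wt om (IItest _ _ _ _ _ _ _ _) in h2.
set wG := wt om (fun x => IIgood _ _ _ _ _ _ _ _ _ _ _ _) in acc.
have hG : (wG <= wII)%N.
  rewrite /wG /wII /wt [X in (X <= _)%N]big_mkcond [X in (_ <= X)%N]big_mkcond; apply: leq_sum => x _.
  case: ifP => [h|_]; last exact: leq0n.
  by rewrite (IIgood_test rtd wC wT cut wD thS th0 rho_pos act_ok h).
have Q0 := drawq_gt0 (slist om).
have QM : 1 <= 2%:R * Q * M%:R by rewrite -size_slist; apply: drawq_size_lb; rewrite size_slist.
have scale z : 2%:R * (dl * M%:R) <= z -> dl <= Q * z.
  move=> hz; apply: le_trans (ler_wpM2l (ltW Q0) hz).
  have -> : Q * (2%:R * (dl * M%:R)) = dl * (2%:R * Q * M%:R) by ring.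
  by rewrite -[X in X <= _]mulr1 ler_pM2l.
have [b1 b2 b3 _] := or_bounds prepl01 pconf01; have [_ b4 b5 _] := or_bounds plong01 b1.
rewrite -/pbase in b4 b5; rewrite -/plong in h1; rewrite -/prepl in h2.
have frac (c F : nat) : (0 < F)%N -> c%:R <= dl * F%:R -> (c * M)%N%:R / F%:R <= dl * M%:R.
  by move=> F0 h; rewrite ler_pdivrMr ?ltr0n // natrM mulrAC ler_wpM2r.
have e1 : (\sum_x om x * size (longnet par om b K x))%N%:R / fL%:R <= dl * M%:R.
  by apply: le_trans (frac _ _ fL0 c6); rewrite ler_pM2r ?invr_gt0 ?ltr0n // ler_nat.
have e2 : (\sum_x om x * size (replnet r par lv om th rho active x))%N%:R / fR%:R <= dl * M%:R.
  by apply: le_trans (frac _ _ fR0 c7); rewrite ler_pM2r ?invr_gt0 ?ltr0n // ler_nat.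
have e3 : (k%:R + 1 + R%:R / k%:R) / fG%:R * ((4 + 256 * m) * M)%N%:R <= dl * M%:R.
  rewrite natrM [X in X <= _](_ : _ = (k%:R + 1 + R%:R / k%:R) * (4 + 256 * m)%:R / fG%:R * M%:R); last by ring.
  by apply: ler_wpM2r => //; rewrite ler_pdivrMr ?ltr0n.
have : [\/ (M <= 4 * 228 * wL)%N, (M <= 4 * 3164 * Wm)%N | (M <= 4 * 228 * wII)%N].
  exact: (three_cases acc hG c1 c2 c3).
move=> cases dl1 dl2.
have uM1 : 1000%:R * (dl * M%:R) <= d1 * M%:R.
  by rewrite mulrA; exact: ler_wpM2r (ler0n _ _) _ _ dl1.
have uM2 := scaled_le (ler0n _ M) dl2.
have uM0 : 0 <= M%:R :> rat := ler0n _ _.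
case: cases => h; rewrite -(ler_nat rat) !natrM in h.
- apply: le_trans b4; apply: le_trans h1; apply: scale; exact: (small_loss1 uM0 uM1 uM2 e1 h).
- apply: le_trans b5; apply: le_trans b3; apply: le_trans pc; apply: scale.
  exact: (small_loss2 uM0 uM1 uM2 e3 c4 h).
- apply: le_trans b5; apply: le_trans b2; apply: le_trans h2; apply: scale.
  exact: (small_loss1 uM0 uM1 uM2 e2 h).
Qed.

End Completeness.

End BaseExperiment.

Local Open Scope nat_scope.

Lemma iter_ordS n (i : 'I_n) k : iter k (@ordS n) i = (i + k) %% n :> nat.
Proof.
elim: k => [|k IH]; first by rewrite addn0 modn_small.
by rewrite iterS /= IH addnS -addn1 -[in RHS]addn1 modnDml.
Qed.

Lemma tour_cyc n (p : {perm 'I_n}) (S : pred 'I_n) : (exists u, S u) -> (exists v, ~~ S v) ->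
  exists i, S (p i) && ~~ S (p (ordS i)).
Proof.
move=> [u Su] [v nv]; apply/existsP; apply: contraNT nv => /existsPn h.
have step i : S (p i) -> S (p (ordS i)) by have := h i; case: (S (p i)) => //=; rewrite negbK.
pose i := (p^-1)%g u; pose j := (p^-1)%g v.
have hk k : S (p (iter k (@ordS n) i)) by elim: k => [|k IH]; [rewrite /= permKV | apply: step].
have e : iter (n - i + j) (@ordS n) i = j.
  apply: val_inj; rewrite /= iter_ordS addnA subnKC ?modnDl ?modn_small //; exact: ltnW.
by have := hk (n - i + j); rewrite e permKV.
Qed.

Lemma best_tour n (w : 'I_n -> 'I_n -> nat) : exists p, TSP w = tour_cost w p.
Proof. by exists [arg min_(p < (1%g : {perm 'I_n})) tour_cost w p]. Qed.

Lemma level_le th a : level th a <= a.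
Proof. by rewrite /level; apply/bigmax_leqP => j _; rewrite -ltnS. Qed.

Lemma level_mono th a b : (forall j, th j < th j.+1) -> th 0 <= b -> a <= b -> level th a <= level th b.
Proof.
move=> thS b0 ab; have /andP[_ h2] := level_bounds thS b0.
rewrite /level; apply/bigmax_leqP => j hj; rewrite -ltnS; apply: (th_lt_inv thS).
exact: leq_ltn_trans (leq_trans hj ab) h2.
Qed.

Lemma level_lt th a : (forall j, th j < th j.+1) -> a < th (level th a).+1.
Proof.
move=> thS; have [h|h] := leqP (th 0) a; first by case/andP: (level_bounds thS h).
by apply: leq_trans h _; apply: (th_mono thS).
Qed.

Lemma dist_scale (V : finType) (par : V -> V) om S U u v :
  dist par (fun x => S * om x) U u v = S * dist par om U u v.
Proof. by rewrite /dist big_distrr /=; apply: eq_bigr => x _; rewrite mulnA. Qed.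

Lemma wt_scale (V : finType) (om : V -> nat) S U : wt (fun x => S * om x) U = S * wt om U.
Proof. by rewrite /wt big_distrr. Qed.

Lemma dist_ext (V : finType) (par : V -> V) om om' U u v : om =1 om' ->
  dist par om U u v = dist par om' U u v.
Proof. by move=> e; apply: eq_bigr => x _; rewrite e. Qed.

Lemma wt_ext (V : finType) (om om' : V -> nat) U : om =1 om' -> wt om U = wt om' U.
Proof. by move=> e; apply: eq_bigr => x _; rewrite e. Qed.

Lemma drawq_lb n (O : seq 'I_n) : 0 < n -> uniq O -> (1 <= 2%:R * drawq O * n%:R)%R.
Proof.
move=> n0 uO; case: (posnP (size O)) => [z|O0].
  have -> : O = [::] by apply/nilP; rewrite /nilp z.
  rewrite /drawq /drawk /= up_log0 expn0 invr1 mulr1 -natrM ler1n; lia.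
apply: le_trans (drawq_size_lb O0) _.
apply: ler_wpM2l; first by rewrite mulr_ge0 // ltW ?drawq_gt0.
by rewrite ler_nat -[X in _ <= X](card_ord n) -(card_uniqP uO) max_card.
Qed.

Lemma threshold_arith (dl : rat) (q R N dM g M : nat) : (0 < dl)%R ->
  (16%:R * q%:R <= dl * N%:R)%R -> (8%:R <= dl * R%:R)%R ->
  (R%:R * g%:R <= 2%:R * M%:R :> rat)%R -> (N%:R * dM%:R <= M%:R :> rat)%R ->
  (2%:R * (4 * q * dM + g)%N%:R <= dl * M%:R)%R.
Proof.
move=> dl0 h1 h2 h3 h4; rewrite natrD !natrM.
have e1 := ler_wpM2r (ler0n rat dM) h1; have e2 := ler_wpM2r (ler0n rat g) h2.
have e3 := ler_wpM2l (ltW dl0) h3; have e4 := ler_wpM2l (ltW dl0) h4.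
rewrite -mulrA in e1; rewrite -[X in (_ <= X)%R]mulrA in e1; rewrite -[X in (_ <= X)%R]mulrA in e2.
have f1 := le_trans e1 e4; have f2 := le_trans e2 e3.
rewrite mulrCA in f2; rewrite -[(4%:R * q%:R * dM%:R)%R]mulrA.
move: (q%:R * dM%:R)%R (g%:R)%R (dl * M%:R)%R f1 f2 => x y z; lra.
Qed.

Lemma draws_arith (dl x : rat) (D n : nat) : (0 < dl)%R -> (1 <= dl * D%:R)%R -> (0 < x)%R ->
  (1 <= 2%:R * x * n%:R)%R -> (1 <= dl * (1 + x * (2%:R * D%:R * n%:R)))%R.
Proof.
move=> dl0 h1 x0 h2; apply: le_trans h1 _.
have -> : (x * (2%:R * D%:R * n%:R) = D%:R * (2%:R * x * n%:R))%R by ring.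
rewrite ler_pM2l // ler_wpDl //; by rewrite -{1}[(D%:R)%R]mulr1 ler_wpM2l.
Qed.

Lemma excess_arith (dl d1 : rat) (Y M x y : nat) : (1000%:R * dl <= d1)%R -> (1000%:R * d1 <= 1)%R ->
  (2%:R * Y%:R <= dl * M%:R)%R -> x <= 2 * Y -> y <= Y -> 8 * (420 * x + 112 * y) <= M.
Proof.
move=> h1 h2 h3 h4 h5; rewrite -(ler_nat rat) natrM natrD !natrM.
rewrite -(ler_nat rat) natrM in h4; rewrite -(ler_nat rat) in h5.
have M0 := ler0n rat M.
have e2 := scaled_le M0 h2; have e1 := ler_wpM2r M0 h1; rewrite -[X in (X <= _)%R]mulrA in e1.
move: (dl * M%:R)%R (d1 * M%:R)%R e1 e2 h3 h4 h5 M0; clear h1 h2.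
move: (M%:R)%R (Y%:R)%R (x%:R)%R (y%:R)%R => a b c d u v; lra.
Qed.

Lemma prefix_arith (D n k : nat) : 0 < k -> n <= k ^ 2 ->
  (k%:R + 1 + (2 * D * n)%N%:R / k%:R <= ((2 * D + 2) * k)%N%:R :> rat)%R.
Proof.
move=> k0 h; have kp : (0 < k%:R :> rat)%R by rewrite ltr0n.
have -> : ((2 * D + 2) * k)%N = (k + k + 2 * D * k)%N by lia.
rewrite !natrD; apply: lerD; first by rewrite lerD2l ler1n.
by rewrite ler_pdivrMr // -natrM ler_nat -[X in _ <= X]mulnA leq_mul2l mulnn h orbT.
Qed.

(** * Choice of the parameters *)

Section Core.
Variables (R0 h D : nat).
Let q := 100 * R0.
(** With distances multiplied by [S], every tree edge reaches the first threshold, which is at most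
    2q by [thr0_le]. *)
Let S := 2 * q.

Section Settings.
Variables (n : nat) (om : 'I_n -> nat).

(** Hops shorter than [p_min] have total length at most M / 2^h and can be neglected. From [p_min]
    to M the weights double at most [p_log] times, up to rounding, and a doubling takes at most 200
    levels ([thr_double]). *)
Definition p_log := (trunc_log 2 n).+1 + h.
Definition p_levels := (200 * p_log).+1.
Definition p_min := wt om xpredT %/ (n * 2 ^ h).
Definition p_th := thr q R0 (best_offset om q R0 (wt om xpredT + p_levels).+2).
Definition p_first := level p_th p_min.
(** A power of two between sqrt n and 2 sqrt n, see [prefix_sq]. *)
Definition p_prefix := 2 ^ ((trunc_log 2 n)./2.+1).
(** [D] times a bound on the expected number of rows, so that truncation loses a fraction of at most
    [dl] once [1 <= dl * D]. *)
Definition p_fuel := D * ((2 * D + 2) * p_prefix * (4 + 256 * p_levels)).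

End Settings.

(** An object is drawn with probability at least 1 / 2n per step, so [2 * D * n] lazy steps leave in
    expectation at most a fraction 1 / (D + 1) of the objects alive. *)
Definition core_exp n (r : 'I_n) par lv (om0 : 'I_n -> nat) :=
  let om := fun x => S * om0 x in
  base_exp S r par lv om (p_th om) (fun j => p_th om j %/ 64) (p_first om) (p_levels n)
    (p_min om %/ 16).+1 (p_log n) (p_fuel n) (p_fuel n) (p_fuel n) (p_prefix n) (2 * D * n).

Variables (n : nat) (w : 'I_n -> 'I_n -> nat) (r : 'I_n) (par : 'I_n -> 'I_n) (lv : 'I_n -> nat).
Hypothesis metw : is_int_metric w.
Hypothesis rtd : rooted r par lv.
Variable om0 : 'I_n -> nat.
Hypothesis om0E : forall x, om0 x = w x (par x).
Hypothesis cut0 : forall x u v, sep par x u v -> om0 x <= w u v.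
Hypothesis n2 : 2 <= n.
Hypothesis R0_big : 64 <= R0.
Hypothesis D_pos : 0 < D.

Let om x := S * om0 x.
Let sw u v := S * w u v.
Local Notation M := (wt om xpredT).
Local Notation th := (p_th om).
Let rho j := th j %/ 64.

Let q_pos : 0 < q. Proof. by rewrite /q muln_gt0 (leq_trans _ R0_big). Qed.
Let R0_pos : 0 < R0. Proof. exact: leq_trans R0_big. Qed.
Let off_lt : best_offset om q R0 (M + p_levels n).+2 < R0. Proof. exact: best_offset_lt. Qed.
Let n0 : 0 < n. Proof. exact: ltnW. Qed.

Let thS j : th j < th j.+1. Proof. exact: thrS. Qed.
Let th_big j : 64 * 100 <= th j.
Proof. by apply: leq_trans (thr_ge _ _ _ j) => //; rewrite /q mulnC leq_mul2l. Qed.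
Let th_ratio j : 99 * th j.+1 <= 100 * th j. Proof. exact: thr_ratio. Qed.
Let th_two j : th j.+1 <= 2 * th j. Proof. exact: (thr_two (q := q)). Qed.
Let th_geo m a : th m <= a -> \sum_(j < m.+1) th j.+1 <= 800 * a. Proof. exact: (thr_geo (q := q)). Qed.
Let om_r : om r = 0.
Proof. by case: metw => e _ _ _; rewrite /om om0E (par_root rtd) e muln0. Qed.
Let om0_pos x : x != r -> 0 < om0 x.
Proof.
move=> xr; rewrite om0E; case: metw => _ pos _ _; apply: pos; apply/eqP => e.
by have := lv_par rtd xr; rewrite -e => /n_Sn.
Qed.
Let om_big x : x != r -> S <= om x.
Proof. by move=> /om0_pos h1; rewrite /om -{1}[S]muln1 leq_mul2l h1 orbT. Qed.
Let th0 x : x != r -> th 0 <= om x.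
Proof. by move=> xr; apply: leq_trans (om_big xr); apply: (thr0_le q_pos R0_pos). Qed.
Let rho_pos j : 0 < rho j. Proof. by rewrite divn_gt0 //; apply: leq_trans (th_big j). Qed.
Let rho_le j : 64 * rho j <= th j. Proof. by rewrite mulnC leq_trunc_div. Qed.
Let th_rho j : th j.+1 <= 256 * rho j.
Proof.
have := th_two j; have := ltn_ceil (th j) (isT : 0 < 64); have := rho_pos j.
by rewrite -/(rho j); lia.
Qed.
Let wC u v : sw u v = sw v u. Proof. by case: metw => _ _ e _; rewrite /sw e. Qed.
Let wT u v x : sw u x <= sw u v + sw v x.
Proof. by case: metw => _ _ _ t; rewrite /sw -mulnDr leq_mul2l t orbT. Qed.
Let cut x u v : sep par x u v -> om x <= sw u v.
Proof. by move=> /cut0 h1; rewrite /om /sw leq_mul2l h1 orbT. Qed.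
Let wD u v : sw u v <= dist par om xpredT u v.
Proof. by rewrite dist_scale (dist_ext _ _ _ _ om0E) leq_mul2l (w_le_dist rtd metw) orbT. Qed.

Definition core_prob := pbase S r par lv om th rho (p_first om) (p_levels n)
    (p_min om %/ 16).+1 (p_log n) (p_fuel n) (p_fuel n) (p_fuel n) (p_prefix n) (2 * D * n) w.

Local Notation M0 := (wt om0 xpredT).

Let ME : M = S * M0. Proof. exact: wt_scale. Qed.
Let S_pos : 0 < S. Proof. by rewrite /S muln_gt0. Qed.

Let M0_pos : 0 < M0.
Proof.
have [x xr] : exists x, x != r.
  have : 0 < #|predC1 r| by rewrite cardC1 card_ord; case: (n) n2 => [|[]].
  by case/card_gt0P => x; exists x.
by rewrite /wt (bigD1 x) //= ltn_addr // om0_pos.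
Qed.

Let fuel_pos : 0 < p_fuel n.
Proof. by rewrite /p_fuel !muln_gt0 D_pos expn_gt0 /= !addn_gt0 orbT. Qed.

Let prefix_pos : 0 < p_prefix n. Proof. by rewrite expn_gt0. Qed.

(** Layer by layer: for every t at least as many hops as tree edges have size t or more. *)
Lemma mst_le_TSP : M0 <= TSP w.
Proof.
have om0_r : om0 r = 0 by case: metw => e _ _ _; rewrite om0E (par_root rtd) e.
have [p ->] := best_tour w; rewrite /tour_cost /wt.
pose N := M0 + \sum_(i < n) w (p i) (p (ordS i)).
have h1 x : om0 x <= N by apply: leq_trans (leq_addr _ _); rewrite /wt (bigD1 x) //= leq_addr.
have h2 (i : 'I_n) : w (p i) (p (ordS i)) <= N by apply: leq_trans (leq_addl _ _); rewrite (bigD1 i) //= leq_addr.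
rewrite (layer_sum om0_r h1) (layer_sum om0_r h2); apply: leq_sum => t _.
exact: (big_hops rtd om0_r cut0 (@tour_cyc n p) (ltn0Sn t)).
Qed.

(** A by-product of [cover_structure], as the weight of [C] is nonnegative. *)
Lemma TSP_le_mst : TSP w <= 2 * M0.
Proof.
have [C [_ hC]] := cover_structure metw rtd n0; rewrite (wt_ext _ om0E).
by move: hC; move: (wt _ _) (wt _ _) (TSP w); clear; lia.
Qed.

Lemma core_prob_le Lam : 800 <= Lam ->
  (core_prob * M0%:R <= ((19 + 60 * Lam) * (202 * (2 * M0 - TSP w)))%N%:R)%R.
Proof.
move=> hLam; have [C [cutC hC]] := cover_structure metw rtd n0.
have geo m a : th m <= a -> \sum_(j < m.+1) th j.+1 <= Lam * a.
  by move=> /th_geo ha; apply: leq_trans ha _; rewrite leq_mul2r hLam orbT.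
have cutS u v : 100 * dist par om (fun x => x \notin C) u v <= 101 * sw u v.
  by rewrite dist_scale (dist_ext _ _ _ _ om0E) [_ * (S * _)]mulnCA /sw [101 * _]mulnCA leq_mul2l cutC orbT.
have := pbase_le (p_first om) (p_levels n) (p_log n) (2 * D * n) rtd om_r wC thS th_big th_ratio geo th0 rho_le fuel_pos fuel_pos fuel_pos prefix_pos (ltn0Sn (p_min om %/ 16)) cutS.
rewrite -/core_prob => hp.
have QM : (drawq (slist om) * (S * M0)%N%:R <= 1)%R by rewrite -ME -size_slist; apply: drawq_size.
have hC' : wt om (fun x => x \in C) <= S * (202 * (2 * M0 - TSP w)).
  rewrite wt_scale leq_mul2l; apply/orP; right; move: hC; rewrite !(wt_ext _ om0E).
  by move: (wt _ _) (wt _ _) (TSP w); clear; lia.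
have S0 : (0 < S%:R :> rat)%R by rewrite ltr0n.
rewrite -(ler_pM2l S0).
have Q0 := drawq_gt0 (slist om).
have hp2 : (core_prob <= drawq (slist om) * ((19 + 60 * Lam) * (S * (202 * (2 * M0 - TSP w))))%N%:R)%R.
  by apply: le_trans hp _; rewrite ler_pM2l // ler_nat leq_mul2l hC' orbT.
move: hp2 QM; rewrite mulnCA.
move: ((19 + 60 * Lam) * (202 * (2 * M0 - TSP w))) => c.
rewrite (natrM _ S c) (natrM _ S M0) => hp2 QM.
have SM0 : (0 <= S%:R * M0%:R :> rat)%R by rewrite mulr_ge0.
have := ler_wpM2r SM0 hp2.
have -> : (drawq (slist om) * (S%:R * c%:R) * (S%:R * M0%:R) = (S%:R * c%:R) * (drawq (slist om) * (S%:R * M0%:R)))%R by ring.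
move=> h1; rewrite mulrCA; apply: le_trans h1 _.
by rewrite -[X in (_ <= X)%R]mulr1 ler_wpM2l // mulr_ge0.
Qed.

Lemma core_expP : is_exp w (core_exp r par lv om0) core_prob ((p_fuel n + p_fuel n + p_fuel n) * n).
Proof. exact: base_expP. Qed.

Lemma p_log_big : n * 2 ^ h < 2 ^ p_log n.
Proof. by rewrite /p_log expnD ltn_mul2r expn_gt0 /= trunc_log_ltn. Qed.

Lemma M_lt_min : M < 2 ^ p_log n * (p_min om).+1.
Proof.
have nh : 0 < n * 2 ^ h by rewrite muln_gt0 n0 expn_gt0.
apply: leq_trans (ltn_ceil M nh) _; rewrite mulnC leq_mul2r ltnW ?orbT //; exact: p_log_big.
Qed.

Lemma prefix_sq : n <= p_prefix n ^ 2 <= 4 * n.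
Proof.
rewrite /p_prefix -expnM mulnC mulnS mul2n -[X in 2 + X](addKn (odd (trunc_log 2 n))) odd_double_half.
have /andP[h1 h2] := trunc_log_bounds (isT : 1 < 2) n0.
apply/andP; split.
  apply: leq_trans (ltnW h2) _; rewrite leq_exp2l //.
  by move: (trunc_log 2 n) (odd _) => t [] /=; clear; lia.
rewrite expnD leq_mul2l /=; apply: leq_trans h1; rewrite leq_exp2l //; exact: leq_subr.
Qed.

Lemma core_act t : th 0 <= t -> p_min om <= t -> t <= M -> active (p_first om) (p_levels n) (level th t).
Proof.
move=> h1 h2 h3; rewrite /active /p_first level_mono //=.
have /andP[l1 _] := level_bounds thS h1.
apply: (th_lt_inv thS); apply: leq_ltn_trans (leq_trans l1 h3) _.
apply: leq_trans M_lt_min _.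
apply: leq_trans (leq_mul (leqnn _) (level_lt (p_min om) thS)) _.
by rewrite addnS -addSn; apply: (thr_double q_pos R0_pos).
Qed.

Lemma core_small x d : x != r -> 6 * om x <= d -> 6 * p_min om <= d -> 16 * (p_min om %/ 16).+1 <= d.
Proof.
move=> /om_big h1 h2 h3; have hS : 64 <= S.
  by rewrite /S /q; apply: leq_trans R0_big _; rewrite mulnA leq_pmull.
have := leq_trunc_div (p_min om) 16; move: (_ %/ _) h1 h2 h3 hS => e.
by move: (om x) (p_min om) S; clear; lia.
Qed.

Lemma core_K : M < 16 * (p_min om %/ 16).+1 * 2 ^ p_log n.
Proof.
apply: leq_trans M_lt_min _; rewrite mulnC leq_mul2r mulnC ltn_ceil ?orbT //.
Qed.

Lemma core_prob_ge (N1 : nat) (dl d1 : rat) :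
  (0 < dl)%R -> (1 <= dl * D%:R)%R -> (8%:R <= dl * R0%:R)%R ->
  (forall x, 16 * (3164 * x) <= 2 ^ h * x) -> (forall x, 16 * (3 * x) <= N1 * x) ->
  (16%:R * q%:R <= dl * N1%:R)%R -> N1 * (TSP w - M0) <= M0 ->
  (1000%:R * dl <= d1)%R -> (1000%:R * d1 <= 1)%R -> (dl <= core_prob)%R.
Proof.
move=> dl0 hD hR hh hN hqN hT.
have [p pE] := best_tour w.
have cyc := @tour_cyc n p.
pose dM := S * (TSP w - M0).
have hd : \sum_i hop_len sw p (fun i => p (ordS i)) i <= M + dM.
  rewrite /hop_len /sw -big_distrr /= -/(tour_cost w p) -pE ME -mulnDr leq_mul2l.
  by rewrite subnKC ?leqnn ?orbT // mst_le_TSP.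
have hNM : N1 * dM <= M by rewrite ME mulnCA leq_mul2l hT orbT.
pose J := (M + p_levels n).+1.
have [ch1 ch2] := chi_bound rtd om_r cut cyc q_pos R0_pos th_two J hd.
have hg := best_offset_cost om (M + p_levels n).+2 q_pos R0_pos.
set g := gap_cost _ _ _ _ _ in ch1 ch2 hg.
have Mp : 0 < M by rewrite ME muln_gt0 S_pos M0_pos.
have W_M i : hop_len sw p (fun i => p (ordS i)) i <= M by apply: (W_le_M wD).
have hY : (2%:R * (4 * q * dM + g)%N%:R <= dl * M%:R)%R.
  have a1 : (R0%:R * g%:R <= 2%:R * M%:R :> rat)%R by rewrite -!natrM ler_nat.
  have a2 : (N1%:R * dM%:R <= M%:R :> rat)%R by rewrite -natrM ler_nat.
  exact: (threshold_arith dl0 hqN hR a1 a2).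
have k1 : 16 * (3164 * (#|'I_n| * p_min om)) <= M.
  apply: leq_trans (hh _) _; rewrite card_ord mulnA [2 ^ h * n]mulnC mulnC; exact: leq_trunc_div.
have k2 : 16 * (3 * dM) <= M by apply: leq_trans (hN _) _.
have k4 : ((chi1 om sw p (fun i => p (ordS i)) th J)%:R <= dl * M%:R)%R.
  by apply: le_trans hY; rewrite -natrM ler_nat.
have levJ i : hop_level sw p (fun i => p (ordS i)) th i < J.
  by rewrite ltnS (leq_trans (level_le _ _)) // (leq_trans (W_M i)) ?leq_addr.
have levJ' x : level th (om x) < J.
  rewrite ltnS (leq_trans (level_le _ _)) // (leq_trans _ (leq_addr _ _)) //.
  by rewrite /wt (bigD1 x) //= leq_addr.
have sJ : p_first om + p_levels n <= J.
  by rewrite /J -addSn leq_add2r (leq_trans (level_le _ _)) // /p_min (leq_trans (leq_div _ _)).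
have k5 j : (1 <= dl * (1 + drawq (objs r par lv om th j) * (2 * D * n)%N%:R))%R.
  have := drawq_lb n0 (objs_uniq r par lv om th j); rewrite !natrM.
  exact: (draws_arith dl0 hD (drawq_gt0 _)).
have fuel_ge x : (x <= ((2 * D + 2) * p_prefix n * (4 + 256 * p_levels n))%N%:R -> x <= dl * (p_fuel n)%:R)%R.
  move=> hx; apply: le_trans hx _; rewrite /p_fuel (natrM _ D) mulrA ler_peMl //.
have kp : 0 < (2 * D + 2) * p_prefix n by rewrite muln_gt0 prefix_pos addn_gt0 orbT.
have k6 : ((48 * p_log n)%N%:R <= dl * (p_fuel n)%:R)%R.
  apply: fuel_ge; rewrite ler_nat; apply: leq_trans (leq_pmull _ kp).
  by rewrite /p_levels; move: (p_log n); clear; lia.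
have k7 : ((2 + 256 * p_levels n)%N%:R <= dl * (p_fuel n)%:R)%R.
  by apply: fuel_ge; rewrite ler_nat; apply: leq_trans (leq_pmull _ kp); rewrite leq_add2r.
have k8 : (((p_prefix n)%:R + 1 + (2 * D * n)%N%:R / (p_prefix n)%:R) * (4 + 256 * p_levels n)%N%:R <= dl * (p_fuel n)%:R)%R.
  apply: fuel_ge; rewrite (natrM _ (_ * p_prefix n)); apply: ler_wpM2r; first exact: ler0n.
  have /andP[sq _] := prefix_sq; exact: prefix_arith prefix_pos sq.
move=> hd1 hd2.
have k3 := excess_arith hd1 hd2 hY ch1 ch2.
exact: (pbase_ge rtd om_r wC wT cut wD thS th_big th_ratio th0 rho_pos th_rho fuel_pos fuel_pos fuel_pos prefix_pos
  (ltn0Sn _) cyc core_act sJ levJ core_small core_K levJ' Mp hd dl0 k1 k2 k3 k4 k5 k6 k7 k8 hd1 hd2).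
Qed.

End Core.

(** * The algorithm *)

Local Open Scope ring_scope.

Section InputTree.
Variables (n : nat) (r : 'I_n).
Local Notation V := 'I_n.

(** Exhaustive search over all parent maps; computation without queries is free. *)
Definition tree_par (T : seq (V * V)) : {ffun V -> V} :=
  odflt [ffun=> r] [pick f : {ffun V -> V} |
    [&& f r == r, [forall v, (v != r) ==> tree_rel T v (f v)] & [forall v, fconnect f v r]]].

Definition tree_lv (par : V -> V) v := findex par v r.

Definition tree_om (L : seq (V * V * nat)) (par : V -> V) x : nat :=
  head 0%N [seq e.2 | e <- L & (e.1 == (x, par x)) || (e.1 == (par x, x))].

Lemma tree_parP T (par := tree_par T) : is_spanning_tree T ->
  rooted r par (tree_lv par) /\ (forall v, v != r -> tree_rel T v (par v)).
Proof.
move=> spT; rewrite /par /tree_par; case: pickP => [f /and3P[/eqP fr /forallP fT /forallP fc]|none].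
  split=> [|v vr]; last by have /implyP := fT v; apply.
  split=> // v vr; apply: fconnect_findex; [exact: fc | by rewrite eq_sym].
have [f [lv [rtd hT]]] := spanning_rooted r spT; have := none f.
rewrite (par_root rtd) eqxx /= => /negP[]; apply/andP; split; apply/forallP => v.
  by apply/implyP; apply: hT.
exact: (anc_rootl rtd).
Qed.

Lemma tree_omE w T (par : V -> V) x : is_int_metric w -> par r = r ->
  (forall v, v != r -> tree_rel T v (par v)) -> tree_om (mst_input w T) par x = w x (par x).
Proof.
move=> [w0 _ wC _] pr hT; rewrite /tree_om.
set s := [seq e.2 | e <- _ & _].
have hs y : y \in s -> y = w x (par x).
  move=> /mapP[e]; rewrite mem_filter => /andP[he /mapP[[u v] _ ee]]; rewrite {}ee /= in he *.
  by move=> ->; case/orP: he => /eqP[-> ->]; rewrite // wC.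
case: (posnP (size s)) => [z|].
  have -> : s = [::] by apply/nilP; rewrite /nilp z.
  have [->|xr] := eqVneq x r; first by rewrite pr w0.
  have := hT x xr; rewrite /tree_rel => hh; exfalso.
  have : exists2 e, e \in T & (e == (x, par x)) || (e == (par x, x)).
    by case/orP: hh => hh; [exists (x, par x)|exists (par x, x)]; rewrite // eqxx ?orbT.
  case=> -[u v] eT he.
  have : w u v \in s.
    apply/mapP; exists (u, v, w u v) => //; rewrite mem_filter /= he /=.
    by apply/mapP; exists (u, v).
  by rewrite (size0nil z).
by move=> sp; apply: hs; case: (s) sp => //= y s' _; rewrite inE eqxx.
Qed.

End InputTree.

Lemma majority_both n (w : 'I_n -> 'I_n -> nat) good e p B m s k : is_exp w e p B ->
  success_prob w good (k true) = 1 -> success_prob w good (k false) = 1 ->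
  success_prob w good (majority m s e k) = 1.
Proof.
move=> [_ he _] h1 h2; elim: m s => [|m IH] s /=; first by case: eqP.
by rewrite he !IH; ring.
Qed.

Lemma bernoulli_lb (p : rat) m : 0 <= p <= 1 -> 1 - m%:R * p <= (1 - p) ^+ m.
Proof.
move=> /andP[p0 p1]; elim: m => [|m IH]; first by rewrite mul0r subr0 expr0.
have q0 : 0 <= 1 - p by rewrite subr_ge0.
apply: le_trans (_ : (1 - p) * (1 - m%:R * p) <= _); last by rewrite exprS ler_wpM2l.
have h : 0 <= m%:R * p * p by rewrite !mulr_ge0.
rewrite -natr1; have -> : (1 - p) * (1 - m%:R * p) = 1 - (m%:R + 1) * p + m%:R * p * p by ring.
by rewrite lerDl.
Qed.

Lemma bernoulli_ub (p : rat) m : 0 <= p <= 1 -> (1 - p) ^+ m * (1 + m%:R * p) <= 1.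
Proof.
move=> /andP[p0 p1]; elim: m => [|m IH]; first by rewrite mul0r addr0 expr0 mulr1.
have q0 : 0 <= (1 - p) ^+ m by rewrite exprn_ge0 // subr_ge0.
apply: le_trans IH; rewrite exprSr -mulrA ler_wpM2l //.
rewrite -natr1; have h : 0 <= m%:R * p by rewrite mulr_ge0.
have -> : (1 - p) * (1 + (m%:R + 1) * p) = 1 + m%:R * p - (p * p + m%:R * p * p) by ring.
by rewrite gerBl addr_ge0 // mulr_ge0.
Qed.

Lemma half_pow (n : nat) : (0 < n)%N -> (2%:R^-1) ^+ (trunc_log 2 n).+1 <= (n%:R)^-1 :> rat.
Proof.
move=> n0; rewrite exprVn lef_pV2 ?posrE ?exprn_gt0 ?ltr0n // -natrX ler_nat ltnW //.
by apply: trunc_log_ltn.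
Qed.

Lemma majority_small (p : rat) s : 0 <= p -> 14%:R * p <= 1 ->
  (1 + 7%:R * p) ^+ (2 * s) / 8%:R ^+ s <= 2%:R^-1 ^+ s.
Proof.
move=> p0 p1; rewrite exprM -expr_div_n.
have h : (1 + 7%:R * p) ^+ 2 / 8%:R <= 2%:R^-1.
  rewrite expr2; have a : 1 + 7%:R * p <= 3%:R / 2%:R by lra.
  have a0 : 0 <= 1 + 7%:R * p by lra.
  have := ler_pM a0 a0 a a; move: (_ * _) => x hx; lra.
apply: lerXn2r => //; rewrite ?nnegrE ?divr_ge0 ?exprn_ge0 //; lra.
Qed.

Lemma query_alg1 (f l n m : nat) : (2 * l * (m * ((f + f + f) * n)) = 6 * m * (f * (l * n)))%N.
Proof. lia. Qed.

Lemma query_alg2 (c k l n m : nat) :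
  (6 * m * c * (k * (l ^ 2 * n)) = 6 * m * (c * (k * l) * (l * n)))%N.
Proof. rewrite -mulnn; lia. Qed.

Lemma query_alg3 (a b d n : nat) : (4 * a * (n * d) * b = a * (4 * n * (b * d)))%N.
Proof. lia. Qed.

Lemma yes_arith (eps eps0 M T : rat) : eps0 <= eps -> 2%:R * eps <= 1 -> 0 <= M -> M <= T ->
  (2%:R - eps) * M <= (2%:R - eps0) * T.
Proof.
move=> h1 h2 h3 h4; apply: ler_pM => //; first by lra.
by rewrite lerB.
Qed.

(** If T exceeds (1 + 1/N) M, the answer 2M is below 2N / (N + 1) times T, which leaves room for a
    small [eps0]. *)
Lemma no_arith (eps0 : rat) (N M T : nat) : 2%:R * N%:R <= (2%:R - eps0) * (N%:R + 1) ->
  (0 < N)%N -> (M < N * (T - M))%N -> 2%:R * M%:R <= (2%:R - eps0) * T%:R.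
Proof.
move=> h1 N0 h2; have h3 : (M * N.+1 <= N * T)%N.
  by move: h2; rewrite mulnBr ltn_subRL mulnSr mulnC; move: (N * M)%N (N * T)%N; clear; lia.
have Np : 0 < N.+1%:R :> rat by rewrite ltr0n.
rewrite -(ler_nat rat) !natrM in h3; rewrite -natr1 in h3 Np.
have c0 : 0 <= 2%:R - eps0.
  by rewrite -(pmulr_lge0 _ Np); apply: le_trans h1; rewrite mulr_ge0.
have N0' : 0 < N%:R :> rat by rewrite ltr0n.
rewrite -(ler_pM2r N0').
have := ler_wpM2r (ler0n rat M) h1; have := ler_wpM2l c0 h3.
move: (2%:R - eps0) (N%:R) (M%:R) (T%:R) => c x y z a1 a2.
have e1 : c * (y * (x + 1)) = c * (x + 1) * y by ring.
have e2 : c * (x * z) = c * z * x by ring.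
have e3 : 2%:R * x * y = 2%:R * y * x by ring.
by rewrite e1 e2 in a1; rewrite e3 in a2; apply: le_trans a2 a1.
Qed.

Lemma mid_arith (eps : rat) (M T : nat) : 2%:R * eps <= 1 -> (2 * (T - M) <= M)%N ->
  T%:R <= (2%:R - eps) * M%:R.
Proof.
move=> h1 h2; have h3 : (2 * T <= 3 * M)%N by lia.
rewrite -(ler_nat rat) !natrM in h3.
have := ler_wpM2r (ler0n rat M) h1; rewrite mul1r mulrBl.
by have -> : 2%:R * eps * M%:R = 2%:R * (eps * M%:R) by [rewrite mulrA]; lra.
Qed.

Lemma rep_arith (u x : rat) : u * (1 + x) <= 1 -> 13%:R <= x -> 0 <= u -> 14%:R * u <= 1.
Proof.
move=> h1 h2 u0; apply: le_trans h1; rewrite mulrC ler_wpM2l //; lra.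
Qed.

Lemma majority_yes_small (u : rat) s : 0 <= u -> 14%:R * u <= 1 ->
  (1 + 7%:R * u) ^+ (2 * s) * 8%:R ^+ s / 8%:R ^+ (2 * s).+1 <= 2%:R^-1 ^+ s.
Proof.
move=> u0 u1; apply: le_trans (majority_small s u0 u1).
have e : 8%:R ^+ (2 * s).+1 = 8%:R ^+ s * (8%:R ^+ s * 8%:R) :> rat.
  by rewrite mulrA -exprD addnn -mul2n exprSr.
have n0 : 8%:R ^+ s != 0 :> rat by rewrite expf_neq0.
rewrite e invfM mulrA mulfK // ler_wpM2l //; first by rewrite exprn_ge0 //; lra.
rewrite lef_pV2 ?posrE ?mulr_gt0 ?exprn_gt0 //.
by rewrite -[X in X <= _]mulr1 ler_wpM2l ?exprn_ge0.
Qed.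

Lemma sound_arith (p eps : rat) (c M T : nat) :
  p * M%:R <= (c * (202 * (2 * M - T)))%N%:R -> (2%:R - eps) * M%:R < T%:R ->
  T%:R <= 2%:R * M%:R :> rat -> p <= (c * 202)%N%:R * eps.
Proof.
move=> h1 h2 h3.
have M0 : 0 < M%:R :> rat.
  rewrite lt_neqAle ler0n andbT eq_sym; apply: contraTneq h2 => e.
  by rewrite -leNgt (le_trans h3) // e !mulr0.
have hT : (T <= 2 * M)%N by rewrite -(ler_nat rat) natrM.
rewrite -(ler_pM2r M0); apply: le_trans h1 _.
rewrite mulnA natrM natrB // (natrM _ 2 M) -[X in _ <= X]mulrA ler_wpM2l //.
by move: h2; rewrite mulrBl; move: (M%:R) (T%:R) => x y; lra.
Qed.

Section Algorithm.
Variables (R0 h D m0 : nat) (eps : rat).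

(** [m0] repetitions bring the probability of a positive outcome above 13/14 or below 1/14. The vote
    over [2 * s] of these, with [s] logarithmic, brings the error below 2^-s, at most 1/n. *)
Definition mst_alg : algorithm := fun n =>
  match n return seq ('I_n * 'I_n * nat) -> qprog n with
  | n'.+2 => fun L =>
      let par := tree_par ord0 [seq e.1 | e <- L] in
      let om := tree_om L par in
      let s := (trunc_log 2 n'.+2).+1 in
      majority (2 * s) s (exp_rep m0 (core_exp R0 h D ord0 par (tree_lv ord0 par) om))
        (fun c => Ret _ (if c then (2%:R - eps) * (wt om xpredT)%:R else 2%:R * (wt om xpredT)%:R))
  | _ => fun _ => Ret _ 0
  end.

(** Squaring makes the exponent 1.5 integral. The prefix has square at most 4n, a row contributes n,
    and the number of levels and of votes one logarithm each. *)
Lemma query_arith n (l := (trunc_log 2 n).+1) (f := p_fuel h D n) : (2 <= n)%N ->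
  ((2 * l * (m0 * ((f + f + f) * n))) ^ 2 <=
    4 * (6 * m0 * (D * (2 * D + 2) * (4 + 256 * (201 * h.+1)))) ^ 2 * n ^ 3 * l ^ 4)%N.
Proof.
move=> n2; have /andP[_ sq] := prefix_sq n2.
have l0 : (0 < l)%N by [].
have hm : (p_levels h n <= 201 * h.+1 * l)%N.
  rewrite /p_levels /p_log -/l; have : (l + h <= h.+1 * l)%N by rewrite mulSn leq_add2l leq_pmulr.
  have : (0 < h.+1 * l)%N by rewrite muln_gt0.
  by rewrite -!mulnA; move: (h.+1 * l)%N (l + h)%N; clear; lia.
have hf : (f <= D * (2 * D + 2) * (4 + 256 * (201 * h.+1)) * (p_prefix n * l))%N.
  rewrite /f /p_fuel -!mulnA leq_mul2l; apply/orP; right; rewrite leq_mul2l; apply/orP; right.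
  rewrite mulnCA leq_mul2l; apply/orP; right; rewrite mulnDl leq_add //; first by rewrite leq_pmulr.
  by rewrite -mulnA leq_mul2l hm.
have hq : (2 * l * (m0 * ((f + f + f) * n)) <= 6 * m0 * (D * (2 * D + 2) * (4 + 256 * (201 * h.+1))) * (p_prefix n * (l ^ 2 * n)))%N.
  set c := (D * _ * _)%N in hf *; clearbody c.
  have -> : (2 * l * (m0 * ((f + f + f) * n)) = 6 * m0 * (f * (l * n)))%N.
    exact: query_alg1.
  have -> : (6 * m0 * c * (p_prefix n * (l ^ 2 * n)) = 6 * m0 * (c * (p_prefix n * l) * (l * n)))%N.
    exact: query_alg2.
  by rewrite leq_mul2l leq_mul2r hf !orbT.
apply: leq_trans (_ : (6 * m0 * (D * (2 * D + 2) * (4 + 256 * (201 * h.+1))) * (p_prefix n * (l ^ 2 * n))) ^ 2 <= _)%N.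
  by rewrite leq_exp2r.
move: (6 * _ * _)%N => c; rewrite (expnMn c) (expnMn (p_prefix n)) (expnMn (l ^ 2)) -(expnM l).
have -> : (4 * c ^ 2 * n ^ 3 * l ^ 4 = c ^ 2 * (4 * n * (l ^ 4 * n ^ 2)))%N.
  by rewrite [(n ^ 3)%N]expnS; exact: query_alg3.
by rewrite leq_mul2l; apply/orP; right; apply: leq_mul sq _.
Qed.

Lemma alg_queries n (w : 'I_n -> 'I_n -> nat) (T : seq ('I_n * 'I_n)) : (64 <= R0)%N ->
  is_int_metric w -> is_MST w T ->
  (num_queries w (mst_alg (mst_input w T)) ^ 2 <=
    4 * (6 * m0 * (D * (2 * D + 2) * (4 + 256 * (201 * h.+1)))) ^ 2 * n ^ 3 * (trunc_log 2 n).+1 ^ 4)%N.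
Proof.
case: n w T => [|[|n']] w T R0_big metw mst; [by [] | by [] |].
have n2 : (2 <= n'.+2)%N by [].
have [spT _] := mst; apply: leq_trans (query_arith n2); rewrite leq_exp2r //.
rewrite /mst_alg; lazy beta iota zeta.
have -> : [seq e.1 | e <- mst_input w T] = T.
  by rewrite /mst_input -map_comp -[RHS]map_id; apply: eq_map => -[].
have [rtd hT] := tree_parP ord0 spT.
have omE x := @tree_omE _ ord0 w T _ x metw (par_root rtd) hT.
have hrep := exp_repP m0 (core_expP h D metw rtd omE R0_big).
by rewrite -[X in (_ <= X)%N]addn0; apply: (queries_majority _ _ hrep).
Qed.

Variables (Lam N1 : nat) (eps0 dl d1 : rat).
Hypotheses (R0_big : (64 <= R0)%N) (D_pos : (0 < D)%N) (dl0 : 0 < dl) (hD : 1 <= dl * D%:R).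
Hypotheses (hR : 8%:R <= dl * R0%:R) (hLam : (800 <= Lam)%N).
Hypotheses (hh : forall x, (16 * (3164 * x) <= 2 ^ h * x)%N) (hN : forall x, (16 * (3 * x) <= N1 * x)%N).
Hypothesis hqN : 16%:R * (100 * R0)%N%:R <= dl * N1%:R.
Hypothesis hd : 1000%:R * dl <= d1 /\ 1000%:R * d1 <= 1.
Hypothesis hm0 : 13%:R <= m0%:R * dl.
Hypothesis heps : 14%:R * (m0%:R * (((19 + 60 * Lam) * 202)%N%:R * eps)) <= 1.
Hypotheses (eps_half : 2%:R * eps <= 1) (eps0_le : eps0 <= eps).
Hypothesis (eps0_N : 2%:R * N1%:R <= (2%:R - eps0) * (N1%:R + 1)).

Lemma alg_correct n (w : 'I_n -> 'I_n -> nat) (T : seq ('I_n * 'I_n)) :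
  is_int_metric w -> is_MST w T ->
  1 - (n%:R)^-1 <= success_prob w
    (fun X => ((TSP w)%:R <= X) && (X <= (2%:R - eps0) * (TSP w)%:R)) (mst_alg (mst_input w T)).
Proof.
case: n w T => [|[|n']] w T metw mst.
(* For [n = 0] the inverse of 0 is 0, so the answer 0 must be right with certainty, and it is exact.
   For [n = 1] the required probability is 0. *)
- rewrite /= invr0 subr0 /TSP /tour_cost big_ord0 mulr0 lexx //.
- have /andP[] := success_range w (fun X => ((TSP w)%:R <= X) && (X <= (2%:R - eps0) * (TSP w)%:R)) (mst_alg (mst_input w T)).
  by rewrite invr1 subrr.
have n2 : (2 <= n'.+2)%N by [].
have [spT _] := mst.
rewrite /mst_alg; lazy beta iota zeta.
have -> : [seq e.1 | e <- mst_input w T] = T.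
  by rewrite /mst_input -map_comp -[RHS]map_id; apply: eq_map => -[].
have [rtd hT] := tree_parP ord0 spT.
set par := tree_par ord0 T in rtd hT *; set lv := tree_lv ord0 par in rtd *.
set om := tree_om _ par.
have omE x : om x = w x (par x) by apply: (@tree_omE _ ord0) => //; apply: (par_root rtd).
have cut x u v : sep par x u v -> (om x <= w u v)%N.
  by rewrite omE; apply: (mst_cut spT rtd hT metw mst).
clearbody om par lv.
set M0 := wt om xpredT.
have m1 : (M0 <= TSP w)%N := mst_le_TSP metw rtd omE cut.
have m2 : (TSP w <= 2 * M0)%N := TSP_le_mst metw rtd omE n2.
have hexp := core_expP h D metw rtd omE R0_big.
have [p01 _ _] := hexp.
set p := core_prob _ _ _ _ _ _ _ _ in hexp p01.
have hrep := exp_repP m0 hexp.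
set good := (X in success_prob _ X _); set s := (trunc_log 2 n'.+2).+1; set kk := (X in majority _ _ _ X).
have M0p : 0 <= M0%:R :> rat by apply: ler0n.
have r1 : M0%:R <= (TSP w)%:R :> rat by rewrite ler_nat.
have r2 : (TSP w)%:R <= 2%:R * M0%:R :> rat by rewrite -natrM ler_nat.
have yes_good : (TSP w)%:R <= (2%:R - eps) * M0%:R -> success_prob w good (kk true) = 1.
  move=> hy; rewrite /= /good hy /= -/M0; case: ifP => // /negbT /negP[].
  exact: yes_arith eps0_le eps_half M0p r1.
have no_good : ~~ (N1 * (TSP w - M0) <= M0)%N -> success_prob w good (kk false) = 1.
  move=> hA; rewrite /= /good -/M0 r2 /=; case: ifP => // /negbT /negP[].
  apply: no_arith eps0_N _ _; first by have := hN 1; rewrite !muln1; apply: leq_trans.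
  by rewrite -ltnNge in hA.
have fin (x : rat) : x <= 2%:R^-1 ^+ s -> x <= (n'.+2)%:R^-1.
  by move=> hx; apply: le_trans hx (half_pow (ltn0Sn _)).
have goal_of (x : rat) : 1 - x <= (n'.+2)%:R^-1 -> 1 - (n'.+2)%:R^-1 <= x by move=> hx; rewrite lerBlDr -lerBlDl.
have q01 : 0 <= 1 - (1 - p) ^+ m0 <= 1 by have [] := hrep.
(* Three regimes: near M the vote is probably positive; in the middle range both answers are
   correct, whatever the vote; near 2M it is probably negative. *)
have [hA|hA] := boolP (N1 * (TSP w - M0) <= M0)%N.
  have hp : dl <= p by case: hd; apply: (core_prob_ge metw rtd omE cut n2 R0_big D_pos dl0 hD hR hh hN hqN hA).
  have hy : (TSP w)%:R <= (2%:R - eps) * M0%:R.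
    apply: mid_arith eps_half _; apply: leq_trans hA; rewrite leq_mul2r; apply/orP; right.
    by have := hN 1; rewrite !muln1; apply: leq_trans.
  apply: goal_of; apply: fin; apply: le_trans (majority_yes _ _ hrep (yes_good hy)) _.
  have u0 : 0 <= (1 - p) ^+ m0 by case/andP: p01 => _ h1; rewrite exprn_ge0 // subr_ge0.
  have -> : 1 - (1 - (1 - p) ^+ m0) = (1 - p) ^+ m0 by ring.
  have x13 : 13%:R <= m0%:R * p by exact: le_trans hm0 (ler_wpM2l (ler0n _ _) hp).
  exact: (majority_yes_small _ u0 (rep_arith (bernoulli_ub m0 p01) x13 u0)).
have [hB|hB] := lerP (TSP w)%:R ((2%:R - eps) * M0%:R).
  rewrite (majority_both _ _ hrep (yes_good hB) (no_good hA)) gerBl invr_ge0 ler0n //.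
apply: goal_of; apply: fin; apply: le_trans (majority_no _ _ hrep (no_good hA)) _.
apply: majority_small; first by case/andP: q01.
have hp := core_prob_le h metw rtd omE n2 R0_big D_pos hLam; rewrite -/p -/M0 in hp.
have hc := sound_arith hp hB r2.
apply: le_trans heps; rewrite ler_pM2l //; apply: le_trans (_ : m0%:R * p <= _).
  by have := bernoulli_lb m0 p01; rewrite lerBlDr addrC -lerBlDr.
by rewrite ler_wpM2l.
Qed.

End Algorithm.

Lemma nat_above (x y : rat) : 0 < x -> exists N : nat, y <= x * N%:R.
Proof.
move=> x0; exists (Num.trunc (y / x)).+1; rewrite mulrC -ler_pdivrMr //.
exact: ltW (truncnS_gt _).
Qed.

Theorem theorem1p8 :
  exists eps0 : rat, 0 < eps0 /\
  exists A : algorithm, exists C k : nat,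
    forall (n : nat) (w : 'I_n -> 'I_n -> nat) (T : seq ('I_n * 'I_n)),
      is_int_metric w -> is_MST w T ->
      (* O~(n^1.5) queries on every run: q^2 <= C n^3 (log n + 1)^k *)
      ((num_queries w (A n (mst_input w T))) ^ 2
          <= C * n ^ 3 * (trunc_log 2 n).+1 ^ k)%N /\
      (* with high probability: failure probability at most 1/n *)
      1 - (n%:R)^-1 <=
        success_prob w
          (fun X => ((TSP w)%:R <= X) && (X <= (2 - eps0) * (TSP w)%:R))
          (A n (mst_input w T)).
Proof.
(* Every constant depends only on those fixed before it: [dl] is 10^-6, then come [D], [R0], [N1],
   [m0] and [h]. Only then is [eps] chosen, since soundness has to survive [m0] repetitions. *)
have [d1 [dl [dl0 hd]]] : exists d1 dl : rat, 0 < dl /\ (1000%:R * dl <= d1 /\ 1000%:R * d1 <= 1).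
  have k0 : 0 < 1000%:R :> rat by rewrite ltr0n.
  move: (1000%:R) k0 => k k0; have kn : k != 0 by rewrite lt0r_neq0.
  by exists k^-1, (k^-1 / k); rewrite divr_gt0 ?invr_gt0 // mulrC divfK // divff // !lexx.
have [D hD] := nat_above 1 dl0.
have D_pos : (0 < D)%N by case: D hD => //; rewrite mulr0 ler10.
have [R1 hR1] := nat_above 8%:R dl0.
pose R0 := (R1 + 64)%N.
have hR : 8%:R <= dl * R0%:R by apply: le_trans hR1 _; rewrite ler_pM2l // ler_nat leq_addr.
have R0_big : (64 <= R0)%N by rewrite leq_addl.
clearbody R0; clear hR1 R1.
have [N2 hN2] := nat_above (16%:R * (100 * R0)%N%:R) dl0.
pose N1 := (N2 + 48)%N.
have hN x : (16 * (3 * x) <= N1 * x)%N by rewrite mulnA leq_mul2r leq_addl orbT.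
have hqN : 16%:R * (100 * R0)%N%:R <= dl * N1%:R.
  by apply: le_trans hN2 _; rewrite ler_pM2l // ler_nat leq_addr.
clearbody N1; clear hN2 N2.
have [m0 hm0] := nat_above 13%:R dl0; rewrite mulrC in hm0.
(* 3164 is the coefficient of the short hops in [accounting], and it is below 2^12. *)
have [h hh] : exists h, forall x, (16 * (3164 * x) <= 2 ^ h * x)%N.
  by exists (4 + 12)%N => x; rewrite expnD -mulnA leq_mul2l leq_mul2r orbT.
pose c := ((19 + 60 * 800) * 202)%N; have Ec : c = ((19 + 60 * 800) * 202)%N by [].
clearbody c.
(* Near 2M the summand with [c] keeps the error of [m0] repetitions below 1/14; the 2 ensures that
   [eps] is at most 1/2. *)
pose eps : rat := ((14 * (m0 * c) + 2)%N%:R)^-1.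
have eps_pos : 0 < eps by rewrite invr_gt0 ltr0n addn_gt0 orbT.
have scale (k : nat) : (k <= 14 * (m0 * c) + 2)%N -> k%:R * eps <= 1.
  by move=> hk; rewrite ler_pdivrMr ?ltr0n ?addn_gt0 ?orbT // mul1r ler_nat.
have heps : 14%:R * (m0%:R * (c%:R * eps)) <= 1.
  by rewrite !mulrA -!natrM; apply: scale; rewrite mulnA leq_addr.
have eps_half : 2%:R * eps <= 1 by apply: scale; rewrite leq_addl.
clearbody eps; rewrite Ec in heps; clear Ec scale c.
have Np : 0 < N1.+1%:R :> rat by rewrite ltr0n.
(* The answer 2M may be given as soon as TSP exceeds (1 + 1/N1) M, so the final gain shrinks by a
   factor of order [N1]. *)
pose eps0 := eps / N1.+1%:R.
have eps0_pos : 0 < eps0 by rewrite divr_gt0.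
have eps0_le : eps0 <= eps by rewrite ler_pdivrMr // -{1}[eps]mulr1 ler_pM2l // ler1n.
have eps0N : eps0 * N1.+1%:R = eps by rewrite divfK // lt0r_neq0.
clearbody eps0; rewrite -natr1 in eps0N.
have e1 : 2%:R * N1%:R <= (2%:R - eps0) * (N1%:R + 1) by rewrite mulrBl eps0N; lra.
exists eps0; split=> //; exists (mst_alg R0 h D m0 eps).
exists (4 * (6 * m0 * (D * (2 * D + 2) * (4 + 256 * (201 * h.+1)))) ^ 2)%N, 4%N => n w T metw mst.
split; first exact: alg_queries.
exact: (alg_correct R0_big D_pos dl0 hD hR (leqnn 800) hh hN hqN hd hm0 heps eps_half eps0_le e1 metw mst).
Qed.
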